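(* Let $\Delta:\mathcal{F}\to\mathbb{K}(u)$ be the $\mathbb{K}$-linear map defined on the basis of homogeneous Jack functions by $$\Delta(j_\lambda)=\varpi_\lambda\sum_{s\in\lambda}\frac{1}{u-[s]}.$$ Then for any two nonempty partitions $\mu,\nu$ (of arbitrary sizes), $$\Delta(j_\mu\cdot j_\nu)=\varpi_\mu\varpi_\nu\left(T_{\mu\star\nu}(u)-1\right),$$ where $T_{\mu\star\nu}(u)=\prod_{x\in\mu,\,y\in\nu}N(u-[x+y])$ and $N(u)=\dfrac{(u-[0,0])(u-[1,1])}{(u-[1,0])(u-[0,1])}$.
   Context: Let $\mathbb{K}=\mathbb{C}(\varepsilon_1,\varepsilon_2)$ with $\varepsilon_1,\varepsilon_2$ independent indeterminates. A partition $\lambda=(\lambda_1\ge\lambda_2\ge\dots)$ is identified with its set of boxes $\{(i,j)\in\mathbb{Z}_{\ge0}^2: j<\lambda_{i+1}\}$; $|\lambda|$ is its size. For $s=(s_1,s_2)\in\mathbb{Z}^2$ put $[s]=[s_1,s_2]=s_1\varepsilon_1+s_2\varepsilon_2$. Let $\mathcal{F}=\mathbb{K}[V_1,V_2,\dots]$, identified with the ring of symmetric functions over $\mathbb{K}$ via $p_k=(-\varepsilon_1)^{-1}V_k$ ($p_k$ power sums). With $\alpha=-\varepsilon_2/\varepsilon_1$, the integral form Jack symmetric functions $J_\lambda^{(\alpha)}$ are the unique family which is orthogonal for $\langle p_\mu,p_\nu\rangle_\alpha=\delta_{\mu\nu}z_\mu\alpha^{\ell(\mu)}$, triangular in the monomial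 symmetric functions for the dominance order ($J_\lambda$ involves only $m_\mu$ with $\mu\le\lambda$), and has coefficient of $m_{1^n}$ in $J_\lambda$ equal to $n!$, $n=|\lambda|$. The homogeneous Jack functions are $j_\lambda=(-\varepsilon_1)^{|\lambda|}J_\lambda^{(\alpha)}|_{p_k=(-\varepsilon_1)^{-1}V_k}\in\mathcal{F}$; they form a $\mathbb{K}$-basis of $\mathcal{F}$. Finally $\varpi_\lambda=\prod_{b\in\lambda,\,b\ne(0,0)}[b]$ (empty product equal to $1$). *)

(* Defs.v *)
From HB Require Import structures.
From mathcomp Require Import all_boot all_order all_algebra.
From mathcomp Require Import finmap complex reals.
(* [monalg] and [mpoly] share many names and notations.  Importing [mpoly] last
   gives it the unqualified ones; those of [monalg] are written qualified.
   The notation {mpoly R[n]} nevertheless resolves to [monalg] in type_scope,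
   hence the explicit [mpoly n R]. *)
From mathcomp Require Import monalg mpoly.

Set Implicit Arguments.
Unset Strict Implicit.
Unset Printing Implicit Defensive.

Import GRing.Theory Num.Theory.
Local Open Scope ring_scope.

Definition is_intpart (s : seq nat) : bool := sorted geq s && (0%N \notin s).

Record intpart : Type := IntPart { parts :> seq nat; _ : is_intpart parts }.

HB.instance Definition _ := [isSub for parts].
HB.instance Definition _ := [Choice of intpart by <:].

Fact ones_subproof (n : nat) : is_intpart (nseq n 1%N).
Proof.
apply/andP; split; last by rewrite mem_nseq andbF.
by case: n => //= n; elim: n => //= n ->.
Qed.

Definition ones (n : nat) : intpart := IntPart (ones_subproof n).

(* Dominance order mu <= la.  [take k] returns the whole sequence when [k]
   exceeds its length, i.e. missing parts count as 0. *)
Definition dominated (mu la : intpart) : Prop :=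
  sumn mu = sumn la /\ forall k : nat, (sumn (take k mu) <= sumn (take k la))%N.

Definition boxes (la : intpart) : seq (int * int) :=
  [seq (i%:Z, j%:Z) | i <- iota 0 (size la), j <- iota 0 (nth 0%N la i)].

(* Polynomials over K in countably many variables X_1, X_2, ...  The variables
   are indexed by nat with a shift: index k stands for X_{k+1}.
   This ring is used both for K[p_1, p_2, ...], the symmetric functions over a
   field of characteristic 0 written in the power sums, and for
   K[V_1, V_2, ...]. *)
Definition pvar (K : fieldType) (k : nat) : {malg K[{cmonom nat}]} :=
  << monalg.ucm k >>.

Definition peval (K : fieldType) (S : comNzRingType) (c : K -> S)
    (v : nat -> S) (f : {malg K[{cmonom nat}]}) : S :=
  monalg.mmap c (fun m : {cmonom nat} => \prod_(k <- finsupp m) v k ^+ m k) f.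

(* Restriction of a symmetric function to the N variables x_1, ..., x_N. *)
Definition symrestr (K : fieldType) (N : nat) (f : {malg K[{cmonom nat}]}) :
    mpoly N K :=
  peval (@mpolyC N K) (fun k => \sum_(i < N) 'X_i ^+ k.+1) f.

(* The monomial symmetric polynomial m_mu(x_1, ..., x_N); it is the sum of the
   monomials whose nonzero exponents are, up to order, the parts of mu. *)
Definition msympoly (K : fieldType) (N : nat) (mu : intpart) : mpoly N K :=
  \sum_(m : 'X_{1..N < (sumn mu).+1} |
          perm_eq [seq e <- (m : 'X_{1..N}) | e != 0%N] mu) 'X_[m].

(* f = sum_mu c_mu m_mu in the ring of symmetric functions, where equality means
   equality of the restrictions to any finite number of variables. *)
Definition is_mexpansion (K : fieldType) (f : {malg K[{cmonom nat}]})
    (c : {malg K[intpart]}) : Prop :=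
  forall N : nat, symrestr N f =
    \sum_(mu <- monalg.msupp c) monalg.mcoeff mu c *: msympoly K N mu.

(* A monomial m in the power sums is p_mu for the partition mu in which k+1 has
   multiplicity m k; so z_mu is [zee m] and l(mu) is [monalg.mdeg m]. *)
Definition zee (m : {cmonom nat}) : nat :=
  (\prod_(k <- finsupp m) (k.+1 ^ m k * (m k)`!))%N.

Definition jack_form (K : fieldType) (alpha : K)
    (f g : {malg K[{cmonom nat}]}) : K :=
  \sum_(m <- monalg.msupp f) monalg.mcoeff m f * monalg.mcoeff m g *
    ((zee m)%:R * alpha ^+ monalg.mdeg m).

Definition is_jack_family (K : fieldType) (alpha : K)
    (J : intpart -> {malg K[{cmonom nat}]}) : Prop :=
  (forall la mu : intpart, la <> mu -> jack_form alpha (J la) (J mu) = 0) /\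
  (forall la : intpart, exists c : {malg K[intpart]},
    [/\ is_mexpansion (J la) c,
        forall mu : intpart, mu \in monalg.msupp c -> dominated mu la
      & monalg.mcoeff (ones (sumn la)) c = ((sumn la)`!)%:R]).

Definition hjack (K : fieldType) (e1 : K)
    (J : intpart -> {malg K[{cmonom nat}]}) (la : intpart) :
    {malg K[{cmonom nat}]} :=
  (- e1) ^+ sumn la *:
    peval (fun c : K => c *: 1) (fun k => (- e1)^-1 *: pvar K k) (J la).

Definition Kconst (K : fieldType) (c : K) : {fraction {poly K}} :=
  tofrac c%:P.

HB.instance Definition _ (K : fieldType) :=
  GRing.RMorphism.copy (@Kconst K) (@tofrac {poly K} \o @polyC K).

Definition uvar (K : fieldType) : {fraction {poly K}} := tofrac 'X.

Definition brak (K : fieldType) (e1 e2 : K) (s : int * int) : K :=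
  s.1%:~R * e1 + s.2%:~R * e2.

Definition varpi (K : fieldType) (e1 e2 : K) (la : intpart) : K :=
  \prod_(b <- boxes la | b != (0, 0)) brak e1 e2 b.

Definition Nfun (K : fieldType) (e1 e2 : K) (z : {fraction {poly K}}) :
    {fraction {poly K}} :=
  ((z - Kconst (brak e1 e2 (0, 0))) * (z - Kconst (brak e1 e2 (1, 1)))) /
  ((z - Kconst (brak e1 e2 (1, 0))) * (z - Kconst (brak e1 e2 (0, 1)))).

Definition starT (K : fieldType) (e1 e2 : K) (mu nu : intpart) :
    {fraction {poly K}} :=
  \prod_(x <- boxes mu) \prod_(y <- boxes nu)
    Nfun e1 e2 (uvar K - Kconst (brak e1 e2 (x + y))).

(* C(eps_1, eps_2), with C = R[i] for a model R of the real numbers. *)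
Definition Keps (R : realType) : fieldType := {fraction (mpoly 2 R[i])}.
Definition eps1 (R : realType) : Keps R := tofrac 'X_0.
Definition eps2 (R : realType) : Keps R := tofrac 'X_1.

(* Main.v *)
From HB Require Import structures.
Require Import Defs.
From mathcomp Require Import all_boot all_order all_algebra.
From mathcomp Require Import finmap complex reals.
From mathcomp Require Import monalg mpoly.
From mathcomp Require Import ring zify.
From mathcomp Require boolp.

Set Implicit Arguments.
Unset Strict Implicit.
Unset Printing Implicit Defensive.

Import GRing.Theory Num.Theory.
Local Open Scope ring_scope.

(** A basis of a Fock module indexed by partitions is specified by two vertex
    functions [up] and [dn], the coefficients of p_1 and of d/dp_1.  For Jack
    functions they are residues of explicit rational functions in the weights
    [i,j], and partial fractions give the commutation relations of p_1 and of
    E = sum_k k p_(k+1) d_k with their adjoints.  Since p_1 and E generate all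
    symmetric functions from 1, such a module is a copy of the ring of symmetric
    functions; transporting its basis gives functions j_la with
      p_1 j_la = sum_i up_i j_(la+i),   E j_la = sum_i up_i [i,la_i]/e2 j_(la+i),
    and a dual basis for the Jack form.  Removing variables one at a time removes
    horizontal strips, hence the j_la are triangular in the monomial functions,
    and they are the Jack functions.
    On the values Delta(j_la) partial fractions give
      Delta(e2 E f) = u Delta(p_1 f) - e1 e2 deg(f) Delta(f).
    The bilinear form B(j_mu, j_nu) given by the right-hand side satisfies
      B(p_1 f, g) = B(f, p_1 g),
      B(e2 E f, g) + B(f, e2 E g) = u B(p_1 f, g) - e1 e2 (deg f + deg g) B(f, g),
    as does Delta(f g), and both agree when g = p_1, hence everywhere. *)

(** * Divided differences and row coefficients *)

(** The family [J] is given only by orthogonality, triangularity and normalisation, so neither its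
    Pieri coefficients nor its norms are at hand. A basis with known coefficients is therefore
    built, and [J] is recognised as that basis afterwards. The dual basis comes from a second module
    on the same space, with transposed vertex functions; pairing the two modules replaces any
    computation of norms.

    Words in p_1 and E satisfy relations, so no map out of the symmetric functions can be defined on
    words directly: [fockrel] only relates elements built by the same words, and the pairing shows
    that every basis vector has exactly one partner.

    Triangularity is compared in the lexicographic order, which is total and extends dominance.

    The bilinear identities live on the ideal of functions without constant term, because for an
    empty partition the right-hand side of the formula is 0. The passage from g = p_1 to all g rests
    on k p_(k+1) being the commutator of E with multiplication by p_k: self-adjointness of p_k then
    passes to p_(k+1). *)

Section DividedDifferences.
Variable K : fieldType.
Implicit Types xs ys : seq K.

(** For distinct nodes [xs], the divided difference of the polynomial with roots [ys], or the sum of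
    the residues of the quotient of the two products. *)
Definition divdiff xs ys : K :=
  \sum_(x <- xs) (\prod_(y <- ys) (x - y)) / \prod_(z <- xs | z != x) (x - z).

Lemma divdiff1 x ys : divdiff [:: x] ys = \prod_(y <- ys) (x - y).
Proof. by rewrite /divdiff big_seq1 big_cons big_nil eqxx divr1. Qed.

Lemma divdiff_perm xs xs' ys : perm_eq xs xs' -> divdiff xs ys = divdiff xs' ys.
Proof.
move=> pxs; rewrite /divdiff (perm_big _ pxs); apply: eq_bigr => x _.
by rewrite (perm_big _ pxs).
Qed.

(** Split x - y as (x - x0) + (x0 - y): the first summand cancels the node [x0], the second is
    constant. *)
Lemma divdiff_cons x0 xs y ys : uniq (x0 :: xs) ->
  divdiff (x0 :: xs) (y :: ys) =
    divdiff xs ys + (x0 - y) * divdiff (x0 :: xs) ys.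
Proof.
move=> /= /andP[nx0 _]; rewrite /divdiff mulr_sumr [in LHS]big_cons.
rewrite [\sum_(_ <- x0 :: xs) (x0 - y) * _]big_cons.
rewrite addrCA; congr (_ + _); first by rewrite big_cons mulrA.
rewrite -big_split /=; apply: eq_big_seq => x xin.
have nx : x0 != x by apply: contraNneq nx0 => ->.
have nx' : x - x0 != 0 by rewrite subr_eq0 eq_sym.
rewrite !big_cons nx /= invfM.
set A := \prod_(_ <- ys) _; set B := (\prod_(_ <- xs | _) _)^-1.
by rewrite -[A * B in RHS](mulKf nx'); ring.
Qed.

(** Expanding the divided difference with the single root [x1], once from the node [x0] and once
    from [x1], gives Newton's recursion: (x0 - x1) times the value on all nodes is a difference of
    two values on one node fewer, equal by induction. *)
Lemma divdiff_nil xs : uniq xs -> (1 < size xs)%N -> divdiff xs [::] = 0.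
Proof.
have [n] := ubnP (size xs); elim: n xs => // n IHn [|x0 [|x1 s]] //= sz ux _.
have nx : x0 - x1 != 0.
  by move: ux; rewrite subr_eq0 inE negb_or => /andP[/andP[]].
have p01 : perm_eq [:: x0, x1 & s] [:: x1, x0 & s].
  by apply/permP => a /=; rewrite addnCA.
have u10 : uniq [:: x1, x0 & s] by rewrite -(perm_uniq p01).
have E : divdiff (x0 :: s) [::] =
    divdiff (x1 :: s) [::] + (x0 - x1) * divdiff [:: x0, x1 & s] [::].
  rewrite -divdiff_cons // (divdiff_perm _ p01) divdiff_cons //.
  by rewrite subrr mul0r addr0.
apply: (mulfI nx); rewrite mulr0; apply: (addrI (divdiff (x1 :: s) [::])).
rewrite addr0 -E; case: s => [|x2 s] in sz ux p01 u10 E *.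
  by rewrite !divdiff1 !big_nil.
have [/= u0 u1] : uniq (x0 :: x2 :: s) /\ uniq (x1 :: x2 :: s).
  by move: ux u10 => /=; rewrite ![_ \in _ :: _ :: _]inE !(negb_or (_ == _)) => /andP[/andP[_ a] /andP[_ b]] /andP[/andP[_ c] _]; rewrite a b c.
by rewrite !IHn //=; case: sz.
Qed.

Definition psum xs ys k : K := \sum_(x <- xs) x ^+ k - \sum_(y <- ys) y ^+ k.

Lemma psum_cons x xs y ys k :
  psum (x :: xs) (y :: ys) k = x ^+ k - y ^+ k + psum xs ys k.
Proof. by rewrite /psum !big_cons; ring. Qed.

Lemma psum_consl x xs ys k : psum (x :: xs) ys k = x ^+ k + psum xs ys k.
Proof. by rewrite /psum !big_cons; ring. Qed.

(* The divided difference is the complete homogeneous function h_d of the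
   virtual alphabet [xs - ys], written in power sums. *)
Lemma divdiffE xs ys : uniq xs ->
  [/\ ((size ys).+1 < size xs)%N -> divdiff xs ys = 0,
      (size ys).+1 = size xs -> divdiff xs ys = 1,
      size ys = size xs -> divdiff xs ys = psum xs ys 1,
      size ys = (size xs).+1 ->
        divdiff xs ys *+ 2 = psum xs ys 1 ^+ 2 + psum xs ys 2
    & size ys = (size xs).+2 ->
        divdiff xs ys *+ 6 = psum xs ys 1 ^+ 3 +
           psum xs ys 1 * psum xs ys 2 *+ 3 + psum xs ys 3 *+ 2].
Proof.
elim: ys xs => [|y ys IHys] [|x0 xs] u0.
- by split=> //; rewrite /divdiff /psum !big_nil subrr.
- split=> //= sz; first exact: divdiff_nil.
  case: xs sz u0 => // _ _.
  by rewrite divdiff1 big_nil.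
- split=> //= sz; rewrite /divdiff /psum !big_nil.
  + by case: ys sz {IHys} => // _; rewrite !big_seq1; ring.
  + by case: ys sz {IHys} => [|y2 []] // _; rewrite !big_cons !big_nil; ring.
- have ux : uniq xs by case/andP: u0.
  have [Z0 Z1 Z2 Z3 Z4] := IHys _ u0; have [W0 W1 W2 W3 W4] := IHys _ ux.
  split=> /= sz; rewrite divdiff_cons // ?psum_cons.
  + by rewrite W0 ?Z0 ?mulr0 ?addr0 //=; lia.
  + by rewrite W1 ?Z0 ?mulr0 ?addr0 //=; lia.
  + by rewrite W2 ?Z1 //=; [ring|lia].
  + have w := W3 ltac:(lia); have z := Z2 ltac:(rewrite /=; lia).
    by rewrite mulrnDl w z psum_consl; ring.
  + have w := W4 ltac:(lia); have z := Z3 ltac:(rewrite /=; lia).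
    rewrite mulrnDl w; set D := divdiff (x0 :: xs) ys in z *.
    have -> : (x0 - y) * D *+ 6 = (x0 - y) * (D *+ 2) *+ 3 by ring.
    by rewrite z !psum_consl; ring.
Qed.
End DividedDifferences.

Definition weight (K : fieldType) (e1 e2 : K) (i j : nat) : K :=
  i%:R * e1 + j%:R * e2.

(** The form in which the independence of the two parameters enters: it separates the ends of
    distinct rows and forces characteristic zero. *)
Definition generic (K : fieldType) (e1 e2 : K) : Prop :=
  forall i j k l : nat, weight e1 e2 i j = weight e1 e2 k l -> i = k /\ j = l.

Definition incr (r : nat -> nat) (i k : nat) : nat := r k + (k == i).
Definition decr (r : nat -> nat) (i k : nat) : nat := r k - (k == i).

Section RowCoefficients.
Variables (K : fieldType) (e1 e2 : K).
Hypothesis gen : generic e1 e2.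
Implicit Types (r : nat -> nat) (N i j k : nat).

Local Notation eb := (e1 + e2).

Lemma gen_e1 : e1 != 0.
Proof.
by apply/eqP => z; have := @gen 1 0 0 0; rewrite /weight z !mulr0 mul0r => /(_ erefl)[].
Qed.

Lemma gen_e2 : e2 != 0.
Proof.
by apply/eqP => z; have := @gen 0 1 0 0; rewrite /weight z !mulr0 mul0r => /(_ erefl)[].
Qed.

Lemma gen_eb : eb != 0.
Proof.
apply/eqP => z; have := @gen 1 1 0 0.
by rewrite /weight !mul1r z !mul0r addr0 => /(_ erefl)[].
Qed.

Lemma gen_nat n : (n.+1%:R : K) != 0.
Proof.
apply/eqP => z; have := @gen n.+1 0 0 0.
by rewrite /weight z !mul0r => /(_ erefl)[].
Qed.

(** Weight of the first free box of row [i]; the last box of a nonempty row has weight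
    [rowend r i - e2]. *)
Definition rowend r i : K := weight e1 e2 i (r i).

Local Notation a := rowend.

Lemma rowend_incr r i : a (incr r i) i = a r i + e2.
Proof. by rewrite /rowend /weight /incr eqxx /= natrD; ring. Qed.

Lemma rowend_incrN r i k : k != i -> a (incr r i) k = a r k.
Proof. by rewrite /rowend /incr => /negPf ->; rewrite addn0. Qed.

Lemma rowend_decr r i : (0 < r i)%N -> a (decr r i) i = a r i - e2.
Proof. by rewrite /rowend /weight /decr eqxx => ri /=; rewrite natrB //; ring. Qed.

Lemma rowend_decrN r i k : k != i -> a (decr r i) k = a r k.
Proof. by rewrite /rowend /decr => /negPf ->; rewrite subn0. Qed.

(* [up_coef] is the residue at [a r i] of
   G(z) = prod_(k < N) (z - a r k - e1) / prod_(k <= N) (z - a r k), and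
   [e1 * e2 * dn_coef] the residue of 1 / G(z) at [a r j + e1]; row [N] is meant
   to be empty. *)
Definition up_coef r N i : K :=
  (\prod_(k <- iota 0 N) (a r i - (a r k + e1))) /
  \prod_(k <- iota 0 N.+1 | k != i) (a r i - a r k).

Definition dn_coef r N j : K :=
  e2^-1 * ((\prod_(k <- iota 0 N.+1 | k != j) (a r j + e1 - a r k)) /
           \prod_(k <- iota 0 N | k != j) (a r j - a r k)).

Lemma rowend_inj r : injective (a r).
Proof. by move=> i k /gen[]. Qed.

Lemma rowend_neq r r' i k n : i != k -> a r i != a r' k + n%:R * e2.
Proof.
move=> ik; apply/eqP => E; move/eqP: ik; apply.
have /gen[] // : weight e1 e2 i (r i) = weight e1 e2 k (r' k + n).
by rewrite -/(a r i) E /rowend /weight natrD; ring.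
Qed.

Lemma rowend_neqN r i k n : i != k -> a r i - a r k + n%:R * e2 != 0.
Proof.
move=> ik; have := @rowend_neq r r k i n; rewrite eq_sym => /(_ ik).
by apply: contra_neq => E; rewrite -[LHS](addr0) -E; ring.
Qed.

Lemma rowend_neq0 r i k : i != k -> a r i - a r k != 0.
Proof. by move=> /(@rowend_neqN r _ _ 0); rewrite mul0r addr0. Qed.

Definition rowends r N := [seq a r k | k <- iota 0 N].
Definition rowtops r N := [seq a r k + e1 | k <- iota 0 N].

Lemma size_rowends r N : size (rowends r N) = N.
Proof. by rewrite size_map size_iota. Qed.

Lemma rowends_uniq r N : uniq (rowends r N).
Proof. by rewrite map_inj_uniq ?iota_uniq //; apply: rowend_inj. Qed.

Lemma rowtops_uniq r N : uniq (rowtops r N).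
Proof.
rewrite map_inj_uniq ?iota_uniq // => i k /addIr; exact: rowend_inj.
Qed.

(** Roots equal to zero become powers of the node, so moments of residues are again divided
    differences and fall under [divdiffE]. *)
Lemma divdiff_nseq0 (xs ys : seq K) m : divdiff xs (nseq m 0 ++ ys) =
  \sum_(x <- xs) x ^+ m *
    ((\prod_(y <- ys) (x - y)) / \prod_(z <- xs | z != x) (x - z)).
Proof.
apply: eq_bigr => x _; rewrite big_cat /= mulrA; congr (_ * _ / _).
by elim: m => [|m IHm]; rewrite ?big_nil ?expr0 // big_cons IHm subr0 exprS.
Qed.

Lemma psum_nseq0 (xs ys : seq K) m k : psum xs (nseq m 0 ++ ys) k.+1 = psum xs ys k.+1.
Proof.
rewrite /psum big_cat /=; congr (_ - _).
by rewrite big1_seq ?add0r // => x /andP[_ /nseqP[-> _]]; rewrite expr0n.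
Qed.

Lemma sum_cup r N m : \sum_(i <- iota 0 N.+1) up_coef r N i * a r i ^+ m =
  divdiff (rowends r N.+1) (nseq m 0 ++ rowtops r N).
Proof.
rewrite divdiff_nseq0 big_map; apply: eq_bigr => i _.
rewrite mulrC /up_coef; congr (_ * (_ / _)); first by rewrite big_map.
by rewrite big_map; apply: eq_bigl => k; rewrite (inj_eq (@rowend_inj r)).
Qed.

Lemma psum_rows1 r N : r N = 0%N -> psum (rowends r N.+1) (rowtops r N) 1 = 0.
Proof.
move=> rN; rewrite /psum /rowends /rowtops -addn1 iotaD map_cat big_cat big_seq1 /=.
rewrite add0n !big_map -addrA addrCA -sumrB.
under eq_bigr do rewrite !expr1 opprD addrA subrr add0r.
by rewrite big_tnth sumr_const card_ord size_iota expr1 /rowend /weight rN mulNrn -mulr_natl; ring.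
Qed.

Lemma sum_rowends r N : (\sum_(k <- iota 0 N) a r k) *+ 2 =
  N%:R * (N%:R - 1) * e1 + (\sum_(k <- iota 0 N) r k)%:R * e2 *+ 2.
Proof.
elim: N => [|N IHN]; first by rewrite !big_nil; ring.
rewrite -addn1 iotaD !big_cat !big_seq1 mulrnDl {}IHN /= !add0n.
by rewrite /rowend /weight !natrD; ring.
Qed.

Lemma sum_sqrB r N : \sum_(k <- iota 0 N) (a r k ^+ 2 - (a r k + e1) ^+ 2) =
  - (N%:R ^+ 2 * e1 ^+ 2 + (\sum_(k <- iota 0 N) r k)%:R * e2 * e1 *+ 2).
Proof.
elim: N => [|N IHN]; first by rewrite !big_nil; ring.
rewrite -addn1 iotaD !big_cat !big_seq1 {}IHN /= !add0n.
by rewrite /rowend /weight !natrD; ring.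
Qed.

Lemma psum_rows2 r N : r N = 0%N -> psum (rowends r N.+1) (rowtops r N) 2 =
  - ((\sum_(k <- iota 0 N) r k)%:R * e2 * e1 *+ 2).
Proof.
move=> rN; rewrite /psum /rowends /rowtops -addn1 iotaD map_cat big_cat big_seq1 /=.
rewrite add0n !big_map -addrA addrCA -sumrB sum_sqrB.
by rewrite /rowend /weight rN; ring.
Qed.

Lemma mulrn2I (x y : K) : x *+ 2 = y *+ 2 -> x = y.
Proof. by rewrite -(mulr_natl x) -(mulr_natl y) => /(mulfI (gen_nat 1)). Qed.

(** These are h_0, h_1, h_2 of the alphabet of row ends minus row tops, whose first two power sums
    are 0 and -2 e1 e2 |r|. *)
Lemma up_coef_moments r N : r N = 0%N ->
  [/\ \sum_(i <- iota 0 N.+1) up_coef r N i = 1,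
      \sum_(i <- iota 0 N.+1) up_coef r N i * a r i = 0
    & \sum_(i <- iota 0 N.+1) up_coef r N i * a r i ^+ 2 =
      - (e1 * e2) * (\sum_(k <- iota 0 N) r k)%:R].
Proof.
move=> rN; have P1 := psum_rows1 rN; have P2 := psum_rows2 rN.
have D m := divdiffE (nseq m 0 ++ rowtops r N) (rowends_uniq r N.+1).
have sz m : size (nseq m (0 : K) ++ rowtops r N) = (m + N)%N.
  by rewrite size_cat size_nseq size_map size_iota.
have sz' : size (rowends r N.+1) = N.+1 by rewrite size_map size_iota.
split.
- rewrite (eq_bigr (fun i => up_coef r N i * a r i ^+ 0)); last by move=> i _; rewrite mulr1.
  by rewrite sum_cup; case: (D 0%N) => _ -> //; rewrite sz sz'.
- rewrite (eq_bigr (fun i => up_coef r N i * a r i ^+ 1)) //.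
  by rewrite sum_cup; case: (D 1%N) => _ _ -> //; rewrite ?sz ?sz' // psum_nseq0.
rewrite sum_cup; case: (D 2%N) => _ _ _ + _.
rewrite sz sz' add2n !psum_nseq0 P1 P2 => /(_ erefl) E.
by apply: mulrn2I; rewrite E; ring.
Qed.

(** With [v] as an additional node, the degree of the numerator is two less than the number of nodes
    and the divided difference vanishes. Its term at [v] is the right-hand side, the others are the
    left-hand side up to sign. *)
Lemma up_coef_partfrac r N v : (forall i, v != a r i) ->
  \sum_(i <- iota 0 N.+1) up_coef r N i / (v - a r i) =
  (\prod_(k <- iota 0 N) (v - (a r k + e1))) / \prod_(k <- iota 0 N.+1) (v - a r k).
Proof.
move=> nv; have vn : v \notin rowends r N.+1.
  by apply/mapP => -[i _ /eqP]; rewrite (negPf (nv i)).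
have u : uniq (v :: rowends r N.+1) by rewrite cons_uniq vn rowends_uniq.
have [+ _ _ _ _] := divdiffE (rowtops r N) u.
have -> : size (v :: rowends r N.+1) = N.+2 by rewrite -[N.+1 in RHS](size_rowends r).
rewrite size_map size_iota => /(_ (leqnn _)) E0.
move: E0; rewrite /divdiff big_cons => /eqP; rewrite addr_eq0 => /eqP E.
symmetry; move: E; rewrite big_cons eqxx !big_map.
have -> : \prod_(j <- iota 0 N.+1 | a r j != v) (v - a r j) =
    \prod_(j <- iota 0 N.+1) (v - a r j).
  by apply: eq_bigl => i; rewrite eq_sym nv.
move=> ->; rewrite -sumrN; apply: eq_bigr => i _.
rewrite big_cons nv !big_map /up_coef.
have -> : \prod_(j <- iota 0 N.+1 | a r j != a r i) (a r i - a r j) =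
    \prod_(j <- iota 0 N.+1 | j != i) (a r i - a r j).
  by apply: eq_bigl => k; rewrite (inj_eq (@rowend_inj r)).
rewrite invfM -[v - a r i]opprB invrN; ring.
Qed.

Lemma prod_iotaD1 (F : nat -> K) N j : (j < N)%N ->
  \prod_(k <- iota 0 N) F k = F j * \prod_(k <- iota 0 N | k != j) F k.
Proof. by move=> jN; rewrite (bigD1_seq j) ?iota_uniq // mem_iota. Qed.

Lemma prod_iotaD2 (F : nat -> K) N i j : (j < N)%N -> i != j ->
  \prod_(k <- iota 0 N | k != i) F k =
  F j * \prod_(k <- iota 0 N | (k != i) && (k != j)) F k.
Proof.
move=> jN ij; rewrite (bigID (pred1 j)) /=; congr (_ * _).
rewrite (eq_bigl (pred1 j)); last by move=> k /=; case: (k =P j) => [->|_]; rewrite ?andbF // eq_sym ij.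
by rewrite -big_filter filter_pred1_uniq ?iota_uniq ?mem_iota // big_seq1.
Qed.

(** Exchanging nodes and roots negates the power sums; the residues of 1 / G therefore sum to h_2 of
    the opposite alphabet, which is e1 e2 |r|. *)
Lemma sum_dn_coef r N : r N = 0%N ->
  \sum_(j <- iota 0 N) dn_coef r N j = (\sum_(k <- iota 0 N) r k)%:R.
Proof.
move=> rN; have P1 := psum_rows1 rN; have P2 := psum_rows2 rN.
have [_ _ _ + _] := divdiffE (rowends r N.+1) (rowtops_uniq r N).
rewrite !size_map !size_iota => /(_ erefl).
have PN k : psum (rowtops r N) (rowends r N.+1) k = - psum (rowends r N.+1) (rowtops r N) k.
  by rewrite /psum opprB.
rewrite !PN P1 P2 => E.
have {E} E : divdiff (rowtops r N) (rowends r N.+1) =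
   (\sum_(k <- iota 0 N) r k)%:R * e2 * e1 by apply: mulrn2I; rewrite E; ring.
apply: (mulfI gen_e2); apply: (mulfI gen_e1).
rewrite [RHS](_ : _ = (\sum_(k <- iota 0 N) r k)%:R * e2 * e1); last by ring.
rewrite -E /divdiff big_map !mulr_sumr; apply: eq_big_seq => j.
rewrite mem_iota /= add0n => jN.
rewrite !big_map (@prod_iotaD1 _ _ j); last by rewrite ltnS ltnW.
have -> : \prod_(k <- iota 0 N | a r k + e1 != a r j + e1) (a r j + e1 - (a r k + e1))
        = \prod_(k <- iota 0 N | k != j) (a r j - a r k).
  apply: eq_big => [k|k _]; first by rewrite (inj_eq (addIr _)) (inj_eq (@rowend_inj r)).
  by ring.
rewrite /dn_coef mulVKf ?gen_e2 //.
by rewrite mulrA; congr (_ * _ / _); ring.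
Qed.

(** Only the factors coupling rows [i] and [j] notice the order of the two moves; [A], [B], [C], [D]
    collect all other factors and are common to both sides. *)
Lemma up_coef_cdn_comm r N i j : i != j -> (i < N)%N -> (j < N)%N -> (0 < r j)%N ->
  up_coef r N i * dn_coef (incr r i) N j = dn_coef r N j * up_coef (decr r j) N i.
Proof.
move=> ij iN jN rj; have ji : j != i by rewrite eq_sym.
set ai := a r i; set aj := a r j.
set A := \prod_(k <- iota 0 N | k != j) (ai - (a r k + e1)).
set B := \prod_(k <- iota 0 N.+1 | (k != i) && (k != j)) (ai - a r k).
set C := \prod_(k <- iota 0 N.+1 | (k != j) && (k != i)) (aj + e1 - a r k).
set D := \prod_(k <- iota 0 N | (k != j) && (k != i)) (aj - a r k).
have -> : up_coef r N i = (ai - (aj + e1)) * A / ((ai - aj) * B).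
  by rewrite /up_coef (prod_iotaD1 _ jN) (prod_iotaD2 _ (leqW jN) ij).
have -> : dn_coef r N j = e2^-1 * ((aj + e1 - ai) * C / ((aj - ai) * D)).
  by rewrite /dn_coef (prod_iotaD2 _ (leqW iN) ji) (prod_iotaD2 _ iN ji).
have -> : dn_coef (incr r i) N j =
    e2^-1 * ((aj + e1 - (ai + e2)) * C / ((aj - (ai + e2)) * D)).
  rewrite /dn_coef (prod_iotaD2 _ (leqW iN) ji) (prod_iotaD2 _ iN ji).
  rewrite rowend_incr rowend_incrN //; congr (_ * (_ * _ / (_ * _)));
    by apply: eq_bigr => k /andP[_ ki]; rewrite rowend_incrN.
have -> : up_coef (decr r j) N i = (ai - (aj - e2 + e1)) * A / ((ai - (aj - e2)) * B).
  rewrite /up_coef (prod_iotaD1 _ jN) (prod_iotaD2 _ (leqW jN) ij).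
  rewrite rowend_decr // rowend_decrN //; congr (_ * _ / (_ * _)).
    by apply: eq_bigr => k ki; rewrite rowend_decrN.
  by apply: eq_bigr => k /andP[_ ki]; rewrite rowend_decrN.
have -> : aj - (ai + e2) = - (ai - (aj - e2)) by ring.
rewrite -(opprB ai aj) !invfM !invrN.
set x := (ai - aj)^-1; set y := (ai - (aj - e2))^-1.
ring.
Qed.
End RowCoefficients.

Lemma prod_iotaS (K : comNzRingType) (P : pred nat) (F : nat -> K) N :
  \prod_(k <- iota 0 N.+1 | P k) F k =
  (\prod_(k <- iota 0 N | P k) F k) * (if P N then F N else 1).
Proof. by rewrite -addn1 iotaD big_cat /= [X in _ * X]big_mkcond big_seq1. Qed.

Lemma sum_iotaS (V : nmodType) (F : nat -> V) N :
  \sum_(k <- iota 0 N.+1) F k = \sum_(k <- iota 0 N) F k + F N.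
Proof. by rewrite -addn1 iotaD big_cat /= big_seq1. Qed.

(** * Vanishing, stability and diagonal moments of the row coefficients *)

Section RowRelations.
Variables (K : fieldType) (e1 e2 : K).
Hypothesis gen : generic e1 e2.
Implicit Types (r : nat -> nat) (N i j k : nat).

Local Notation eb := (e1 + e2).
Local Notation a := (rowend e1 e2).
Local Notation cup := (up_coef e1 e2).
Local Notation cdn := (dn_coef e1 e2).

(** A row above of the same length puts a zero into the numerator, so sums over all rows only see
    the corners. *)
Lemma up_coef_eq0 r N i : (i < N)%N -> r i.+1 = r i -> cup r N i.+1 = 0.
Proof.
move=> iN ri; rewrite /up_coef (prod_iotaD1 _ iN) -[X in X * _ / _](_ : 0 = _) ?mul0r //.
by rewrite /rowend /weight ri -addn1 natrD; ring.
Qed.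

Lemma dn_coef_eq0 r N j : (j < N)%N -> r j.+1 = r j -> cdn r N j = 0.
Proof.
move=> jN rj; rewrite /dn_coef (@prod_iotaD2 _ _ N.+1 j j.+1) //; last by rewrite neq_ltn ltnSn.
rewrite -[X in X * _ / _](_ : 0 = _) ?mul0r ?mulr0 //.
by rewrite /rowend /weight rj -addn1 natrD; ring.
Qed.

(** The extra empty row brings a numerator factor at [a r N + e1] and a denominator factor at
    [a r N.+1], which is the same point. *)
Lemma up_coefS r N i : (i <= N)%N -> r N = 0%N -> r N.+1 = 0%N -> cup r N.+1 i = cup r N i.
Proof.
move=> iN rN rN1; rewrite /up_coef prod_iotaS (@prod_iotaS _ _ _ N.+1) /=.
have -> : N.+1 != i by rewrite gtn_eqF.
have -> : a r N + e1 = a r N.+1 by rewrite /rowend /weight rN rN1 -[N.+1]addn1 natrD; ring.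
rewrite -mulf_div divff ?mulr1 //; apply: rowend_neq0 => //.
by rewrite neq_ltn ltnS iN.
Qed.

Lemma dn_coefS r N j : (j < N)%N -> r N = 0%N -> r N.+1 = 0%N -> cdn r N.+1 j = cdn r N j.
Proof.
move=> jN rN rN1; rewrite /dn_coef (@prod_iotaS _ _ _ N.+1) (@prod_iotaS _ _ (fun k => a r j - a r k) N) /=.
have -> : N.+1 != j by rewrite gtn_eqF // leqW.
have -> : N != j by rewrite gtn_eqF.
have -> : a r j + e1 - a r N.+1 = a r j - a r N.
  by rewrite /rowend /weight rN rN1 -[N.+1]addn1 natrD; ring.
rewrite -mulf_div divff ?mulr1 //; apply: rowend_neq0 => //.
by rewrite neq_ltn jN.
Qed.

(** With [diagzeros], the poles and zeros of G(z) / G(z + e1 + e2). The poles are the candidate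
    weights of boxes to add, [a r k], and of boxes to remove, [a r k - e2]. *)
Definition diagnodes r N := rowends e1 e2 r N.+1 ++ [seq a r k - e2 | k <- iota 0 N].
Definition diagzeros r N := [seq a r k + e1 | k <- iota 0 N] ++ [seq a r k - eb | k <- iota 0 N.+1].

Lemma rowend_subN r i k : a r i != a r k - e2.
Proof.
apply/eqP => E.
have /gen[<- rr] : weight e1 e2 i (r i).+1 = weight e1 e2 k (r k).
  by move/eqP: E; rewrite eq_sym subr_eq => /eqP; rewrite /rowend => ->; rewrite /weight -addn1 natrD; ring.
by move/eqP: rr; rewrite (gtn_eqF).
Qed.

Lemma rowendB2_inj r : injective (fun k => a r k - e2).
Proof. by move=> i k /addIr; apply: rowend_inj. Qed.

Lemma diagnodes_uniq r N : uniq (diagnodes r N).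
Proof.
rewrite cat_uniq rowends_uniq // map_inj_uniq ?iota_uniq ?andbT /=; last exact: rowendB2_inj.
apply/hasPn => _ /mapP[k _ ->]; apply/mapP => -[i _ /eqP].
by rewrite eq_sym (negPf (rowend_subN r i k)).
Qed.

Lemma prod_diagzeros r N x : \prod_(y <- diagzeros r N) (x - y) =
  \prod_(k <- iota 0 N) (x - (a r k + e1)) * \prod_(k <- iota 0 N.+1) (x - (a r k - eb)).
Proof. by rewrite big_cat !big_map. Qed.

Lemma prod_diagnodes1 r N i : \prod_(z <- diagnodes r N | z != a r i) (a r i - z) =
  \prod_(k <- iota 0 N.+1 | k != i) (a r i - a r k) *
  \prod_(k <- iota 0 N) (a r i - (a r k - e2)).
Proof.
rewrite big_cat !big_map; apply: f_equal2; apply: eq_bigl => k.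
  by rewrite (inj_eq (rowend_inj gen (r := r))).
by rewrite eq_sym rowend_subN.
Qed.

Lemma prod_diagnodes2 r N j :
  \prod_(z <- diagnodes r N | z != a r j - e2) (a r j - e2 - z) =
  \prod_(k <- iota 0 N.+1) (a r j - e2 - a r k) *
  \prod_(k <- iota 0 N | k != j) (a r j - e2 - (a r k - e2)).
Proof.
rewrite big_cat !big_map; apply: f_equal2; apply: eq_bigl => k.
  by rewrite rowend_subN.
by rewrite (inj_eq (@rowendB2_inj r)).
Qed.

(** Up to the factor e1 + e2, the residue of G(z) / G(z + e1 + e2) at an addable box is the
    coefficient of adding and then removing it, and at a removable box minus that of removing and
    then restoring it. *)
Lemma diag_divdiff r N m : r N = 0%N -> r N.+1 = 0%N ->
  (forall j, r j = 0%N -> r j.+1 = 0%N) ->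
  eb * (\sum_(i <- iota 0 N.+1) cup r N.+1 i * cdn (incr r i) N.+1 i * a r i ^+ m -
        \sum_(j <- iota 0 N.+1) cdn r N.+1 j * cup (decr r j) N.+1 j * (a r j - e2) ^+ m) =
  divdiff (diagnodes r N.+1) (nseq m 0 ++ diagzeros r N.+1).
Proof.
move=> rN rN1 r0; rewrite divdiff_nseq0 big_cat !big_map [LHS]mulrBr; apply: f_equal2.
  rewrite mulr_sumr [RHS](@sum_iotaS _ _ N.+1).
  (* The node of row [N.+1] is also a zero: rows [N] and [N.+1] are both empty, so [a r N.+1] equals
     [a r N + e1]. *)
  rewrite [X in _ = _ + X](_ : _ = 0) ?addr0; last first.
    rewrite prod_diagzeros (@prod_iotaD1 _ _ N.+1 N) //.
    have -> : a r N.+1 - (a r N + e1) = 0; last by rewrite !mul0r mulr0.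
    by rewrite /rowend /weight rN rN1 -[N.+1]addn1 natrD; ring.
  apply: eq_big_seq => i; rewrite mem_iota add0n => /andP[_ iN].
  rewrite prod_diagzeros prod_diagnodes1 /up_coef.
  rewrite (@prod_iotaD1 _ (fun k => a r i - (a r k - eb)) N.+2 i) 1?leqW //.
  rewrite (@prod_iotaD1 _ (fun k => a r i - (a r k - e2)) N.+1 i) //.
  rewrite /dn_coef rowend_incr.
  have -> : \prod_(k <- iota 0 N.+2 | k != i) (a r i + e2 + e1 - a (incr r i) k) =
     \prod_(k <- iota 0 N.+2 | k != i) (a r i - (a r k - eb)).
    by apply: eq_bigr => k ki; rewrite rowend_incrN //; ring.
  have -> : \prod_(k <- iota 0 N.+1 | k != i) (a r i + e2 - a (incr r i) k) =
     \prod_(k <- iota 0 N.+1 | k != i) (a r i - (a r k - e2)).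
    by apply: eq_bigr => k ki; rewrite rowend_incrN //; ring.
  have -> : a r i - (a r i - eb) = eb by ring.
  have -> : a r i - (a r i - e2) = e2 by ring.
  by rewrite !invfM; ring.
rewrite mulr_sumr -sumrN; apply: eq_big_seq => j; rewrite mem_iota add0n => /andP[_ jN].
rewrite prod_diagzeros prod_diagnodes2.
rewrite (@prod_iotaD1 _ (fun k => a r j - e2 - (a r k + e1)) N.+1 j) //.
rewrite (@prod_iotaD1 _ (fun k => a r j - e2 - (a r k - eb)) N.+2 j) 1?leqW //.
rewrite (@prod_iotaD1 _ (fun k => a r j - e2 - a r k) N.+2 j) 1?leqW //.
have E1 : \prod_(k <- iota 0 N.+2 | k != j) (a r j - e2 - (a r k - eb)) =
   \prod_(k <- iota 0 N.+2 | k != j) (a r j + e1 - a r k).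
  by apply: eq_bigr => k _; ring.
have E2 : \prod_(k <- iota 0 N.+1 | k != j) (a r j - e2 - (a r k - e2)) =
   \prod_(k <- iota 0 N.+1 | k != j) (a r j - a r k).
  by apply: eq_bigr => k _; ring.
rewrite E1 E2.
(* On an empty row [decr] truncates and moves no box. There both sides vanish, because row [j.+1] is
   empty too. *)
have [rj|rj] := posnP (r j).
  rewrite dn_coef_eq0 ?mul0r ?mulr0 ?oppr0; [|exact: jN|by rewrite rj r0].
  rewrite (@prod_iotaD2 _ (fun k => a r j + e1 - a r k) N.+2 j j.+1) //; last by rewrite neq_ltn ltnSn.
  have -> : a r j + e1 - a r j.+1 = 0 by rewrite /rowend /weight rj r0 // -[j.+1]addn1 natrD; ring.
  by rewrite !(mul0r, mulr0).
rewrite /up_coef rowend_decr // (@prod_iotaD1 _ (fun k => a r j - e2 - (a (decr r j) k + e1)) N.+1 j) //.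
rewrite rowend_decr //.
have -> : \prod_(k <- iota 0 N.+2 | k != j) (a r j - e2 - a (decr r j) k) =
   \prod_(k <- iota 0 N.+2 | k != j) (a r j - e2 - a r k).
  by apply: eq_bigr => k kj; rewrite rowend_decrN.
have -> : \prod_(k <- iota 0 N.+1 | k != j) (a r j - e2 - (a (decr r j) k + e1)) =
   \prod_(k <- iota 0 N.+1 | k != j) (a r j - e2 - (a r k + e1)).
  by apply: eq_bigr => k kj; rewrite rowend_decrN.
have -> : a r j - e2 - (a r j + e1) = - eb by ring.
have -> : a r j - e2 - (a r j - eb) = e1 by ring.
have -> : a r j - e2 - a r j = - e2 by ring.
have -> : a r j - e2 - (a r j - e2 + e1) = - e1 by ring.
rewrite /dn_coef !invfM invrN; ring.
Qed.

Lemma psum_diag r N p : psum (diagnodes r N) (diagzeros r N) p =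
  \sum_(k <- iota 0 N) ((a r k ^+ p - (a r k - eb) ^+ p) +
                        ((a r k - e2) ^+ p - (a r k + e1) ^+ p)) +
  (a r N ^+ p - (a r N - eb) ^+ p).
Proof.
rewrite /psum !big_cat !big_map !sum_iotaS big_split !sumrB /=; ring.
Qed.

Lemma psum_diag1 r N : psum (diagnodes r N) (diagzeros r N) 1 = eb.
Proof. by rewrite psum_diag big1 => [|k _]; ring. Qed.

Lemma psum_diag2 r N : r N = 0%N -> psum (diagnodes r N) (diagzeros r N) 2 = - eb ^+ 2.
Proof.
move=> rN; rewrite psum_diag.
have -> : \sum_(k <- iota 0 N) ((a r k ^+ 2 - (a r k - eb) ^+ 2) +
    ((a r k - e2) ^+ 2 - (a r k + e1) ^+ 2)) = - (e1 * eb) *+ 2 * N%:R.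
  rewrite (eq_bigr (fun=> - (e1 * eb) *+ 2)) => [|k _]; last by ring.
  by rewrite big_tnth sumr_const card_ord size_iota mulr_natr.
by rewrite /rowend /weight rN; ring.
Qed.

Lemma psum_diag3 r N : r N = 0%N -> psum (diagnodes r N) (diagzeros r N) 3 =
  eb ^+ 3 - e1 * e2 * eb * (\sum_(k <- iota 0 N) r k)%:R *+ 6.
Proof.
move=> rN; rewrite psum_diag.
have -> : \sum_(k <- iota 0 N) ((a r k ^+ 3 - (a r k - eb) ^+ 3) +
    ((a r k - e2) ^+ 3 - (a r k + e1) ^+ 3)) =
  eb * e1 * e2 * N%:R *+ 3 - eb * e1 * ((\sum_(k <- iota 0 N) a r k) *+ 2) *+ 3.
  rewrite (eq_bigr (fun k => eb * e1 * e2 *+ 3 - eb * e1 *+ 6 * a r k)) => [|k _]; last by ring.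
  rewrite sumrB -mulr_sumr big_tnth sumr_const card_ord size_iota -mulr_natr; ring.
by rewrite sum_rowends /rowend /weight rN; ring.
Qed.

(** D m is h_(m+1) divided by eb. The power sums eb, - eb^2 and eb^3 - 6 e1 e2 eb |r| give h_1 = eb,
    h_2 = 0 and h_3 = -2 e1 e2 eb |r|. *)
Lemma diag_moments r N : r N = 0%N -> r N.+1 = 0%N ->
  (forall j, r j = 0%N -> r j.+1 = 0%N) ->
  let D m := \sum_(i <- iota 0 N.+1) cup r N.+1 i * cdn (incr r i) N.+1 i * a r i ^+ m -
        \sum_(j <- iota 0 N.+1) cdn r N.+1 j * cup (decr r j) N.+1 j * (a r j - e2) ^+ m in
  [/\ D 0 = 1, D 1 = 0 & D 2 = - (e1 * e2) * (\sum_(k <- iota 0 N.+1) r k)%:R *+ 2].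
Proof.
move=> rN rN1 r0 D; have E m := diag_divdiff m rN rN1 r0.
have DE m := divdiffE (nseq m 0 ++ diagzeros r N.+1) (diagnodes_uniq r N.+1).
have sz : size (diagnodes r N.+1) = (N.+1 + N.+2)%N.
  by rewrite size_cat !size_map !size_iota addnC.
have sz' m : size (nseq m (0 : K) ++ diagzeros r N.+1) = (m + (N.+1 + N.+2))%N.
  by rewrite !size_cat size_nseq !size_map !size_iota.
have P1 := psum_diag1 r N.+1; have P2 := psum_diag2 rN1; have P3 := psum_diag3 rN1.
split; apply: (mulfI (gen_eb gen)); rewrite E.
- case: (DE 0%N) => _ _ + _ _; rewrite sz sz' !psum_nseq0 P1 => -> //; ring.
- case: (DE 1%N) => _ _ _ + _; rewrite sz sz' !psum_nseq0 P1 P2 => H.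
  by apply: (mulrn2I gen); rewrite H //; ring.
case: (DE 2%N) => _ _ _ _; rewrite sz sz' !psum_nseq0 P1 P2 P3 => H.
have n6 : (6%:R : K) != 0 by apply: (gen_nat gen 5).
by apply: (mulfI n6); rewrite mulr_natl H //; ring.
Qed.

End RowRelations.

(** * Partitions *)

Section Partitions.
Local Open Scope nat_scope.
Implicit Types (la mu : intpart) (r : nat -> nat).

Definition row la k : nat := nth 0 la k.

Lemma row_default la k : size la <= k -> row la k = 0.
Proof. exact: nth_default. Qed.

Lemma row_gt0 la k : (0 < row la k) = (k < size la).
Proof.
apply/idP/idP => [|kl]; first by rewrite [k < _]ltnNge; apply: contraL => /row_default ->.
have /andP[_ s0] := valP la; rewrite lt0n; apply: contraNneq s0 => <-.
exact: mem_nth.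
Qed.

Lemma row_noninc la k : row la k.+1 <= row la k.
Proof.
have [kl|kl] := ltnP k.+1 (size la); last by rewrite (row_default kl).
have /andP[so _] := valP la.
have := sorted_ltn_nth (rev_trans leq_trans) 0 so; apply=> //.
by rewrite inE (ltn_trans _ kl).
Qed.

Lemma row_inj la mu : row la =1 row mu -> la = mu.
Proof.
move=> E; have sz : size la = size mu.
  apply/eqP; rewrite eqn_leq; apply/andP; split; rewrite leqNgt -row_gt0.
    by rewrite E row_gt0 ltnn.
  by rewrite -E row_gt0 ltnn.
apply: val_inj; apply: (@eq_from_nth _ 0) => [|k _]; [exact: sz | exact: E].
Qed.

Lemma sumn_row la N : size la <= N -> sumn la = \sum_(k <- iota 0 N) row la k.
Proof.
move=> /subnKC <-; rewrite sumnE iotaD big_cat /= [X in _ = _ + X]big1_seq.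
  by rewrite addn0 (big_nth 0) /index_iota subn0.
by move=> k /andP[_]; rewrite mem_iota add0n => /andP[/row_default].
Qed.

Lemma sum_iotaD1 (f : nat -> nat) N i : i < N ->
  \sum_(k <- iota 0 N) f k = f i + \sum_(k <- iota 0 N | k != i) f k.
Proof. by move=> iN; rewrite (bigD1_seq i) ?iota_uniq ?mem_iota. Qed.

Definition topart (s : seq nat) : intpart := insubd (ones 0) [seq x <- s | x != 0].

Lemma filter_noninc r N : (forall k, r k.+1 <= r k) ->
  exists2 n, n <= N & [seq x <- [seq r k | k <- iota 0 N] | x != 0] = [seq r k | k <- iota 0 n]
    /\ forall k, n <= k < N -> r k = 0.
Proof.
move=> rn; elim: N => [|N [n nN [E Z]]]; first by exists 0 => //; split=> // k; case: k.
have rn' i k : i <= k -> r k <= r i.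
  by move=> /subnKC <-; elim: (k - i) => [|m IHm]; rewrite ?addn0 // addnS (leq_trans (rn _)).
rewrite -addn1 iotaD map_cat filter_cat E /= add0n.
case: eqP => [rN|/eqP rN] /=.
  exists n; first by rewrite addn1 leqW. 
  split; first by rewrite cats0.
  move=> k /andP[nk]; rewrite addn1 ltnS leq_eqVlt => /predU1P[->//|kN].
  by apply: Z; rewrite nk.
have -> : n = N.
  apply/eqP; rewrite eqn_leq nN leqNgt; apply: contra rN => nltN.
  by have := rn' _ _ (ltnW nltN); rewrite (Z n) ?leqnn // leqn0.
exists N.+1; [by rewrite addn1 | split; first by rewrite -[in RHS]addn1 iotaD map_cat].
by move=> k /andP[Nk]; rewrite addn1 ltnS => kN; move: (leq_trans Nk kN); rewrite ltnn.
Qed.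

Lemma row_topart r N : (forall k, r k.+1 <= r k) -> r N = 0 ->
  row (topart [seq r k | k <- iota 0 N]) =1 r.
Proof.
move=> rn rN k.
have rn' i j : i <= j -> r j <= r i.
  by move=> /subnKC <-; elim: (j - i) => [|m IHm]; rewrite ?addn0 // addnS (leq_trans (rn _)).
have [n nN [E Z]] := filter_noninc N rn.
have P : is_intpart [seq x <- [seq r k | k <- iota 0 N] | x != 0].
  rewrite /is_intpart mem_filter eqxx /= andbT E.
  apply/(sortedP 0) => i; rewrite size_map size_iota => i1; have i0 := ltnW i1.
  by rewrite !(nth_map 0) ?size_iota // !nth_iota //; apply: rn.
rewrite /row /topart /insubd insubT /= E.
have [kn|nk] := ltnP k n; first by rewrite (nth_map 0) ?size_iota // nth_iota.
rewrite nth_default ?size_map ?size_iota //; symmetry.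
have [kN|Nk] := ltnP k N; first by rewrite Z ?nk.
by apply/eqP; rewrite -leqn0 -rN rn'.
Qed.

Definition addable la i : bool := (i == 0) || (row la i < row la i.-1).
Definition removable la j : bool := row la j.+1 < row la j.
(* Meaningful only if row [i] is addable, resp. row [j] removable. *)
Definition padd la i : intpart := topart [seq incr (row la) i k | k <- iota 0 (size la).+1].
Definition prem la j : intpart := topart [seq decr (row la) j k | k <- iota 0 (size la)].

Lemma addable_le la i : addable la i -> i <= size la.
Proof.
case: i => //= i /(leq_ltn_trans (leq0n _)); by rewrite row_gt0.
Qed.

Lemma removable_lt la j : removable la j -> j < size la.
Proof. by move=> /(leq_ltn_trans (leq0n _)); rewrite row_gt0. Qed.

Lemma row_padd la i : addable la i -> row (padd la i) =1 incr (row la) i.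
Proof.
move=> ai; apply: row_topart => [k|].
  rewrite /incr; have rk := row_noninc la k; move: ai; rewrite /addable.
  case: (k.+1 =P i) => [<- /= lt|_ _].
    by rewrite addn1 (leq_trans lt) // leq_addr.
  by rewrite addn0 (leq_trans rk) // leq_addr.
rewrite /incr row_default // gtn_eqF //.
exact: addable_le.
Qed.

Lemma row_prem la j : removable la j -> row (prem la j) =1 decr (row la) j.
Proof.
move=> rj; apply: row_topart => [k|]; last by rewrite /decr row_default.
rewrite /decr; have rk := row_noninc la k; move: rj; rewrite /removable.
case: (k =P j) => [<- lt|_ _].
  by rewrite -ltnS (leq_ltn_trans (leq_subr _ _)) // subn1 prednK // (leq_ltn_trans _ lt).
by rewrite subn0 (leq_trans (leq_subr _ _)).
Qed.

Lemma removable_padd la i : addable la i -> removable (padd la i) i.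
Proof.
move=> ai; rewrite /removable !row_padd // /incr eqxx addn1 gtn_eqF // addn0 ltnS.
exact: row_noninc.
Qed.

Lemma addable_prem la j : removable la j -> addable (prem la j) j.
Proof.
move=> rj; rewrite /addable !row_prem // /decr eqxx; case: j rj => //= j rj.
rewrite ltn_eqF // subn0 -ltnS subn1 prednK ?ltnS ?row_noninc //.
exact: leq_ltn_trans rj.
Qed.

Lemma prem_padd la i : addable la i -> prem (padd la i) i = la.
Proof.
move=> ai; apply: row_inj => k.
by rewrite row_prem ?removable_padd // /decr row_padd // /incr addnK.
Qed.

Lemma padd_prem la j : removable la j -> padd (prem la j) j = la.
Proof.
move=> rj; apply: row_inj => k.
rewrite row_padd ?addable_prem // /incr row_prem // /decr subnK //.
by case: eqP => // ->; apply: leq_ltn_trans rj.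
Qed.

(** The moves interact only for i = j + 1, and then both sides ask that row [i] be shorter than row
    [j] by at least two. *)
Lemma add_rem_swap la i j : i != j ->
  (addable la i && removable (padd la i) j) =
  (removable la j && addable (prem la j) i).
Proof.
move=> ij; apply/andP/andP => -[H1 H2].
  have rj : removable la j.
    move: H2; rewrite /removable !row_padd // /incr.
    rewrite [j == i]eq_sym (negPf ij) addn0; apply: leq_ltn_trans.
    exact: leq_addr.
  split=> //; have := H1; rewrite {1}/addable /addable; case: (i =P 0) => //= /eqP i0.
  rewrite !row_prem // /decr (negPf ij) subn0; case: (i.-1 =P j) => [E|_]; last by rewrite subn0.
  move: H2; rewrite /removable !row_padd // /incr.
  rewrite -E prednK ?lt0n // eqxx addn1.
  case: (i.-1 =P i) => [e|_]; first by move: ij; rewrite -E e eqxx.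
  by rewrite addn0 => lt _; lia.
have ai : addable la i.
  move: H2; rewrite /addable; case: (i =P 0) => //= _.
  rewrite !row_prem // /decr (negPf ij) subn0 => lt; apply: leq_trans lt _.
  exact: leq_subr.
split=> //; rewrite /removable !row_padd // /incr [j == i]eq_sym (negPf ij) addn0.
move: H1; rewrite /removable; case: (j.+1 =P i) => [E|_]; last by rewrite addn0.
move=> lt; move: H2; rewrite /addable -E /= !row_prem // /decr eqxx.
by rewrite gtn_eqF // subn0; lia.
Qed.

Lemma padd_prem_swap la i j : i != j -> addable la i -> removable (padd la i) j ->
  prem (padd la i) j = padd (prem la j) i.
Proof.
move=> ij ai rj; have /esym := add_rem_swap la ij.
rewrite ai rj => /andP[rj' ai']; apply: row_inj => k.
rewrite row_prem // row_padd // /decr /incr row_padd // row_prem // /decr /incr.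
case: (k =P j) => [->|_]; last by rewrite !subn0.
by rewrite [j == i]eq_sym (negPf ij) !addn0.
Qed.

Lemma size_padd la i : addable la i -> size la <= size (padd la i) <= (size la).+1.
Proof.
move=> ai; apply/andP; split; rewrite leqNgt -row_gt0.
  have := row_default (leqnn (size (padd la i))); rewrite row_padd // /incr.
  by move=> /eqP; rewrite addn_eq0 => /andP[/eqP ->].
rewrite row_padd // /incr row_default // gtn_eqF // ltnS; exact: addable_le.
Qed.

Lemma sumn_padd la i : addable la i -> sumn (padd la i) = (sumn la).+1.
Proof.
move=> ai; have il := addable_le ai; have /andP[_ sz] := size_padd ai.
rewrite !(@sumn_row _ (size la).+1) //.
rewrite !(@sum_iotaD1 _ (size la).+1 i) ?ltnS //.
rewrite row_padd // /incr eqxx addn1 addSn; congr (_ + _).+1.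
by apply: eq_bigr => k /negPf ki; rewrite row_padd // /incr ki addn0.
Qed.

Lemma sumn_prem la j : removable la j -> sumn la = (sumn (prem la j)).+1.
Proof. by move=> rj; rewrite -{1}(padd_prem rj) sumn_padd ?addable_prem. Qed.

Lemma sumn_eq0 la : (sumn la == 0) = (la == ones 0).
Proof.
apply/eqP/eqP => [s0|->]; last by [].
apply: row_inj => k; rewrite [RHS]row_default //; apply/eqP; rewrite -leqn0 -s0.
have [kl|kl] := ltnP k (size la); last by rewrite row_default.
by rewrite (@sumn_row la (size la)) // (sum_iotaD1 _ kl) leq_addr.
Qed.

Lemma size_le_sumn la : size la <= sumn la.
Proof.
rewrite (@sumn_row la (size la)) // -[X in X <= _](size_iota 0) -sum1_size.
rewrite big_seq [leqRHS]big_seq; apply: leq_sum => k; rewrite mem_iota add0n => /andP[_].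
by rewrite row_gt0.
Qed.

Lemma row_le_sumn la k : row la k <= sumn la.
Proof.
have [kl|kl] := ltnP k (size la); last by rewrite row_default.
by rewrite (@sumn_row la (size la)) // (sum_iotaD1 _ kl) leq_addr.
Qed.

Lemma intpart_no0 (la : intpart) : 0%N \notin parts la.
Proof. by have /andP[] := valP la. Qed.

Lemma intpart_perm (rho mu : intpart) : perm_eq rho mu -> rho = mu.
Proof.
move=> pm; apply: val_inj; apply: (sorted_eq (leT := geq)) => //=.
- by move=> x y z; rewrite /geq /= => yx xz; exact: leq_trans xz yx.
- by move=> x y; rewrite /geq /= => /anti_leq.
- by case: (rho) => ? /= /andP[].
by case: (mu) => ? /= /andP[].
Qed.

Lemma filter_parts (rho : intpart) : [seq e <- rho | e != 0%N] = rho.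
Proof.
apply/all_filterP/allP => x xr; apply/eqP => x0; have := intpart_no0 rho.
by rewrite -x0 xr.
Qed.

End Partitions.

Definition addrows (la : intpart) := [seq i <- iota 0 (size la).+1 | addable la i].
Definition remrows (la : intpart) := [seq j <- iota 0 (size la) | removable la j].

Section Rows.
Implicit Types (la mu : intpart).

Lemma mem_addrows la i : (i \in addrows la) = addable la i.
Proof.
rewrite mem_filter mem_iota add0n ltnS /=.
by apply: andb_idr => /addable_le.
Qed.

Lemma mem_remrows la j : (j \in remrows la) = removable la j.
Proof.
rewrite mem_filter mem_iota add0n /=.
by apply: andb_idr => /removable_lt.
Qed.

(** A range of rows independent of the partition lets sums attached to [la] and to its neighbours be
    compared term by term. *)
Lemma sum_addrows (V : nmodType) la N (F : nat -> V) : (size la < N)%N ->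
  \sum_(i <- addrows la) F i = \sum_(i <- iota 0 N | addable la i) F i.
Proof.
move=> /subnKC <-; rewrite iotaD big_cat /= big_filter [X in _ = _ + X]big1_seq ?addr0 // => i.
rewrite mem_iota add0n => /andP[/addable_le il /andP[]].
by rewrite ltnNge il.
Qed.

Lemma sum_remrows (V : nmodType) la N (F : nat -> V) : (size la <= N)%N ->
  \sum_(i <- remrows la) F i = \sum_(i <- iota 0 N | removable la i) F i.
Proof.
move=> /subnKC <-; rewrite iotaD big_cat /= big_filter [X in _ = _ + X]big1_seq ?addr0 // => i.
rewrite mem_iota add0n => /andP[/removable_lt il /andP[]].
by rewrite leqNgt il.
Qed.

Lemma addrows_uniq la : uniq (addrows la).
Proof. by rewrite filter_uniq ?iota_uniq. Qed.

Lemma remrows_uniq la : uniq (remrows la).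
Proof. by rewrite filter_uniq ?iota_uniq. Qed.

Lemma size_prem la j : removable la j -> (size (prem la j) <= size la)%N.
Proof.
by move=> rj; have /andP[+ _] := size_padd (addable_prem rj); rewrite padd_prem.
Qed.

Lemma sum_rows_swap (V : nmodType) la (G : nat -> nat -> V) :
  \sum_(i <- addrows la) \sum_(j <- remrows (padd la i) | j != i) G i j =
  \sum_(j <- remrows la) \sum_(i <- addrows (prem la j) | i != j) G i j.
Proof.
pose N := (size la).+1.
transitivity (\sum_(i <- iota 0 N) \sum_(j <- iota 0 N)
    if [&& i != j, addable la i & removable (padd la i) j] then G i j else 0).
  rewrite (@sum_addrows _ _ N) // big_mkcond /=; apply: eq_bigr => i _.
  case: ifP => ai; last by rewrite big1 // => j _; rewrite andbF.
  rewrite big_mkcond (@sum_remrows _ _ N); last by case/andP: (size_padd ai).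
  rewrite big_mkcond; apply: eq_bigr => j _; rewrite eq_sym.
  by case: eqP; case: ifP.
rewrite exchange_big /= (@sum_remrows _ _ N) // [RHS]big_mkcond /=.
apply: eq_bigr => j _; case: ifP => rj; last first.
  rewrite big1 // => i _; have [//|ij] := eqVneq i j.
  by rewrite add_rem_swap // rj.
rewrite [RHS]big_mkcond (@sum_addrows _ _ N); last by rewrite ltnS size_prem.
rewrite [RHS]big_mkcond; apply: eq_bigr => i _; have [_|ij] := eqVneq i j; first by rewrite if_same.
by rewrite add_rem_swap // rj.
Qed.
End Rows.

(** * Coefficients at the corners of a partition *)

Section PartitionCoefficients.
Variables (K : fieldType) (e1 e2 : K).
Hypothesis gen : generic e1 e2.
Implicit Types (la mu : intpart).

Local Notation br := (weight e1 e2).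
Local Notation cup := (up_coef e1 e2).
Local Notation cdn := (dn_coef e1 e2).

Definition jack_up la i : K := cup (row la) (size la) i.
Definition jack_dn la j : K := cdn (row la) (size la) j.

Lemma jack_upE la N i : (size la <= N)%N -> (i <= size la)%N -> cup (row la) N i = jack_up la i.
Proof.
move=> /subnKC <- il; elim: (N - size la)%N => [|n IHn]; first by rewrite addn0.
rewrite addnS up_coefS // ?row_default ?leq_addr //; first by rewrite (leq_trans il) // leq_addr.
by rewrite leqW // leq_addr.
Qed.

Lemma jack_dnE la N j : (size la <= N)%N -> (j < size la)%N -> cdn (row la) N j = jack_dn la j.
Proof.
move=> /subnKC <- jl; elim: (N - size la)%N => [|n IHn]; first by rewrite addn0.
rewrite addnS dn_coefS // ?row_default ?leq_addr //; first by rewrite (leq_trans jl) // leq_addr.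
by rewrite leqW // leq_addr.
Qed.

Lemma up_coef_nonaddable la N i : (i <= N)%N -> ~~ addable la i -> cup (row la) N i = 0.
Proof.
case: i => //= i iN; rewrite /addable /= -leqNgt => ri; apply: up_coef_eq0 => //.
by apply/eqP; rewrite eqn_leq ri row_noninc.
Qed.

Lemma dn_coef_nonremovable la N j : (j < N)%N -> ~~ removable la j -> cdn (row la) N j = 0.
Proof.
move=> jN; rewrite /removable -leqNgt => rj; apply: dn_coef_eq0 => //.
by apply/eqP; rewrite eqn_leq rj row_noninc.
Qed.

Lemma sum_jack_up la N (F : nat -> K) : (size la <= N)%N ->
  \sum_(i <- addrows la) jack_up la i * F i = \sum_(i <- iota 0 N.+1) cup (row la) N i * F i.
Proof.
move=> lN; rewrite (@sum_addrows _ _ N.+1) // big_mkcond; apply: eq_big_seq => i.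
rewrite mem_iota add0n ltnS /= => iN; case: ifP => ai; first by rewrite jack_upE ?addable_le.
by rewrite up_coef_nonaddable ?ai ?mul0r.
Qed.

Lemma sum_jack_dn la N (F : nat -> K) : (size la <= N)%N ->
  \sum_(j <- remrows la) jack_dn la j * F j = \sum_(j <- iota 0 N) cdn (row la) N j * F j.
Proof.
move=> lN; rewrite (@sum_remrows _ _ N) // big_mkcond; apply: eq_big_seq => j.
rewrite mem_iota add0n /= => jN; case: ifP => rj; first by rewrite jack_dnE ?removable_lt.
by rewrite dn_coef_nonremovable ?rj ?mul0r.
Qed.

Lemma jack_up_moments la :
  [/\ \sum_(i <- addrows la) jack_up la i = 1,
      \sum_(i <- addrows la) jack_up la i * br i (row la i) = 0
    & \sum_(i <- addrows la) jack_up la i * br i (row la i) ^+ 2 = - (e1 * e2) * (sumn la)%:R].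
Proof.
have [M0 M1 M2] := up_coef_moments gen (row_default (leqnn (size la))).
have Z : \sum_(i <- addrows la) jack_up la i = \sum_(i <- addrows la) jack_up la i * 1.
  by apply: eq_bigr => i _; rewrite mulr1.
rewrite Z !(@sum_jack_up _ (size la)) // (sumn_row (leqnn _)); split=> //.
by under eq_bigr do rewrite mulr1.
Qed.

Lemma jack_up_partfrac la v : (forall i, v != br i (row la i)) ->
  \sum_(i <- addrows la) jack_up la i / (v - br i (row la i)) =
  (\prod_(k <- iota 0 (size la)) (v - (br k (row la k) + e1))) /
  \prod_(k <- iota 0 (size la).+1) (v - br k (row la k)).
Proof. by move=> vn; rewrite (@sum_jack_up _ (size la)) // up_coef_partfrac. Qed.

(** Iterated, this identity produces the factorial coefficient of the squarefree monomial in
    [xcoef_ones]. *)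
Lemma sum_jack_dnE la : \sum_(j <- remrows la) jack_dn la j = (sumn la)%:R.
Proof.
have Z : \sum_(i <- remrows la) jack_dn la i = \sum_(i <- remrows la) jack_dn la i * 1.
  by apply: eq_bigr => i _; rewrite mulr1.
rewrite Z (@sum_jack_dn _ (size la)) // (sumn_row (leqnn _)).
rewrite -(sum_dn_coef gen (row_default (leqnn (size la)))).
by apply: eq_bigr => i _; rewrite mulr1.
Qed.

Lemma up_coef_ext r r' N i : r =1 r' -> cup r N i = cup r' N i.
Proof.
move=> E; rewrite /up_coef /rowend.
by congr (_ / _); apply: eq_bigr => k _; rewrite !E.
Qed.

Lemma dn_coef_ext r r' N i : r =1 r' -> cdn r N i = cdn r' N i.
Proof.
move=> E; rewrite /dn_coef /rowend.
by congr (_ * (_ / _)); apply: eq_bigr => k _; rewrite !E.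
Qed.

Lemma jack_dn_padd la i j : addable la i -> removable (padd la i) j ->
  jack_dn (padd la i) j = cdn (incr (row la) i) (size la).+1 j.
Proof.
move=> ai rj; rewrite -(dn_coef_ext _ _ (row_padd ai)) jack_dnE ?removable_lt //.
by case/andP: (size_padd ai).
Qed.

Lemma jack_up_prem la i j : removable la j -> addable (prem la j) i ->
  jack_up (prem la j) i = cup (decr (row la) j) (size la).+1 i.
Proof.
move=> rj ai; rewrite -(up_coef_ext _ _ (row_prem rj)) jack_upE ?addable_le //.
by rewrite leqW // size_prem.
Qed.

Lemma jack_up_dn_swap la i j : i != j -> addable la i -> removable (padd la i) j ->
  jack_up la i * jack_dn (padd la i) j = jack_dn la j * jack_up (prem la j) i.
Proof.
move=> ij ai rj; have /esym := add_rem_swap la ij.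
rewrite ai rj => /andP[rj' ai'].
have il := addable_le ai; have jl := removable_lt rj'.
rewrite jack_dn_padd // jack_up_prem // -(jack_upE (leqnSn _) il) -(jack_dnE (leqnSn _) jl).
by apply: up_coef_cdn_comm; rewrite // ?ltnS ?row_gt0 // ltnW.
Qed.

(** Adding a box may open a new row, so the coefficients of [la] and of all its neighbours are
    computed over the common range of [(size la).+1] rows. *)
Lemma jack_up_dn_diag la :
  let D m := \sum_(i <- addrows la) jack_up la i * jack_dn (padd la i) i * br i (row la i) ^+ m -
             \sum_(j <- remrows la) jack_dn la j * jack_up (prem la j) j * br j (row la j).-1 ^+ m in
  [/\ D 0 = 1, D 1 = 0 & D 2 = - (e1 * e2) * (sumn la)%:R *+ 2].
Proof.
have rN := row_default (leqnn (size la)); have rN1 := row_default (leqnSn (size la)).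
have r0 j : row la j = 0%N -> row la j.+1 = 0%N.
  by move=> rj; apply/eqP; rewrite -leqn0 -rj row_noninc.
move=> D; have := diag_moments gen rN rN1 r0.
rewrite -(@sumn_row la (size la).+1) //.
set D' := fun m => _ - _; suff E m : D m = D' m by rewrite !E.
congr (_ - _).
  rewrite (@sum_addrows _ _ (size la).+1) // big_mkcond; apply: eq_big_seq => i.
  rewrite mem_iota add0n ltnS => /andP[_ il]; case: ifP => ai.
    by rewrite jack_dn_padd ?removable_padd // jack_upE.
  by rewrite up_coef_nonaddable ?ai ?mul0r // leqW.
rewrite (@sum_remrows _ _ (size la).+1) // big_mkcond; apply: eq_big_seq => j.
rewrite mem_iota add0n ltnS => /andP[_ jl]; case: ifP => rj.
  rewrite jack_up_prem ?addable_prem // jack_dnE ?removable_lt //; congr (_ * _ ^+ _).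
  have rj0 : (0 < row la j)%N by rewrite row_gt0 removable_lt.
  by rewrite /rowend /weight -[in RHS](prednK rj0) -[in RHS]addn1 natrD; ring.
by rewrite dn_coef_nonremovable ?rj ?mul0r.
Qed.

End PartitionCoefficients.

(** * Symmetric functions in the power sums *)

Section Derivations.
Variables (K : fieldType) (F : comAlgType K) (p : nat -> F).

(** Phrased as an induction principle: identities are checked on 1 and propagated through
    multiplication by a generator and linear combinations. *)
Definition generated_by : Prop := forall P : F -> Prop,
  P 1 -> (forall k f, P f -> P (p k * f)) ->
  P 0 -> (forall c f g, P f -> P g -> P (c *: f + g)) -> forall f, P f.

Definition derivation (D : F -> F) : Prop :=
  linear D /\ (forall f g, D (f * g) = D f * g + f * D g).

Lemma linear_at0 (V W : lmodType K) (D : V -> W) : linear D -> D 0 = 0.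
Proof.
move=> Dl; have E := Dl (-1) 0 0; rewrite scaler0 in E; rewrite addr0 in E.
by rewrite E scaleN1r addNr.
Qed.

Lemma derivation1 D : derivation D -> D 1 = 0.
Proof.
by case=> _ DM; apply: (addrI (D 1)); rewrite addr0 -{3}[1]mulr1 DM mulr1 mul1r.
Qed.

Lemma derivationD D f g : derivation D -> D (f + g) = D f + D g.
Proof. by case=> Dl _; rewrite -[f]scale1r Dl !scale1r. Qed.

Lemma derivationZ D c f : derivation D -> D (c *: f) = c *: D f.
Proof. by case=> Dl _; rewrite -[c *: f]addr0 Dl (linear_at0 Dl) addr0. Qed.

Lemma derivation_comm D D' : derivation D -> derivation D' ->
  derivation (fun f => D (D' f) - D' (D f)).
Proof.
move=> dD dD'; have [Dl DM] := dD; have [Dl' DM'] := dD'; split=> [c f g|f g].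
  by rewrite Dl Dl' Dl Dl' scalerBr opprD addrACA.
by rewrite DM' DM !(derivationD _ _ dD) !(derivationD _ _ dD') !DM !DM'; ring.
Qed.

Lemma derivation_scale c D : derivation D -> derivation (fun f => c *: D f).
Proof.
move=> [Dl DM]; split=> [a f g|f g].
  by rewrite Dl scalerDr !scalerA mulrC.
by rewrite DM scalerDr scalerAl scalerAr.
Qed.

Lemma derivation0 : derivation (fun=> 0).
Proof. by split=> [a f g|f g]; rewrite ?scaler0 ?mul0r ?mulr0 addr0. Qed.

Hypothesis p_gen : generated_by.

Lemma derivation_ext D D' : derivation D -> derivation D' ->
  (forall k, D (p k) = D' (p k)) -> D =1 D'.
Proof.
move=> dD dD' E; apply: p_gen => [|k f IHf||c f g IHf IHg].
- by rewrite !derivation1.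
- by rewrite dD.2 dD'.2 E IHf.
- by rewrite (linear_at0 dD.1) (linear_at0 dD'.1).
by rewrite dD.1 dD'.1 IHf IHg.
Qed.

Lemma derivation_commE D D' D'' : derivation D -> derivation D' -> derivation D'' ->
  (forall k, D (D' (p k)) = D' (D (p k)) + D'' (p k)) ->
  forall f, D (D' f) = D' (D f) + D'' f.
Proof.
move=> dD dD' dD'' E f; rewrite addrC; apply/eqP; rewrite -subr_eq; apply/eqP.
apply: (derivation_ext (derivation_comm dD dD') dD'') => k.
by rewrite E addrC addKr.
Qed.

End Derivations.

(* The operators acting on symmetric functions written in the power sums
   [p k] (the power sum of degree [k.+1]): the partial derivatives, and the two
   first order operators sum_l l p_(l+1) d_l and sum_l (l+1) p_l d_(l+1). *)
Record symops (K : fieldType) (F : comAlgType K) (p : nat -> F)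
    (pd : nat -> F -> F) (rs lw dg : F -> F) : Prop := SymOps {
  so_gen : generated_by p;
  so_pd : forall k, derivation (pd k);
  so_rs : derivation rs;
  so_lw : derivation lw;
  so_dg : derivation dg;
  so_pdp : forall k i, pd k (p i) = (i == k)%:R;
  so_rsp : forall k, rs (p k) = k.+1%:R *: p k.+1;
  so_lwp0 : lw (p 0) = 0;
  so_lwpS : forall k, lw (p k.+1) = k.+2%:R *: p k;
  so_dgp : forall k, dg (p k) = k.+1%:R *: p k }.

Section SymOpsTheory.
Variables (K : fieldType) (F : comAlgType K) (p : nat -> F).
Variables (pd : nat -> F -> F) (rs lw dg : F -> F).
Hypothesis so : symops p pd rs lw dg.

Let gen := so_gen so.
Let dpd := so_pd so.
Let drs := so_rs so.
Let dlw := so_lw so.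
Let ddg := so_dg so.

Lemma derivation_nat D n : derivation D -> D (n%:R : F) = 0.
Proof. by move=> dD; rewrite -[n%:R]/(1 *+ n) -scaler_nat derivationZ // derivation1 // scaler0. Qed.

Lemma pd_pM k i f : pd k (p i * f) = (i == k)%:R * f + p i * pd k f.
Proof. by rewrite (dpd k).2 (so_pdp so). Qed.

Lemma rs_pM k f : rs (p k * f) = k.+1%:R *: (p k.+1 * f) + p k * rs f.
Proof. by rewrite drs.2 (so_rsp so) scalerAl. Qed.

Lemma lw_p0M f : lw (p 0 * f) = p 0 * lw f.
Proof. by rewrite dlw.2 (so_lwp0 so) mul0r add0r. Qed.

Lemma lw_pSM k f : lw (p k.+1 * f) = k.+2%:R *: (p k * f) + p k.+1 * lw f.
Proof. by rewrite dlw.2 (so_lwpS so) scalerAl. Qed.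

Lemma dg_pM k f : dg (p k * f) = k.+1%:R *: (p k * f) + p k * dg f.
Proof. by rewrite ddg.2 (so_dgp so) scalerAl. Qed.

Lemma pd0_rs f : pd 0 (rs f) = rs (pd 0 f).
Proof.
rewrite (derivation_commE gen (dpd 0) drs (derivation0 F)) ?addr0 // => k.
rewrite (so_rsp so) derivationZ // !(so_pdp so) scaler0 (derivation_nat _ drs).
by rewrite addr0.
Qed.

Lemma pd_lw k f : pd k (lw f) = lw (pd k f) + k.+2%:R *: pd k.+1 f.
Proof.
apply: (derivation_commE gen (dpd k) dlw (derivation_scale _ (dpd k.+1))) => -[|i].
  rewrite (so_lwp0 so) (linear_at0 (dpd k).1) !(so_pdp so) (derivation_nat _ dlw).
  by rewrite scaler0 addr0.
rewrite (so_lwpS so) derivationZ // !(so_pdp so) (derivation_nat _ dlw) add0r eqSS.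
by case: eqP => [->|_]; rewrite ?scaler0.
Qed.

(** On [p k] the two compositions give (k+1)(k+2) and k(k+1). Up to scaling, [lw], [rs] and [dg]
    form an sl_2 triple. *)
Lemma lw_rs f : lw (rs f) = rs (lw f) + 2%:R *: dg f.
Proof.
apply: (derivation_commE gen dlw drs (derivation_scale _ ddg)) => -[|k].
  rewrite (so_rsp so) derivationZ // (so_lwpS so) (so_lwp0 so) (linear_at0 drs.1).
  by rewrite (so_dgp so) !scale1r add0r.
rewrite (so_rsp so) (derivationZ _ _ dlw) !(so_lwpS so) (derivationZ _ _ drs) (so_rsp so).
rewrite (so_dgp so) !scalerA -scalerDl; congr (_ *: _).
by rewrite -!natrM -natrD; congr _%:R; lia.
Qed.

Lemma dg_rs f : dg (rs f) = rs (dg f) + rs f.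
Proof.
apply: (derivation_commE gen ddg drs drs) => k.
rewrite (so_rsp so) (derivationZ _ _ ddg) !(so_dgp so) (derivationZ _ _ drs) (so_rsp so).
rewrite !scalerA -scalerDl; congr (_ *: _).
by rewrite -!natrM -natrD; congr _%:R; lia.
Qed.
End SymOpsTheory.

(** * Free modules, monomials in the power sums and evaluation *)

Section LinearExtension.
Variables (K : fieldType) (I : choiceType).

Lemma malg_lin_ind (P : {malg K[I]} -> Prop) :
  P 0 -> (forall c x y, P x -> P y -> P (c *: x + y)) ->
  (forall k, P << k >>) -> forall x, P x.
Proof.
move=> P0 PD PU x; rewrite [x]monalgE; elim/big_rec: _ => // k y _ Py.
have -> : << monalg.mcoeff k x *g k >> = monalg.mcoeff k x *: << k >> :> {malg K[I]}.
  by apply/malgP => l; rewrite monalg.mcoeffZ !mcoeffU mulrnAr mulr1.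
exact: PD.
Qed.

Variables (V : lmodType K) (phi : I -> V).

Definition linext (x : {malg K[I]}) : V :=
  \sum_(k <- monalg.msupp x) monalg.mcoeff k x *: phi k.

Lemma linext_sub (d : {fset I}) x : (monalg.msupp x `<=` d)%fset ->
  linext x = \sum_(k <- d) monalg.mcoeff k x *: phi k.
Proof.
move=> le; rewrite [LHS](big_fset_incl _ le) // => k _ /mcoeff_outdom ->.
by rewrite scale0r.
Qed.

Fact linext_is_linear : linear linext.
Proof.
move=> c x y.
pose d := (monalg.msupp x `|` monalg.msupp y `|` monalg.msupp (c *: x + y))%fset.
rewrite !(@linext_sub d) ?fsubsetUr //; last first.
- by rewrite /d -fsetUA fsubsetUl.
- by rewrite /d fsetUAC fsubsetUr.
rewrite scaler_sumr -big_split; apply: eq_bigr => k _ /=.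
by rewrite monalg.mcoeffD monalg.mcoeffZ scalerDl scalerA.
Qed.
HB.instance Definition _ := GRing.isLinear.Build K {malg K[I]} V *:%R linext
  linext_is_linear.

Lemma linextU k : linext << k >> = phi k.
Proof. by rewrite (linext_sub msuppU_le) big_seq_fset1 mcoeffUU scale1r. Qed.

End LinearExtension.

Section PowerSums.
Variable (K : fieldType).
Local Notation F := {malg K[{cmonom nat}]}.

Local Notation cm0 := (monalg.one : {cmonom nat}).
Local Notation cmul := (@monalg.mul {cmonom nat}).

Lemma cmonom_neq1 (m : {cmonom nat}) : m != cm0 ->
  exists k m', m = cmul (ucm k) m'.
Proof.
move=> m1; have /fset0Pn[k] : finsupp m != fset0.
  apply: contra_neq m1 => m0; apply/eqP/cmP => k.
  by rewrite cm1; apply/eqP; rewrite cmE_eq0 m0 in_fset0.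
rewrite -cmE_neq0 -lt0n => mk; exists k, (divcm m (ucm k)).
apply/eqP/cmP => i; rewrite cmM cmU divcmE ucmE.
by case: eqP => [<-|_] /=; rewrite ?subnKC ?subn0.
Qed.

Lemma cmonom_ind (P : {cmonom nat} -> Prop) :
  P cm0 -> (forall k m, P m -> P (cmul (ucm k) m)) -> forall m, P m.
Proof.
move=> P1 PM m; have [n] := ubnP (monalg.mdeg m); elim: n m => // n IHn m mn.
have [->//|/cmonom_neq1[k [m' E]]] := eqVneq m cm0.
rewrite E; apply/PM/IHn; move: mn.
by rewrite E mdegM mdegU add1n ltnS.
Qed.

Lemma pvarM k (m : {cmonom nat}) : pvar K k * << m >> = << (cmul (ucm k) m) >>.
Proof. by rewrite malgM_def fgmulUU mulr1. Qed.

Lemma psum_ind (P : F -> Prop) :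
  P 1 -> (forall k f, P f -> P (pvar K k * f)) ->
  P 0 -> (forall c f g, P f -> P g -> P (c *: f + g)) -> forall f, P f.
Proof.
move=> P1 PM P0 PD; apply: (malg_lin_ind P0 PD) => m.
by elim/cmonom_ind: m => [//|k m IHm]; rewrite -pvarM; apply: PM.
Qed.

Section Peval.
Variables (S : comNzRingType) (c : {rmorphism K -> S}) (v : nat -> S).

Definition monval (m : {cmonom nat}) : S := \prod_(k <- finsupp m) v k ^+ m k.

Lemma monval_sub (d : {fset nat}) (m : {cmonom nat}) : (finsupp m `<=` d)%fset ->
  monval m = \prod_(k <- d) v k ^+ m k.
Proof.
move=> le; rewrite [LHS](big_fset_incl _ le) // => k _.
by rewrite -cmE_eq0 => /eqP ->.
Qed.

Fact monval_mmorphism : mmorphism monval.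
Proof.
split=> [m1 m2|]; last by rewrite /monval mdom1 big_seq_fset0.
rewrite (monval_sub (fsubsetUl (finsupp m1) (finsupp m2))).
rewrite (monval_sub (fsubsetUr (finsupp m1) (finsupp m2))).
rewrite /monval mdomD -big_split; apply: eq_bigr => k _ /=.
by rewrite cmM exprD.
Qed.
HB.instance Definition _ := isMultiplicative.Build {cmonom nat} S monval
  monval_mmorphism.

HB.instance Definition _ := GRing.RMorphism.copy (peval c v) (monalg.mmap c monval).

Lemma pevalZ a f : peval c v (a *: f) = c a * peval c v f.
Proof. exact: (@monalg.mmapZ _ _ _ c monval). Qed.

Lemma peval_pvar k : peval c v (pvar K k) = v k.
Proof.
rewrite /peval /pvar mmapU. rewrite [X in X * _](_ : _ = 1); last exact: (rmorph1 c). rewrite mul1r -/(monval _).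
by rewrite (monval_sub (d := [fset k]%fset)) ?mdomU // big_seq_fset1 cmUU expr1.
Qed.

End Peval.

End PowerSums.

(* A free module on [I], kept abstract so that no conversion ever looks inside
   the representation of its elements. *)
Record freemod (K : fieldType) (I : eqType) := FreeMod {
  fm_sort :> lmodType K;
  fm_b : I -> fm_sort;
  fm_ext : forall V : lmodType K, (I -> V) -> {linear fm_sort -> V};
  fm_extE : forall (V : lmodType K) (phi : I -> V) k, fm_ext phi (fm_b k) = phi k;
  fm_ind : forall P : fm_sort -> Prop,
    P 0 -> (forall c x y, P x -> P y -> P (c *: x + y)) -> (forall k, P (fm_b k)) ->
    forall x, P x }.

Definition malg_freemod (K : fieldType) (I : choiceType) : freemod K I :=
  FreeMod (fm_ext := fun V phi => linext phi) (@linextU K I) (@malg_lin_ind K I).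

(** * Fock modules on partitions *)

Section Model.
Variables (K : fieldType) (M : freemod K intpart) (up dn : intpart -> nat -> K).
Implicit Types (la mu : intpart) (w : nat -> nat -> K).
Local Notation "''b_' la" := (fm_b M la) (at level 8, la at level 2).

(** Here and in [lower_at] the weight is taken at the box that is moved; a box removed from row [j]
    sits in column [(row la j).-1]. *)
Definition raise_at w la : M :=
  \sum_(i <- addrows la) (up la i * w i (row la i)) *: 'b_(padd la i).
Definition lower_at w la : M :=
  \sum_(j <- remrows la) (dn la j * w j (row la j).-1) *: 'b_(prem la j).
Definition raise w : {linear M -> M} := fm_ext M (raise_at w).
Definition lower w : {linear M -> M} := fm_ext M (lower_at w).

Lemma raiseE w la : raise w 'b_la = raise_at w la.
Proof. exact: fm_extE. Qed.

Lemma lowerE w la : lower w 'b_la = lower_at w la.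
Proof. exact: fm_extE. Qed.

Definition swap_rel := forall la i j, i != j -> addable la i -> removable (padd la i) j ->
  up la i * dn (padd la i) j = dn la j * up (prem la j) i.

(** Diagonal entry of the commutator of a lowering and a raising operator, [w] being the product of
    their two weights. *)
Definition diag w la : K :=
  \sum_(i <- addrows la) up la i * dn (padd la i) i * w i (row la i) -
  \sum_(j <- remrows la) dn la j * up (prem la j) j * w j (row la j).-1.

(** When distinct boxes are moved, [swap_rel] makes both orders agree, since the weights depend only
    on the boxes. What remains is the same box added and removed, which restores [la]. *)
Lemma lower_raise w w' la : swap_rel ->
  lower w' (raise w 'b_la) =
  raise w (lower w' 'b_la) + diag (fun i j => w i j * w' i j) la *: 'b_la.
Proof.
move=> sw; rewrite raiseE lowerE /raise_at /lower_at !linear_sum /=.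
under eq_bigr do rewrite linearZ /= lowerE /lower_at scaler_sumr.
under [X in _ = X + _]eq_bigr do rewrite linearZ /= raiseE /raise_at scaler_sumr.
have H1 : \sum_(i <- addrows la) \sum_(j <- remrows (padd la i))
   (up la i * w i (row la i)) *: ((dn (padd la i) j * w' j (row (padd la i) j).-1) *: 'b_(prem (padd la i) j))
  = (\sum_(i <- addrows la) up la i * dn (padd la i) i * (w i (row la i) * w' i (row la i))) *: 'b_la
  + \sum_(i <- addrows la) \sum_(j <- remrows (padd la i) | j != i)
   (up la i * w i (row la i)) *: ((dn (padd la i) j * w' j (row (padd la i) j).-1) *: 'b_(prem (padd la i) j)).
  rewrite scaler_suml -big_split; apply: eq_big_seq => i; rewrite mem_addrows => ai.
  rewrite (bigD1_seq i) ?remrows_uniq ?mem_remrows ?removable_padd //=; congr (_ + _).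
  rewrite prem_padd // scalerA row_padd // /incr eqxx addn1 /=; congr (_ *: _); ring.
have H2 : \sum_(j <- remrows la) \sum_(i <- addrows (prem la j))
   (dn la j * w' j (row la j).-1) *: ((up (prem la j) i * w i (row (prem la j) i)) *: 'b_(padd (prem la j) i))
  = (\sum_(j <- remrows la) dn la j * up (prem la j) j * (w j (row la j).-1 * w' j (row la j).-1)) *: 'b_la
  + \sum_(j <- remrows la) \sum_(i <- addrows (prem la j) | i != j)
   (dn la j * w' j (row la j).-1) *: ((up (prem la j) i * w i (row (prem la j) i)) *: 'b_(padd (prem la j) i)).
  rewrite scaler_suml -big_split; apply: eq_big_seq => j; rewrite mem_remrows => rj.
  rewrite (bigD1_seq j) ?addrows_uniq ?mem_addrows ?addable_prem //=; congr (_ + _).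
  rewrite padd_prem // scalerA row_prem // /decr eqxx subn1 /=; congr (_ *: _); ring.
rewrite H1 H2 sum_rows_swap /diag scalerBl [RHS]addrC addrA subrK; congr (_ + _).
apply: eq_big_seq => j; rewrite mem_remrows => rj.
rewrite big_seq_cond [RHS]big_seq_cond; apply: eq_bigr => i; rewrite mem_addrows => /andP[ai ij].
have := add_rem_swap la ij; rewrite rj ai => /andP[ai' rj'].
rewrite -padd_prem_swap // !scalerA row_padd // row_prem // /incr /decr.
rewrite [j == i]eq_sym (negPf ij) addn0 subn0; congr (_ *: _).
have E := sw _ _ _ ij ai' rj'.
transitivity (up la i * dn (padd la i) j * (w i (row la i) * w' j (row la j).-1)); first by ring.
by rewrite E; ring.
Qed.

Definition degm : {linear M -> M} := fm_ext M (fun la => (sumn la)%:R *: 'b_la).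

Lemma degmE la : degm 'b_la = (sumn la)%:R *: 'b_la.
Proof. exact: fm_extE. Qed.

Lemma degm_raise w x : degm (raise w x) = raise w (degm x) + raise w x.
Proof.
elim/fm_ind: x => [|c x y IHx IHy|la].
- by rewrite !linear0 addr0.
- by rewrite !linearP /= IHx IHy scalerDr addrACA.
rewrite raiseE degmE linearZ /= raiseE /raise_at linear_sum /=.
rewrite scaler_sumr -big_split; apply: eq_big_seq => i; rewrite mem_addrows => ai /=.
rewrite linearZ /= degmE sumn_padd // !scalerA -scalerDl -addn1 natrD; congr (_ *: _); ring.
Qed.
End Model.

Notation "''b_' la" := (fm_b _ la) (at level 8, la at level 2).

Definition wt1 (K : fieldType) (i j : nat) : K := 1.

(** The fields say that raising with weights 1 and [u] and lowering with weights 1 and [v] commute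
    as p_1, E, d_1 and the adjoint of E do: [d_1, p_1] = 1, two mixed commutators vanish, and the
    last one is twice the degree. *)
Record fockmodel (K : fieldType) (up dn : intpart -> nat -> K) (u v : nat -> nat -> K) : Prop :=
  FockModel {
    fk_swap : swap_rel up dn;
    fk_diag1 : forall la, diag up dn (fun _ _ => 1) la = 1;
    fk_diagu : forall la, diag up dn u la = 0;
    fk_diagv : forall la, diag up dn v la = 0;
    fk_diaguv : forall la, diag up dn (fun i j => u i j * v i j) la = (sumn la)%:R *+ 2 }.

Definition ppart (K : fieldType) (F : comAlgType K) (p : nat -> F) (rho : seq nat) : F :=
  \prod_(k <- rho) p k.-1.

Record symform (K : fieldType) (F : comAlgType K) (p : nat -> F) (pd : nat -> F -> F)
    (al : K) (jf : F -> F -> K) : Prop := SymForm {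
  jf_lin : forall c f g h, jf (c *: f + g) h = c * jf f h + jf g h;
  jf_sym : forall f g, jf f g = jf g f;
  jf_p : forall k f g, jf (p k * f) g = k.+1%:R * al * jf f (pd k g);
  jf_11 : jf 1 1 = 1;
  jf_orth : forall rho sig : intpart, rho <> sig -> jf (ppart p rho) (ppart p sig) = 0;
  jf_norm : forall rho : intpart, jf (ppart p rho) (ppart p rho) != 0 }.

Section Rel.
Variables (K : fieldType) (F : comAlgType K) (p : nat -> F).
Variables (pd : nat -> F -> F) (rs lw dg : F -> F).
Hypothesis so : symops p pd rs lw dg.

Section OneModel.
Variables (M : freemod K intpart) (up dn : intpart -> nat -> K) (u v : nat -> nat -> K).
Hypothesis fk : fockmodel up dn u v.

Local Notation e0 := (raise M up (wt1 K)).
Local Notation e1 := (raise M up u).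
Local Notation f0 := (lower M dn (wt1 K)).
Local Notation f1 := (lower M dn v).

Let ext_diag w w' (c : nat -> K) :
  (forall la, diag up dn (fun i j => w i j * w' i j) la = c (sumn la)) ->
  forall (T : M -> M), linear T -> (forall la, T 'b_la = c (sumn la) *: 'b_la) ->
  forall x, lower M dn w' (raise M up w x) = raise M up w (lower M dn w' x) + T x.
Proof.
move=> dc T Tl HT; elim/fm_ind => [|a x y IHx IHy|la].
- by rewrite !linear0 (linear_at0 Tl) addr0.
- by rewrite Tl !linearP /= IHx IHy scalerDr addrACA.
by rewrite (lower_raise M w w' la (fk_swap fk)) dc HT.
Qed.

Let diag_ext w w' la : (forall i j, w i j = w' i j) -> diag up dn w la = diag up dn w' la.
Proof. by move=> E; congr (_ - _); apply: eq_bigr => i _; rewrite E. Qed.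

Lemma model_f0e0 x : f0 (e0 x) = e0 (f0 x) + x.
Proof.
apply: (@ext_diag _ _ (fun=> 1) _ id) => [la|//|la]; last by rewrite scale1r.
by rewrite -[RHS](fk_diag1 fk la); apply: diag_ext => i j; rewrite /wt1 mul1r.
Qed.

Lemma model_f0e1 x : f0 (e1 x) = e1 (f0 x).
Proof.
rewrite -[RHS]addr0.
apply: (@ext_diag _ _ (fun=> 0) _ (fun=> 0)) => [la|c ? ?|la]; [|by rewrite scaler0 addr0|by rewrite scale0r].
by rewrite -[RHS](fk_diagu fk la); apply: diag_ext => i j; rewrite /wt1 mulr1.
Qed.

Lemma model_f1e0 x : f1 (e0 x) = e0 (f1 x).
Proof.
rewrite -[RHS]addr0.
apply: (@ext_diag _ _ (fun=> 0) _ (fun=> 0)) => [la|c ? ?|la]; [|by rewrite scaler0 addr0|by rewrite scale0r].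
by rewrite -[RHS](fk_diagv fk la); apply: diag_ext => i j; rewrite /wt1 mul1r.
Qed.

Lemma model_f1e1 x : f1 (e1 x) = e1 (f1 x) + 2%:R *: degm M x.
Proof.
apply: (@ext_diag _ _ (fun n => n%:R *+ 2) (fk_diaguv fk) (fun x => 2%:R *: degm M x)) => [c y z|la].
  by rewrite linearP /= scalerDr !scalerA mulrC.
by rewrite degmE scalerA mulr_natl.
Qed.

Lemma f0_vac : f0 'b_(ones 0) = 0.
Proof. by rewrite lowerE /lower_at big_nil. Qed.

Lemma f1_vac : f1 'b_(ones 0) = 0.
Proof. by rewrite lowerE /lower_at big_nil. Qed.

(** The index is the degree, which makes related pairs homogeneous on both sides. Closure under
    linear combinations is built in, as the commutators are not single words. *)
Inductive fockrel : nat -> F -> M -> Prop :=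
| rel_vac : fockrel 0 1 'b_(ones 0)
| rel_e0 n f x : fockrel n f x -> fockrel n.+1 (p 0 * f) (e0 x)
| rel_e1 n f x : fockrel n f x -> fockrel n.+1 (rs f) (e1 x)
| rel_0 n : fockrel n 0 0
| rel_lin n c f g x y : fockrel n f x -> fockrel n g y -> fockrel n (c *: f + g) (c *: x + y).

Lemma relD n f g x y : fockrel n f x -> fockrel n g y -> fockrel n (f + g) (x + y).
Proof. by move=> fx gy; rewrite -[f]scale1r -[x]scale1r; apply: rel_lin. Qed.

Lemma relZ n c f x : fockrel n f x -> fockrel n (c *: f) (c *: x).
Proof. by move=> fx; rewrite -[c *: f]addr0 -[c *: x]addr0; apply: rel_lin fx (rel_0 n). Qed.

Lemma scaleSr (V : lmodType K) n (y : V) : n.+1%:R *: y = n%:R *: y + y.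
Proof. by rewrite -addn1 natrD scalerDl scale1r. Qed.

Lemma rel_deg n f x : fockrel n f x -> dg f = n%:R *: f /\ degm M x = n%:R *: x.
Proof.
have dgl := (so_dg so).1.
elim=> {n f x} [|n f x _ [IHf IHx]|n f x _ [IHf IHx]|n|n c f g x y _ [IHf IHx] _ [IHg IHy]].
- by rewrite (derivation1 (so_dg so)) degmE !scale0r.
- rewrite (dg_pM so) degm_raise IHf IHx linearZ /= scale1r !scaleSr.
  by rewrite -scalerAr addrC.
- by rewrite (dg_rs so) degm_raise IHf IHx linearZ /= (derivationZ _ _ (so_rs so)) !scaleSr.
- by split; rewrite ?(linear_at0 dgl) !linear0.
by split; rewrite ?dgl ?[degm M _]linearP /= ?IHf ?IHx ?IHg ?IHy scalerDr !scalerA mulrC.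
Qed.

(** The lowering operators kill 1 and the vacuum and have the same commutators with the raising
    operators on both sides, so they can be pushed through a word. Degree 0 is apart, having no
    degree below it. *)
Lemma rel_low n f x : fockrel n f x ->
  (n = 0%N -> [/\ pd 0 f = 0, f0 x = 0, lw f = 0 & f1 x = 0]) /\
  (forall m, n = m.+1 -> fockrel m (pd 0 f) (f0 x) /\ fockrel m (lw f) (f1 x)).
Proof.
have pdl := (so_pd so 0).1; have lwl := (so_lw so).1.
elim=> {n f x} [|n f x fx [IH0 IHS]|n f x fx [IH0 IHS]|n|n c f g x y _ [IHf0 IHfS] _ [IHg0 IHgS]].
- split=> // _; rewrite (derivation1 (so_pd so 0)) (derivation1 (so_lw so)).
  by rewrite f0_vac f1_vac.
- split=> // m [<-] {m}; rewrite (pd_pM so) mul1r (lw_p0M so) model_f0e0 model_f1e0.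
  rewrite [e0 _ + x]addrC; case: n fx IH0 IHS => [|n] fx IH0 IHS.
    have [-> -> -> ->] := IH0 erefl; rewrite !mulr0 !linear0 !addr0; split=> //; exact: rel_0.
  have [H0 H1] := IHS n erefl; split; last exact: rel_e0.
  by apply: relD => //; exact: rel_e0.
- split=> // m [<-] {m}; rewrite (pd0_rs so) (lw_rs so) model_f0e1 model_f1e1.
  have [-> ->] := rel_deg fx; rewrite !scalerA.
  case: n fx IH0 IHS => [|n] fx IH0 IHS.
    have [-> -> -> ->] := IH0 erefl; rewrite !linear0 (linear_at0 (so_rs so).1) !add0r.
    by split; [exact: rel_0|exact: relZ].
  have [H0 H1] := IHS n erefl; split; first exact: rel_e1.
  by apply: relD; [exact: rel_e1|exact: relZ].
- by rewrite !linear0 (linear_at0 pdl) (linear_at0 lwl); split=> // m _; split; exact: rel_0.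
rewrite pdl lwl !linearP /=; split=> [n0|m nm].
  by have [-> -> -> ->] := IHf0 n0; have [-> -> -> ->] := IHg0 n0; rewrite !scaler0 !addr0.
have [? ?] := IHfS m nm; have [? ?] := IHgS m nm.
by split; apply: rel_lin.
Qed.

Hypothesis char0 : forall n, (n.+1%:R : K) != 0.

(** Multiplication by [p k.+1] is the commutator of [rs] with multiplication by [p k], divided by
    k+1; the partner is the same combination of partners. Only its existence is claimed, since
    multiplication by [p k] is not an operator on the module yet. *)
Lemma rel_pM k n f x : fockrel n f x -> exists y, fockrel (n + k.+1) (p k * f) y.
Proof.
elim: k n f x => [|k IHk] n f x fx; first by exists (e0 x); rewrite addn1; exact: rel_e0.
have [y Hy] := IHk _ _ _ fx; have [z Hz] := IHk _ _ _ (rel_e1 fx).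
exists (k.+1%:R^-1 *: (e1 y + (-1) *: z)).
have -> : p k.+1 * f = k.+1%:R^-1 *: (rs (p k * f) + (-1) *: (p k * rs f)).
  by rewrite (rs_pM so) scaleN1r addrK scalerA mulVf ?scale1r.
apply: relZ; apply: relD; first by rewrite addnS; exact: rel_e1.
by apply: relZ; rewrite addnS -addSn.
Qed.

Lemma rel_ppart (s : seq nat) : 0%N \notin s -> exists x, fockrel (sumn s) (ppart p s) x.
Proof.
rewrite /ppart; elim: s => [|k s IHs]; first by exists 'b_(ones 0); rewrite big_nil; exact: rel_vac.
rewrite inE negb_or => /andP[k0 /IHs[x Hx]].
have [y Hy] := rel_pM k.-1 Hx; exists y; rewrite big_cons /= addnC.
by rewrite prednK ?lt0n // eq_sym in Hy.
Qed.

End OneModel.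
End Rel.

Lemma finitely_many_parts n : exists2 L : seq intpart, uniq L & forall la, (la \in L) = (sumn la == n).
Proof.
pose T := {ffun 'I_n -> 'I_n.+1}.
pose g (t : T) := topart [seq (t i : nat) | i <- enum 'I_n].
exists (undup [seq la : intpart <- [seq g t | t <- enum {: T}] | sumn la == n]); first exact: undup_uniq.
move=> la; rewrite mem_undup mem_filter; apply: andb_idr => /eqP sn.
apply/mapP; exists [ffun i : 'I_n => inord (row la i)]; first by rewrite mem_enum.
apply: row_inj => k; rewrite /g.
have -> : [seq (([ffun i : 'I_n => inord (row la i)] : T) i : nat) | i <- enum 'I_n] =
    [seq row la i | i <- iota 0 n].
  rewrite -val_enum_ord -map_comp; apply: eq_map => i /=.
  rewrite ffunE inordK // ltnS; apply: leq_trans (row_le_sumn _ _) _.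
  by rewrite sn.
rewrite row_topart //; first by move=> i; exact: row_noninc.
by rewrite row_default //; apply: leq_trans (size_le_sumn _) _; rewrite sn.
Qed.

(** * Coordinates and the pairing of two Fock modules *)

Section Coordinates.
Variables (K : fieldType) (I : eqType) (M : freemod K I).

Definition fm_coord (k : I) (x : M) : K := fm_ext M (fun l => (l == k)%:R : K^o) x.

Lemma coE k l : fm_coord k (fm_b M l) = (l == k)%:R.
Proof. by rewrite /fm_coord fm_extE. Qed.

Lemma co_lin k c x y : fm_coord k (c *: x + y) = c * fm_coord k x + fm_coord k y.
Proof. by rewrite /fm_coord linearP. Qed.

Lemma co0 k : fm_coord k 0 = 0.
Proof. by rewrite /fm_coord linear0. Qed.

Lemma coZ k c x : fm_coord k (c *: x) = c * fm_coord k x.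
Proof. by rewrite /fm_coord linearZ. Qed.

Lemma co_sum k (J : Type) (r : seq J) (f : J -> M) :
  fm_coord k (\sum_(j <- r) f j) = \sum_(j <- r) fm_coord k (f j).
Proof. by rewrite /fm_coord linear_sum. Qed.

(** The form for which the basis is orthonormal. It will be taken between vectors built with two
    different vertex structures on the same space. *)
Definition pairing (x y : M) : K := fm_ext M (fun l => fm_coord l y : K^o) x.

Lemma pairing_linl c x x' y : pairing (c *: x + x') y = c * pairing x y + pairing x' y.
Proof. by rewrite /pairing linearP. Qed.

Lemma pairing_bl k y : pairing (fm_b M k) y = fm_coord k y.
Proof. by rewrite /pairing fm_extE. Qed.

Lemma pairing_linr c x y y' : pairing x (c *: y + y') = c * pairing x y + pairing x y'.
Proof.
elim/fm_ind: x => [|a x x' IHx IHx'|k]; first by rewrite /pairing !linear0 mulr0 addr0.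
  by rewrite !pairing_linl IHx IHx'; ring.
by rewrite !pairing_bl co_lin.
Qed.

Lemma pairing_bb k l : pairing (fm_b M k) (fm_b M l) = (k == l)%:R.
Proof. by rewrite pairing_bl coE eq_sym. Qed.

Lemma pairing0l y : pairing 0 y = 0.
Proof. by rewrite /pairing linear0. Qed.

Lemma pairing0r x : pairing x 0 = 0.
Proof. by have := pairing_linr (-1) x 0 0; rewrite scaler0 addr0 mulN1r addNr. Qed.

Lemma pairingZl c x y : pairing (c *: x) y = c * pairing x y.
Proof. by rewrite -[c *: x]addr0 pairing_linl pairing0l addr0. Qed.

Lemma pairingZr c x y : pairing x (c *: y) = c * pairing x y.
Proof. by rewrite -[c *: y]addr0 pairing_linr pairing0r addr0. Qed.

Lemma pairing_suml (J : Type) (r : seq J) (f : J -> M) y :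
  pairing (\sum_(j <- r) f j) y = \sum_(j <- r) pairing (f j) y.
Proof. by rewrite /pairing linear_sum. Qed.

Lemma pairing_sumr (J : Type) (r : seq J) (f : J -> M) x :
  pairing x (\sum_(j <- r) f j) = \sum_(j <- r) pairing x (f j).
Proof.
elim: r => [|j r IHr]; first by rewrite !big_nil pairing0r.
by rewrite !big_cons -[f j]scale1r pairing_linr mul1r IHr scale1r.
Qed.

(** Stated for every list containing a support, so that several vectors can be expanded over one
    list. *)
Lemma fm_supp (x : M) : exists S : seq I, forall S', uniq S' -> {subset S <= S'} ->
  x = \sum_(k <- S') fm_coord k x *: fm_b M k.
Proof.
elim/fm_ind: x => [|c x y [S Sx] [S0 Sy]|k].
- exists [::] => S' _ _; rewrite big1 // => k _; by rewrite co0 scale0r.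
- exists (S ++ S0) => S' uS' sub.
  rewrite {1}(Sx S') // => [|k kS]; last by apply: sub; rewrite mem_cat kS.
  rewrite {1}(Sy S') // => [|k kS]; last by apply: sub; rewrite mem_cat kS orbT.
  rewrite scaler_sumr -big_split; apply: eq_bigr => k _.
  by rewrite co_lin scalerA scalerDl.
exists [:: k] => S' uS' /(_ k (mem_head _ _)) kS'.
rewrite (bigD1_seq k) //= coE eqxx scale1r big1 ?addr0 // => l.
by rewrite eq_sym coE => /negPf ->; rewrite scale0r.
Qed.
End Coordinates.

Section Pairing.
Variables (K : fieldType) (M : freemod K intpart).
Hypothesis char0 : forall n, (n.+1%:R : K) != 0.

Lemma co_degm mu (x : M) : fm_coord mu (degm M x) = (sumn mu)%:R * fm_coord mu x.
Proof.
elim/fm_ind: x => [|c x y IHx IHy|la].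
- by rewrite linear0 !co0 mulr0.
- by rewrite linearP !co_lin IHx IHy; ring.
by rewrite degmE coZ coE; case: eqP => [->|_] //; rewrite !mulr0.
Qed.

Lemma natr_neq m n : m <> n -> (m%:R : K) != n%:R.
Proof.
wlog mn : m n / (m < n)%N => [hw|_].
  move=> mn; case: (ltngtP m n) => [lt|lt|//]; first exact: hw.
  by rewrite eq_sym; apply: hw => // /esym.
rewrite eq_sym -subr_eq0 -natrB; last exact: ltnW.
by rewrite -subn_gt0 in mn; rewrite -(prednK mn).
Qed.

(** In characteristic zero distinct degrees stay distinct in K, so an eigenvector of the grading has
    no coordinate outside its degree. *)
Lemma degm_supp n (L : seq intpart) (x : M) : uniq L -> (forall la, (la \in L) = (sumn la == n)) ->
  degm M x = n%:R *: x -> x = \sum_(la <- L) fm_coord la x *: 'b_la.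
Proof.
move=> uL mL dx; have [S HS] := fm_supp x.
have Z la : la \notin L -> fm_coord la x = 0.
  rewrite mL => /eqP/natr_neq ne; have := co_degm la x; rewrite dx coZ.
  move/eqP; rewrite -subr_eq0 -mulrBl mulf_eq0 subr_eq0 eq_sym (negPf ne) /=.
  by move/eqP.
rewrite {1}(HS (undup (S ++ L))) ?undup_uniq //; last first.
  by move=> k kS; rewrite mem_undup mem_cat kS.
rewrite (bigID (fun la => la \in L)) /= [X in _ + X]big1 ?addr0; last first.
  by move=> la /Z ->; rewrite scale0r.
rewrite -big_filter; apply: perm_big; apply: uniq_perm => //.
  by rewrite filter_uniq ?undup_uniq.
by move=> la; rewrite mem_filter mem_undup mem_cat; case: (la \in L); rewrite ?orbT.
Qed.

Lemma pairing_deg n (L : seq intpart) (x y : M) : uniq L -> (forall la, (la \in L) = (sumn la == n)) ->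
  degm M x = n%:R *: x -> pairing x y = \sum_(la <- L) fm_coord la x * fm_coord la y.
Proof.
move=> uL mL dx; rewrite {1}(degm_supp uL mL dx) pairing_suml.
by apply: eq_bigr => la _; rewrite pairingZl pairing_bl.
Qed.

Lemma raise_adj (up dn : intpart -> nat -> K) (w w' : nat -> nat -> K) c :
  (forall la j, removable la j -> c * (dn la j * w' j (row la j).-1) = up (prem la j) j * w j (row la j).-1) ->
  forall x y, pairing (raise M up w x) y = c * pairing x (lower M dn w' y).
Proof.
move=> E x y; elim/fm_ind: x => [|a x x' IHx IHx'|la].
- by rewrite linear0 !pairing0l mulr0.
- by rewrite linearP !pairing_linl /= IHx IHx'; ring.
elim/fm_ind: y => [|a y y' IHy IHy'|mu].
- by rewrite linear0 !pairing0r mulr0.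
- by rewrite linearP !pairing_linr /= IHy IHy'; ring.
rewrite raiseE lowerE /raise_at /lower_at pairing_suml pairing_sumr mulr_sumr.
under eq_bigr do rewrite pairingZl pairing_bb.
under [RHS]eq_bigr do rewrite pairingZr pairing_bb.
pose N := (maxn (size la) (size mu)).+1.
rewrite (@sum_addrows _ _ N); last by rewrite ltnS leq_maxl.
rewrite (@sum_remrows _ _ N); last by rewrite leqW ?leq_maxr.
rewrite big_mkcond [RHS]big_mkcond; apply: eq_bigr => i _.
case: ifP => ai; case: ifP => ri.
- case: eqP => [Epa|ne].
    have Eq : la = prem mu i by rewrite -Epa prem_padd.
    rewrite [in RHS]Eq eqxx !mulr1 E // -Eq -Epa row_padd // /incr eqxx addn1.
    by [].
  case: eqP => [Epr|_]; last by rewrite !mulr0.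
  by case: ne; rewrite Epr padd_prem.
- case: eqP => [Epa|_]; last by rewrite mulr0.
  by move: ri; rewrite -Epa removable_padd.
- case: eqP => [Epr|_]; last by rewrite !mulr0.
  by move: ai; rewrite Epr addable_prem.
by [].
Qed.
End Pairing.

Section JackBasis.
Variables (K : fieldType) (F : comAlgType K) (p : nat -> F).
Variables (pd : nat -> F -> F) (rs lw dg : F -> F) (al : K) (jf : F -> F -> K).
Hypothesis so : symops p pd rs lw dg.
Hypothesis sf : symform p pd al jf.
Hypothesis char0 : forall n, (n.+1%:R : K) != 0.
Variables (M : freemod K intpart).

Lemma jf0 g : jf 0 g = 0.
Proof. by have := jf_lin sf (-1) 0 0 g; rewrite scaler0 addr0 mulN1r addNr. Qed.

Lemma jfZ c f g : jf (c *: f) g = c * jf f g.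
Proof. by rewrite -[c *: f]addr0 (jf_lin sf) jf0 addr0. Qed.

Lemma jfD f f' g : jf (f + f') g = jf f g + jf f' g.
Proof. by rewrite -[f]scale1r (jf_lin sf) mul1r scale1r. Qed.

Lemma jf_linr c f g h : jf h (c *: f + g) = c * jf h f + jf h g.
Proof. by rewrite ![jf h _](jf_sym sf) (jf_lin sf). Qed.

Lemma jfZr c f g : jf f (c *: g) = c * jf f g.
Proof. by rewrite ![jf f _](jf_sym sf) jfZ. Qed.

Lemma jfDr f g g' : jf f (g + g') = jf f g + jf f g'.
Proof. by rewrite ![jf f _](jf_sym sf) jfD. Qed.

Lemma jf_1p k g : jf 1 (p k * g) = 0.
Proof. by rewrite (jf_sym sf) (jf_p sf) (derivation1 (so_pd so k)) (jf_sym sf) jf0 mulr0. Qed.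

Lemma jf_1lw g : jf 1 (lw g) = 0.
Proof.
move: g; apply: (so_gen so) => [|k g _||c f g IHf IHg].
- by rewrite (derivation1 (so_lw so)) (jf_sym sf) jf0.
- case: k => [|k]; first by rewrite (lw_p0M so) jf_1p.
  by rewrite (lw_pSM so) jfDr jfZr !jf_1p mulr0 addr0.
- by rewrite (linear_at0 (so_lw so).1) (jf_sym sf) jf0.
by rewrite (so_lw so).1 jf_linr IHf IHg mulr0 addr0.
Qed.

(** Induction on [f]: the term that [rs_pM] creates when [rs] passes [p k] is matched by the one
    that [pd_lw] creates when [lw] passes [pd k]. *)
Lemma jf_rs f g : jf (rs f) g = jf f (lw g).
Proof.
move: f g; apply: (so_gen so) => [g|k f IHf g|g|c f f' IHf IHf' g].
- by rewrite (derivation1 (so_rs so)) jf0 jf_1lw.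
- rewrite (rs_pM so) jfD jfZ !(jf_p sf) IHf (pd_lw so) jfDr jfZr; ring.
- by rewrite (linear_at0 (so_rs so).1) !jf0.
by rewrite (so_rs so).1 !(jf_lin sf) IHf IHf'.
Qed.

Variables (up dn : intpart -> nat -> K) (u v : nat -> nat -> K).
Variables (up' dn' : intpart -> nat -> K) (u' v' : nat -> nat -> K).
Hypothesis fk : fockmodel up dn u v.
Hypothesis fk' : fockmodel up' dn' u' v'.
Hypothesis adj0 : forall la j, removable la j -> al * dn' la j = up (prem la j) j.
Hypothesis adju : forall la j, removable la j ->
  dn' la j * v' j (row la j).-1 = up (prem la j) j * u j (row la j).-1.

Local Notation rel1 := (fockrel p rs (M := M) up u).
Local Notation rel2 := (fockrel p rs (M := M) up' u').

Lemma co_vac_raise (w : nat -> nat -> K) (x : M) : fm_coord (ones 0) (raise M up' w x) = 0.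
Proof.
elim/fm_ind: x => [|c x y IHx IHy|la]; first by rewrite linear0 co0.
  by rewrite linearP co_lin IHx IHy mulr0 addr0.
rewrite raiseE /raise_at co_sum big_seq big1 // => i; rewrite mem_addrows => ai.
rewrite coZ coE; case: eqP => [E|_]; last by rewrite mulr0.
by have := sumn_padd ai; rewrite E.
Qed.

(** Induction on the word building [f]. Its outer raising operator crosses the form and becomes
    [pd 0] or [lw] on [g], and the matching lowering operator of the second module on [y]; by
    [rel_low] the results are related again. *)
Lemma rel_pairing n f x m g y : rel1 n f x -> rel2 m g y -> jf f g = pairing x y.
Proof.
move=> fx; elim: fx m g y => {n f x} [|n f x fx IH|n f x fx IH|n|n c f f' x x' _ IH _ IH'] m g y gy.
- elim: gy => {m g y} [|m g y _ _|m g y _ _|m|m c f g x y _ IHf _ IHg].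
  + by rewrite (jf_11 sf) pairing_bb eqxx.
  + by rewrite jf_1p pairing_bl co_vac_raise.
  + by rewrite (jf_sym sf) jf_rs (derivation1 (so_lw so)) (jf_sym sf) jf0 pairing_bl co_vac_raise.
  + by rewrite (jf_sym sf) jf0 pairing0r.
  by rewrite jf_linr pairing_linr IHf IHg.
- rewrite (jf_p sf) mul1r (@raise_adj _ _ up dn' (wt1 K) (wt1 K) al); last first.
    by move=> la j rj; rewrite /wt1 !mulr1 adj0.
  have [H0 HS] := rel_low so fk' gy; congr (_ * _); case: m gy H0 HS => [|m] gy H0 HS.
    by have [-> -> _ _] := H0 erefl; apply: (IH 0%N); exact: rel_0.
  by have [H _] := HS m erefl; exact: IH H.
- rewrite jf_rs (@raise_adj _ _ up dn' u v' 1) ?mul1r; last first.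
    by move=> la j rj; rewrite mul1r adju.
  have [H0 HS] := rel_low so fk' gy; case: m gy H0 HS => [|m] gy H0 HS.
    by have [_ _ -> ->] := H0 erefl; apply: (IH 0%N); exact: rel_0.
  by have [_ H] := HS m erefl; exact: IH H.
- by rewrite jf0 pairing0l.
by rewrite (jf_lin sf) pairing_linl (IH _ _ _ gy) (IH' _ _ _ gy).
Qed.

(** The products of power sums of degree n all have partners, as many as there are basis vectors of
    degree n. Orthogonality against their partners in the second module exhibits an inverse of the
    coordinate matrix, so each basis vector is a combination of partners. *)
Lemma rel_basis (la : intpart) : exists f, rel1 (sumn la) f 'b_la.
Proof.
set n := sumn la; have [L uL mL] := finitely_many_parts n.
pose N := size L; pose lam (i : 'I_N) : intpart := nth (ones 0) L i.
have lamL i : sumn (lam i) = n by apply/eqP; rewrite -mL mem_nth.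
have ex1 i : exists x, rel1 n (ppart p (lam i)) x.
  rewrite -(lamL i); apply: (rel_ppart so) => //.
  by have /andP[] := valP (lam i).
have ex2 i : exists x, rel2 n (ppart p (lam i)) x.
  rewrite -(lamL i); apply: (rel_ppart so) => //.
  by have /andP[] := valP (lam i).
have [x Hx] := fin_all_exists ex1; have [y Hy] := fin_all_exists ex2.
pose A : 'M[K]_N := \matrix_(i, j) fm_coord (lam j) (x i).
pose B : 'M[K]_N := \matrix_(i, j) fm_coord (lam j) (y i).
pose z i := jf (ppart p (lam i)) (ppart p (lam i)).
(* The entries of [A *m C] are the pairings of [x i] with [y k] divided by [z k], hence by
   [rel_pairing] quotients of values of the form on power sums. *)
pose C : 'M[K]_N := \matrix_(j, i) ((z i)^-1 * B i j).
have sumL (V : nmodType) (G : intpart -> V) : \sum_(mu <- L) G mu = \sum_(j < N) G (lam j).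
  by rewrite (big_nth (ones 0)) big_mkord.
have lam_inj i j : lam i = lam j -> i = j.
  by move=> /eqP; rewrite nth_uniq // => /eqP/val_inj.
have AC : A *m C = 1%:M.
  apply/matrixP => i k; rewrite !mxE.
  transitivity ((z k)^-1 * pairing (x i) (y k)).
    rewrite (pairing_deg char0 _ uL mL (rel_deg so (Hx i)).2) sumL mulr_sumr.
    by apply: eq_bigr => j _; rewrite !mxE mulrCA.
  rewrite -(rel_pairing (Hx i) (Hy k)); have [->|ik] := eqVneq i k.
    by rewrite mulVf // (jf_norm sf).
  by rewrite (jf_orth sf) ?mulr0 // => /lam_inj/eqP; rewrite (negPf ik).
have CA := mulmx1C AC.
have CAE j k : \sum_i C j i * fm_coord (lam k) (x i) = (j == k)%:R.
  have /matrixP/(_ j k) := CA; rewrite mxE [RHS]mxE => <-.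
  by apply: eq_bigr => i _; rewrite [A i k]mxE.
have laL : la \in L by rewrite mL.
have [j Hj] : exists j, lam j = la.
  by exists (Ordinal (etrans (index_mem la L) laL)); rewrite /lam /= nth_index.
exists (\sum_i C j i *: ppart p (lam i)).
have -> : 'b_la = \sum_i C j i *: x i :> M.
  under eq_bigr do rewrite {1}(degm_supp char0 uL mL (rel_deg so (Hx _)).2) sumL scaler_sumr.
  rewrite exchange_big /= -Hj (bigD1 j) //= [X in _ + X]big1 ?addr0 => [|k kj].
    under eq_bigr do rewrite scalerA.
    by rewrite -scaler_suml CAE eqxx scale1r.
  under eq_bigr do rewrite scalerA.
  by rewrite -scaler_suml CAE eq_sym (negPf kj) scale0r.
elim/big_rec2: _ => [|i f w _ Hw]; first exact: rel_0.
exact: rel_lin.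
Qed.
End JackBasis.

(** * The Jack basis *)

Record jackbasis (K : fieldType) (F : comAlgType K) (p : nat -> F) (pd : nat -> F -> F)
    (rs lw dg : F -> F) (up dn : intpart -> nat -> K) (u v : nat -> nat -> K)
    (j : intpart -> F) : Prop := JackBasis {
  jb_vac : j (ones 0) = 1;
  jb_p0 : forall la, p 0 * j la = \sum_(i <- addrows la) up la i *: j (padd la i);
  jb_rs : forall la, rs (j la) =
     \sum_(i <- addrows la) (up la i * u i (row la i)) *: j (padd la i);
  jb_pd : forall la, pd 0 (j la) = \sum_(i <- remrows la) dn la i *: j (prem la i);
  jb_lw : forall la, lw (j la) =
     \sum_(i <- remrows la) (dn la i * v i (row la i).-1) *: j (prem la i);
  jb_dg : forall la, dg (j la) = (sumn la)%:R *: j la }.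

Section JackPair.
Variables (K : fieldType) (F : comAlgType K) (p : nat -> F).
Variables (pd : nat -> F -> F) (rs lw dg : F -> F) (al : K) (jf : F -> F -> K).
Hypothesis so : symops p pd rs lw dg.
Hypothesis sf : symform p pd al jf.
Hypothesis char0 : forall n, (n.+1%:R : K) != 0.
Hypothesis al0 : al != 0.
Hypothesis nondeg : forall f, (forall g, jf f g = 0) -> f = 0.
Variables (M : freemod K intpart).

Section Unique.
Variables (up dn up' dn' : intpart -> nat -> K) (u v : nat -> nat -> K).
Hypothesis fk : fockmodel up dn u v.
Hypothesis fk' : fockmodel up' dn' u v.
Hypothesis adj0 : forall la j, removable la j -> al * dn' la j = up (prem la j) j.
Hypothesis vu : forall i j, v i j = al * u i j.

Local Notation rel1 := (fockrel p rs (M := M) up u).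
Local Notation rel2 := (fockrel p rs (M := M) up' u).

Lemma adju la j : removable la j ->
  dn' la j * v j (row la j).-1 = up (prem la j) j * u j (row la j).-1.
Proof. by move=> rj; rewrite -adj0 // vu; ring. Qed.

(** By [rel_pairing], [f] is orthogonal to everything related in the second module. This property of
    [h] passes to [pd k h], because multiplication by [p k] preserves having a partner; removing the
    generators of [g] one by one gives orthogonality to all [g]. *)
Lemma rel_eq0 n f : rel1 n f 0 -> f = 0.
Proof.
move=> f0; apply: nondeg.
have K1 m g y : rel2 m g y -> jf f g = 0.
  by move=> gy; rewrite (rel_pairing so sf fk' adj0 adju f0 gy) pairing0l.
suff : forall g h, (forall m g' y, rel2 m g' y -> jf h g' = 0) -> jf h g = 0.
  by move=> H g; apply: H K1.
apply: (so_gen so) => [h Hh|k g IHg h Hh|h Hh|c f1 g IHf IHg h Hh].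
- exact: Hh (rel_vac _ _ _ _ _).
- rewrite (jf_sym sf) (jf_p sf) (jf_sym sf) IHg ?mulr0 // => m g' y g'y.
  apply: (mulfI (mulf_neq0 (char0 k) al0)); rewrite mulr0 (jf_sym sf) -(jf_p sf) (jf_sym sf).
  by have [y' H] := rel_pM so char0 k g'y; exact: Hh H.
- by rewrite (jf_sym sf) (jf0 sf).
by rewrite (jf_linr sf) IHf // IHg // mulr0 addr0.
Qed.

Lemma rel_uniq n f g x : rel1 n f x -> rel1 n g x -> f = g.
Proof.
move=> fx gx; apply/eqP; rewrite -subr_eq0; apply/eqP; apply: (@rel_eq0 n).
have -> : 0 = (-1) *: x + x by rewrite scaleN1r addNr.
have -> : f - g = (-1) *: g + f by rewrite scaleN1r addrC.
exact: rel_lin.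
Qed.

Lemma rel_sum n (r : seq nat) (c : nat -> K) (f : nat -> F) (x : nat -> M) :
  (forall i, i \in r -> rel1 n (f i) (x i)) ->
  rel1 n (\sum_(i <- r) c i *: f i) (\sum_(i <- r) c i *: x i).
Proof.
elim: r => [|i r IHr] H; first by rewrite !big_nil; exact: rel_0.
rewrite !big_cons; apply: rel_lin; first by apply: H; rewrite mem_head.
by apply: IHr => k kr; apply: H; rewrite inE kr orbT.
Qed.

Lemma rel_jackbasis (j : intpart -> F) : (forall la : intpart, rel1 (sumn la) (j la) 'b_la) ->
  jackbasis p pd rs lw dg up dn u v j.
Proof.
move=> Hj.
have low (la : intpart) i : i \in remrows la -> rel1 (sumn la).-1 (j (prem la i)) 'b_(prem la i).
  by rewrite mem_remrows => ri; rewrite (sumn_prem ri); exact: Hj.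
have upp (la : intpart) i : i \in addrows la -> rel1 (sumn la).+1 (j (padd la i)) 'b_(padd la i).
  by rewrite mem_addrows => ri; rewrite -(sumn_padd ri); exact: Hj.
split.
- exact: (rel_uniq (Hj (ones 0)) (rel_vac _ _ _ _ _)).
- move=> la; apply: (@rel_uniq (sumn la).+1 _ _ (raise M up (wt1 K) 'b_la)).
    exact: rel_e0.
  have -> : raise M up (wt1 K) 'b_la = \sum_(i <- addrows la) up la i *: 'b_(padd la i).
    by rewrite raiseE; apply: eq_bigr => i _; rewrite mulr1.
  by apply: rel_sum; apply: upp.
- move=> la; apply: (@rel_uniq (sumn la).+1 _ _ (raise M up u 'b_la)).
    exact: rel_e1.
  by rewrite raiseE /raise_at; apply: rel_sum; apply: upp.
- move=> la; have [H0 HS] := rel_low so fk (Hj la).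
  have [/eqP z|nz] := eqVneq (sumn la) 0%N.
    have [-> _ _ _] := H0 (eqP z); move: z; rewrite sumn_eq0 => /eqP ->.
    by rewrite big_nil.
  apply: (@rel_uniq (sumn la).-1 _ _ (lower M dn (wt1 K) 'b_la)).
    by have [] := HS (sumn la).-1; rewrite ?prednK ?lt0n.
  have -> : lower M dn (wt1 K) 'b_la = \sum_(i <- remrows la) dn la i *: 'b_(prem la i).
    by rewrite lowerE; apply: eq_bigr => i _; rewrite mulr1.
  by apply: rel_sum; apply: low.
- move=> la; have [H0 HS] := rel_low so fk (Hj la).
  have [/eqP z|nz] := eqVneq (sumn la) 0%N.
    have [_ _ -> _] := H0 (eqP z); move: z; rewrite sumn_eq0 => /eqP ->.
    by rewrite big_nil.
  apply: (@rel_uniq (sumn la).-1 _ _ (lower M dn v 'b_la)).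
    by have [] := HS (sumn la).-1; rewrite ?prednK ?lt0n.
  by rewrite lowerE /lower_at; apply: rel_sum; apply: low.
by move=> la; have [] := rel_deg so (Hj la).
Qed.
End Unique.

Variables (up dn up' dn' : intpart -> nat -> K) (u v : nat -> nat -> K).
Hypothesis fk : fockmodel up dn u v.
Hypothesis fk' : fockmodel up' dn' u v.
Hypothesis adj0 : forall la j, removable la j -> al * dn' la j = up (prem la j) j.
Hypothesis adj0' : forall la j, removable la j -> al * dn la j = up' (prem la j) j.
Hypothesis vu : forall i j, v i j = al * u i j.

Theorem jackpair_exists : exists j js : intpart -> F,
  [/\ jackbasis p pd rs lw dg up dn u v j, jackbasis p pd rs lw dg up' dn' u v js
    & forall la mu, jf (j la) (js mu) = (la == mu)%:R].
Proof.
have [j Hj] := boolp.choice (rel_basis so sf char0 M fk' adj0 (adju adj0 vu)).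
have [js Hjs] := boolp.choice (rel_basis so sf char0 M fk adj0' (adju adj0' vu)).
exists j, js; split.
- exact: (rel_jackbasis fk fk' adj0 vu Hj).
- exact: (rel_jackbasis fk' fk adj0' vu Hjs).
by move=> la mu; rewrite (rel_pairing so sf fk' adj0 (adju adj0 vu) (Hj la) (Hjs mu)) pairing_bb.
Qed.
End JackPair.

(** * Restriction of the alphabet *)

Section Restriction.
Variables (K : fieldType) (F : comAlgType K) (p : nat -> F).
Variables (pd : nat -> F -> F) (rs lw dg : F -> F) (al : K) (jf : F -> F -> K).
Hypothesis so : symops p pd rs lw dg.
Hypothesis sf : symform p pd al jf.
Hypothesis char0 : forall n, (n.+1%:R : K) != 0.
Hypothesis al0 : al != 0.
Hypothesis nondeg : forall f, (forall g, jf f g = 0) -> f = 0.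

(* [tau] adds one variable X to the alphabet of a symmetric function. *)
Variable tau : {rmorphism F -> {poly F}}.
Hypothesis tauZ : forall c f, tau (c *: f) = (c%:A)%:P * tau f.
Hypothesis taup : forall k, tau (p k) = (p k)%:P + 'X^(k.+1).

(** The coefficient of X^k after adding a variable; classically, skewing by the complete function
    h_k. *)
Definition var_coef k f : F := (tau f)`_k.
Local Notation R := var_coef.

Lemma var_coef_lin k c f g : R k (c *: f + g) = c *: R k f + R k g.
Proof. by rewrite /R rmorphD /= tauZ coefD coefCM mulr_algl. Qed.

Lemma var_coef0 k : R k 0 = 0.
Proof. by rewrite /R rmorph0 coef0. Qed.

Lemma var_coefZ k c f : R k (c *: f) = c *: R k f.
Proof. by rewrite -[c *: f]addr0 var_coef_lin var_coef0 addr0. Qed.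

Lemma var_coefD k f g : R k (f + g) = R k f + R k g.
Proof. by rewrite -[f]scale1r var_coef_lin !scale1r. Qed.

Lemma var_coef_1 k : R k 1 = (k == 0%N)%:R.
Proof. by rewrite /R rmorph1 coef1. Qed.

Lemma var_coef_pM k i f : R k (p i * f) = p i * R k f + (if (k <= i)%N then 0 else R (k - i.+1) f).
Proof. by rewrite /R rmorphM /= taup mulrDl coefD coefCM coefXnM. Qed.

Lemma var_coef_id f : R 0 f = f.
Proof.
move: f; apply: (so_gen so) => [|k f IHf||c f g IHf IHg].
- by rewrite var_coef_1.
- by rewrite var_coef_pM /= IHf addr0.
- exact: var_coef0.
by rewrite var_coef_lin IHf IHg.
Qed.

Lemma var_coef_pd0 k f : R k (pd 0 f) = pd 0 (R k f).
Proof.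
have dpd := so_pd so 0.
move: f k; apply: (so_gen so) => [k|i f IHf k|k|c f g IHf IHg k].
- by rewrite var_coef_1 (derivation1 dpd) var_coef0 (derivation_nat _ dpd).
- rewrite (pd_pM so) var_coefD !var_coef_pM (derivationD _ _ dpd) (pd_pM so) IHf.
  have -> : R k ((i == 0%N)%:R * f) = (i == 0%N)%:R * R k f by case: eqP; rewrite ?mul0r ?mul1r ?var_coef0.
  by rewrite addrA; congr (_ + _); case: ifP => _; rewrite ?IHf // (linear_at0 dpd.1).
- by rewrite (linear_at0 dpd.1) var_coef0 (linear_at0 dpd.1).
by rewrite dpd.1 !var_coef_lin dpd.1 IHf IHg.
Qed.

(** [lw] is the sum of the partial derivatives in the variables, minus the number of variables times
    [pd 0] so that p_1 is killed. One more variable X gives tau lw = (lw + d/dX - pd 0) tau, and the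
    lemma compares the coefficients of X^k. *)
Lemma var_coef_rec k f : k.+1%:R *: R k.+1 f = R k (lw f) - lw (R k f) + pd 0 (R k f).
Proof.
have dpd := so_pd so 0; have dlw := so_lw so.
move: f k; apply: (so_gen so) => [k|i f IHf k|k|c f g IHf IHg k].
- rewrite !var_coef_1 (derivation1 dlw) (derivation_nat _ dpd) (derivation_nat _ dlw) var_coef0.
  by rewrite subr0 addr0 scaler0.
- have IH1 m : (if (m <= i)%N then 0 else R (m - i.+1) (lw f)) -
        lw (if (m <= i)%N then 0 else R (m - i.+1) f) +
        pd 0 (if (m <= i)%N then 0 else R (m - i.+1) f) =
      if (m <= i)%N then 0 else (m - i)%:R *: R (m - i) f.
    case: leqP => mi; first by rewrite (linear_at0 dlw.1) (linear_at0 dpd.1) subr0 addr0.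
    by rewrite -IHf subnSK.
  rewrite !var_coef_pM scalerDr scalerAr IHf.
  case: i IH1 => [|i] IH1.
    rewrite (lw_p0M so) var_coef_pM !(derivationD _ _ dlw) !(derivationD _ _ dpd) (lw_p0M so) (pd_pM so) mul1r.
    have := IH1 k; set X := (if _ then _ else R _ (lw f)); set Y := lw (if _ then _ else _).
    set Z := pd 0 (if _ then _ else _) => E.
    transitivity (p 0 * (R k (lw f) - lw (R k f) + pd 0 (R k f)) + (R k f + (X - Y + Z))); last by ring.
    rewrite E; congr (_ + _); rewrite subn0 subn1 ltn0 /=; case: k {IH1 E X Y Z} => [|k] /=.
      by rewrite scale1r addr0.
    by rewrite -[k.+2]addn1 natrD scalerDl scale1r addrC.
  rewrite (lw_pSM so) var_coefD var_coefZ !var_coef_pM !(derivationD _ _ dlw) !(derivationD _ _ dpd) (lw_pSM so) (pd_pM so) mul0r add0r.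
  have := IH1 k; set X := (if _ then _ else R _ (lw f)); set Y := lw (if _ then _ else _).
  set Z := pd 0 (if _ then _ else _) => E.
  rewrite scalerDr; set W := i.+2%:R *: (if _ then _ else _).
  transitivity (p i.+1 * (R k (lw f) - lw (R k f) + pd 0 (R k f)) + (W + (X - Y + Z))); last by ring.
  rewrite E /W; congr (_ + _); case: (ltngtP k i.+1) => ki.
  - by rewrite -ltnS ki !scaler0 addr0.
  - have -> : (k <= i)%N = false by apply/negbTE; rewrite -ltnNge; apply: ltnW.
    rewrite subSS -scalerDl -natrD; congr (_%:R *: _); clear -ki; lia.
  by rewrite ki ltnn addr0 subSS.
- by rewrite !(linear_at0 dlw.1, var_coef0, linear_at0 dpd.1) scaler0 subr0 addr0.
rewrite dlw.1 !var_coef_lin dlw.1 dpd.1 scalerDr scalerA mulrC -scalerA IHf IHg.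
by rewrite !scalerDr scalerN; ring.
Qed.

Lemma var_coef1 f : R 1 f = pd 0 f.
Proof. by have := var_coef_rec 0 f; rewrite scale1r !var_coef_id subrr add0r. Qed.

Lemma var_coef_comm k l f : R k (R l f) = R l (R k f).
Proof.
move: f k l; apply: (so_gen so) => [k l|i f IHf k l|k l|c f g IHf IHg k l].
- by rewrite !var_coef_1; case: k => [|k]; case: l => [|l]; rewrite ?var_coef_1 ?var_coef0.
- rewrite !var_coef_pM !var_coefD !var_coef_pM IHf -!addrA; congr (_ + _).
  by rewrite addrC; congr (_ + _); case: ifP => _; rewrite ?var_coef0.
- by rewrite !var_coef0.
by rewrite !var_coef_lin IHf IHg.
Qed.

(* The coefficient of the monomial with exponents [s]; [jf f 1] is the constant
   term of [f] in the power sums. *)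
Fixpoint xcoef (s : seq nat) (f : F) : K :=
  if s is k :: s' then xcoef s' (R k f) else jf f 1.

Lemma xcoef_lin s c f g : xcoef s (c *: f + g) = c * xcoef s f + xcoef s g.
Proof. by elim: s f g => [|k s IHs] f g /=; rewrite ?(jf_lin sf) // var_coef_lin IHs. Qed.

Lemma xcoef0 s : xcoef s 0 = 0.
Proof. by elim: s => [|k s IHs] /=; rewrite ?(jf0 sf) // var_coef0. Qed.

Lemma xcoefZ s c f : xcoef s (c *: f) = c * xcoef s f.
Proof. by rewrite -[c *: f]addr0 xcoef_lin xcoef0 addr0. Qed.

Lemma xcoefD s f g : xcoef s (f + g) = xcoef s f + xcoef s g.
Proof. by rewrite -[f]scale1r xcoef_lin mul1r scale1r. Qed.

Lemma xcoef_sum s (I : Type) (r : seq I) (f : I -> F) :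
  xcoef s (\sum_(i <- r) f i) = \sum_(i <- r) xcoef s (f i).
Proof. by elim: r => [|i r IHr]; rewrite ?big_nil ?xcoef0 // !big_cons xcoefD IHr. Qed.

Lemma xcoef_cat s t f : xcoef (s ++ t) f = xcoef t (foldl (fun g k => R k g) f s).
Proof. by elim: s f => [|k s IHs] f /=. Qed.

Lemma xcoef_catCons s k t f : xcoef (s ++ k :: t) f = xcoef (k :: s ++ t) f.
Proof.
rewrite /= !xcoef_cat /=; congr (xcoef t _).
by elim: s f => [|l s IHs] f //=; rewrite IHs var_coef_comm.
Qed.

Lemma xcoef_perm s t f : perm_eq s t -> xcoef s f = xcoef t f.
Proof.
elim: s t f => [|k s IHs] t f; first by rewrite perm_sym => /perm_nilP ->.
move=> pst; have kt : k \in t by rewrite -(perm_mem pst) mem_head.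
case/splitPr: kt pst => t1 t2 pst; rewrite xcoef_catCons /=.
apply: IHs; rewrite -(perm_cons k) (perm_trans pst) //.
by rewrite perm_catC /= perm_cons perm_catC.
Qed.

Lemma xcoef_filter s f : xcoef [seq k <- s | k != 0%N] f = xcoef s f.
Proof. by elim: s f => [|[|k] s IHs] f //=; rewrite ?var_coef_id IHs. Qed.

(** Functions with all coefficients zero are stable under [lw] by [var_coef_rec], then under every
    [pd k] by the commutator [pd_lw]. Carrying the generators of [g] across the form shows such an
    [f] orthogonal to every [g]. *)
Lemma xcoef_separates f : (forall s, xcoef s f = 0) -> f = 0.
Proof.
move=> f0; apply: nondeg => g; rewrite (jf_sym sf).
have Slw h : (forall s, xcoef s h = 0) -> forall s, xcoef s (lw h) = 0.
  move=> h0 s; elim: s h h0 => [|k s IHs] h h0 /=.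
    by rewrite (jf_sym sf) (jf_1lw so sf).
  have -> : R k (lw h) = k.+1%:R *: R k.+1 h + (lw (R k h) + (-1) *: pd 0 (R k h)).
    by rewrite (var_coef_rec k h) scaleN1r; ring.
  rewrite xcoef_lin xcoefD xcoefZ (IHs (R k h)) => [|t]; last exact: (h0 (k :: t)).
  by rewrite (h0 (k.+1 :: s) : xcoef s (R k.+1 h) = 0) -var_coef1 (h0 [:: k, 1 & s]%N : xcoef s (R 1 (R k h)) = 0) !mulr0 !addr0.
have Spd k h : (forall s, xcoef s h = 0) -> forall s, xcoef s (pd k h) = 0.
  elim: k h => [|k IHk] h h0 s; first by rewrite -var_coef1; apply: (h0 (1%N :: s)).
  apply: (mulfI (char0 k.+1)); rewrite mulr0 -xcoefZ.
  have -> : k.+2%:R *: pd k.+1 h = pd k (lw h) + (-1) *: lw (pd k h).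
    by rewrite (pd_lw so) scaleN1r addrC addKr.
  by rewrite xcoefD xcoefZ (IHk (lw h)) ?(Slw (pd k h)) ?mulr0 ?addr0 //; [apply: IHk | apply: Slw].
move: g f f0; apply: (so_gen so) => [f f0|k g IHg f f0|f f0|c g h IHg IHh f f0].
- by rewrite (jf_sym sf); apply: (f0 [::]).
- by rewrite (jf_p sf) IHg ?mulr0 //; apply: Spd.
- exact: (jf0 sf).
by rewrite (jf_lin sf) IHg // IHh // mulr0 addr0.
Qed.
End Restriction.

(** * Lexicographic order and horizontal strips *)

Section Lex.
Local Open Scope nat_scope.

Fixpoint lexb (s t : seq nat) : bool :=
  match s, t with
  | [::], _ => true
  | _ :: _, [::] => false
  | x :: s', y :: t' => (x < y) || ((x == y) && lexb s' t')
  end.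

Lemma lexb_total : total lexb.
Proof.
elim=> [|x s IHs] [|y t] //=; rewrite [y == x]eq_sym.
by case: (ltngtP x y) => //= _; apply: IHs.
Qed.

Lemma lexb_trans : transitive lexb.
Proof.
elim=> [|y t IHt] [|x s] [|z r] //= /orP[xy|/andP[/eqP-> st]] /orP[yz|/andP[/eqP<- tr]].
- by rewrite (ltn_trans xy).
- by rewrite xy.
- by rewrite yz.
by rewrite eqxx (IHt _ _ st tr) orbT.
Qed.

Lemma lexb_anti : antisymmetric lexb.
Proof.
elim=> [|x s IHs] [|y t] //= /andP[/orP[xy|/andP[/eqP-> st]] /orP[yx|/andP[/eqP E ts]]].
- by have := ltn_trans xy yx; rewrite ltnn.
- by move: xy; rewrite E ltnn.
- by move: yx; rewrite ltnn.
by rewrite (IHs t) // st ts.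
Qed.

Lemma lexb_refl s : lexb s s.
Proof. by have := lexb_total s s; rewrite orbb. Qed.

Lemma exists_max (T : eqType) (r : rel T) (s : seq T) : total r -> transitive r -> s != [::] ->
  exists2 x, x \in s & forall y, y \in s -> r y x.
Proof.
move=> rt rtr; elim: s => // x [|x' s] IHs _.
  exists x; first exact: mem_head.
  by move=> y; rewrite inE => /eqP ->; have := rt x x; rewrite orbb.
have [//|m ms mmax] := IHs _.
have [rxm|rmx] := orP (rt x m).
  exists m; first by rewrite inE ms orbT.
  by move=> y; rewrite inE => /predU1P[->//|/mmax].
exists x; first exact: mem_head.
move=> y; rewrite inE => /predU1P[->|/mmax rym]; last exact: rtr rmx.
by have := rt x x; rewrite orbb.
Qed.

(** The interlacing form of the condition that la / mu is a horizontal strip of size [k]. *)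
Definition hstrip (la mu : intpart) k :=
  sumn la = sumn mu + k /\ forall i, row la i.+1 <= row mu i <= row la i.

Fact behead_intpart (la : intpart) : is_intpart (behead la).
Proof.
have := valP la; rewrite /is_intpart /=; case: (parts la) => //= x s /andP[p0].
by rewrite inE negb_or => /andP[_ ->]; rewrite (path_sorted p0).
Qed.
Definition ptail la : intpart := IntPart (behead_intpart la).

Lemma row_ptail la i : row (ptail la) i = row la i.+1.
Proof. by rewrite /row /= nth_behead. Qed.

(** The size of the strip is the first row of [la] minus the total excess of the rows [row mu i]
    over [row la i.+1]; maximal size means no excess. *)
Lemma hstrip_le la mu k : hstrip la mu k ->
  k <= row la 0 /\ (k = row la 0 -> mu = ptail la).
Proof.
move=> [sz H]; pose N := (maxn (size la) (size mu)).
have Ela : sumn la = row la 0 + \sum_(i <- iota 0 N) row la i.+1.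
  rewrite (@sumn_row la N.+1); last by rewrite leqW ?leq_maxl.
  rewrite /= big_cons; congr (_ + _).
  by rewrite (iotaDl 1 0) big_map; apply: eq_bigr.
have Emu : sumn mu = \sum_(i <- iota 0 N) row mu i by rewrite (@sumn_row mu N) ?leq_maxr.
have D : sumn mu = \sum_(i <- iota 0 N) row la i.+1 + \sum_(i <- iota 0 N) (row mu i - row la i.+1).
  by rewrite Emu -big_split /=; apply: eq_bigr => i _; rewrite subnKC //; case/andP: (H i).
split=> [|Ek]; first by lia.
have Z : \sum_(i <- iota 0 N) (row mu i - row la i.+1) = 0 by lia.
apply: row_inj => i; rewrite row_ptail.
have [iN|Ni] := ltnP i N; last first.
  rewrite !row_default //; first by rewrite leqW // (leq_trans _ Ni) ?leq_maxl.
  by rewrite (leq_trans _ Ni) ?leq_maxr.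
move: Z; rewrite (sum_iotaD1 _ iN) => /eqP; rewrite addn_eq0 subn_eq0 => /andP[le _].
by apply/eqP; rewrite eqn_leq le; case/andP: (H i).
Qed.
End Lex.

Section Strips.
Variables (K : fieldType) (F : comAlgType K) (p : nat -> F).
Variables (pd : nat -> F -> F) (rs lw dg : F -> F) (al : K) (jf : F -> F -> K).
Hypothesis so : symops p pd rs lw dg.
Hypothesis sf : symform p pd al jf.
Hypothesis char0 : forall n, (n.+1%:R : K) != 0.
Hypothesis al0 : al != 0.
Hypothesis nondeg : forall f, (forall g, jf f g = 0) -> f = 0.
Variable tau : {rmorphism F -> {poly F}}.
Hypothesis tauZ : forall c f, tau (c *: f) = (c%:A)%:P * tau f.
Hypothesis taup : forall k, tau (p k) = (p k)%:P + 'X^(k.+1).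
Variables (u v : nat -> nat -> K).
Hypothesis vu : forall i j, v i j = al * u i j.
Hypothesis vS : forall i j, v i.+1 j = v i j - 1.

Local Notation R := (var_coef tau).
Local Notation ev := (xcoef jf tau).

Section OneBasis.
Variables (up dn up' dn' : intpart -> nat -> K) (j js : intpart -> F).
Hypothesis jb : jackbasis p pd rs lw dg up dn u v j.
Hypothesis jbs : jackbasis p pd rs lw dg up' dn' u v js.
Hypothesis dual : forall la mu, jf (j la) (js mu) = (la == mu)%:R.

(** The coefficient of [j mu] in [R k (j la)], read off by the dual basis. *)
Let rho k la mu := jf (R k (j la)) (js mu).

Lemma jf_sumr (I : Type) (r : seq I) (c : I -> K) (f : I -> F) g :
  jf g (\sum_(i <- r) c i *: f i) = \sum_(i <- r) c i * jf g (f i).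
Proof.
elim: r => [|i r IHr]; first by rewrite !big_nil (jf_sym sf) (jf0 sf).
by rewrite !big_cons (jf_linr sf) IHr.
Qed.

Lemma jf_suml (I : Type) (r : seq I) (c : I -> K) (f : I -> F) g :
  jf (\sum_(i <- r) c i *: f i) g = \sum_(i <- r) c i * jf (f i) g.
Proof.
rewrite (jf_sym sf) jf_sumr; apply: eq_bigr => i _; by rewrite (jf_sym sf).
Qed.

Lemma var_coef_sum k (r : seq nat) (c : nat -> K) (f : nat -> F) :
  R k (\sum_(i <- r) c i *: f i) = \sum_(i <- r) c i *: R k (f i).
Proof.
elim: r => [|i r IHr]; first by rewrite !big_nil var_coef0.
by rewrite !big_cons (var_coef_lin tauZ) IHr.
Qed.

Lemma pd_adj f mu : jf (pd 0 f) (js mu) = \sum_(t <- addrows mu) up' mu t / al * jf f (js (padd mu t)).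
Proof.
apply: (mulfI al0); rewrite (jf_sym sf) -[al]mul1r -[X in X * al]/(1%:R) -(jf_p sf).
rewrite (jb_p0 jbs) (jf_sym sf) jf_sumr mulr_sumr; apply: eq_bigr => t _.
by rewrite mul1r mulrA mulrCA divff // mulr1.
Qed.

Lemma lw_adj f mu : jf (lw f) (js mu) =
  \sum_(t <- addrows mu) up' mu t / al * v t (row mu t) * jf f (js (padd mu t)).
Proof.
rewrite (jf_sym sf) -(jf_rs so sf) (jf_sym sf) (jb_rs jbs) jf_sumr.
apply: eq_bigr => t _; rewrite vu; congr (_ * _).
by rewrite mulrA divfK.
Qed.

Lemma rho_comm k la mu :
  \sum_(s <- remrows la) dn la s * rho k (prem la s) mu =
  \sum_(t <- addrows mu) up' mu t / al * rho k la (padd mu t).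
Proof. by rewrite -pd_adj -(var_coef_pd0 so tauZ taup) (jb_pd jb) var_coef_sum jf_suml. Qed.

(** [var_coef_rec] in coordinates: a box removed from [la] is weighted by its [v], a box added to
    [mu] by one minus its [v]. *)
Lemma rho_rec k la mu : k.+1%:R * rho k.+1 la mu =
  \sum_(s <- remrows la) dn la s * v s (row la s).-1 * rho k (prem la s) mu +
  \sum_(t <- addrows mu) up' mu t / al * (1 - v t (row mu t)) * rho k la (padd mu t).
Proof.
rewrite /rho -(jfZ sf) (var_coef_rec so tauZ taup) (jb_lw jb) var_coef_sum -addrA (jfD sf) jf_suml.
congr (_ + _); rewrite (jfD sf) -scaleN1r (jfZ sf) pd_adj lw_adj mulN1r -sumrN -big_split.
apply: eq_bigr => t _ /=; ring.
Qed.

Lemma rho_hstrip k la mu : rho k la mu != 0 -> hstrip la mu k.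
Proof.
elim: k la mu => [|k IHk] la mu.
  rewrite /rho (var_coef_id so tauZ taup) dual; case: (la =P mu) => [-> _|_]; last by rewrite eqxx.
  by split=> [|i]; rewrite ?addn0 // leqnn row_noninc.
move=> nz; have nz' : k.+1%:R * rho k.+1 la mu != 0 by rewrite mulf_neq0.
have Hs s : s \in remrows la -> rho k (prem la s) mu != 0 ->
    (sumn la = sumn mu + k.+1)%N /\ forall i, (decr (row la) s i.+1 <= row mu i <= row la i)%N.
  rewrite mem_remrows => rs' /IHk[sz H]; split=> [|i].
    by rewrite (sumn_prem rs') sz addnS.
  have := H i; rewrite !row_prem // => /andP[-> /= le].
  by rewrite (leq_trans le) // /decr leq_subr.
have Ht t : t \in addrows mu -> rho k la (padd mu t) != 0 ->
    (sumn la = sumn mu + k.+1)%N /\ forall i, (row la i.+1 <= incr (row mu) t i)%N /\ (row mu i <= row la i)%N.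
  rewrite mem_addrows => at' /IHk[sz H]; split=> [|i].
    by rewrite sz sumn_padd // addSnnS.
  have := H i; rewrite !row_padd // => /andP[-> /= le]; split=> //.
  by rewrite (leq_trans _ le) // /incr leq_addr.
have Hnz : (sumn la = sumn mu + k.+1)%N /\ (forall i, row mu i <= row la i)%N.
  have [/hasP[s ss ns]|/hasPn Ns] := boolP (has (fun s => rho k (prem la s) mu != 0) (remrows la)).
    by have [E H] := Hs s ss ns; split=> // i; case/andP: (H i).
  have [/hasP[t tt nt]|/hasPn Nt] := boolP (has (fun t => rho k la (padd mu t) != 0) (addrows mu)).
    by have [E H] := Ht t tt nt; split=> // i; case: (H i).
  move: nz'; rewrite rho_rec !big_seq !big1 ?addr0 ?eqxx // => i ii.
    by move: (Nt i ii); rewrite negbK => /eqP ->; rewrite mulr0.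
  by move: (Ns i ii); rewrite negbK => /eqP ->; rewrite mulr0.
case: Hnz => sz cont; split=> // i; rewrite cont andbT leqNgt; apply/negP => lt.
(* A vertical domino in rows [i], [i.+1]: only its lower box can be removed
   first, only its upper box last, and their contents differ by one. *)
pose c := v i.+1 (row mu i).
have Es s : s \in remrows la ->
    v s (row la s).-1 * rho k (prem la s) mu = c * rho k (prem la s) mu.
  move=> ss; have [->|ns] := eqVneq (rho k (prem la s) mu) 0; first by rewrite !mulr0.
  have [_ /(_ i) /andP[+ _]] := Hs s ss ns; rewrite /decr.
  case: eqP => [<-|_]; last by rewrite subn0 leqNgt lt.
  rewrite subn1 => le; congr (v _ _ * _); apply/eqP; rewrite eqn_leq le /=.
  by rewrite -ltnS (leq_trans lt) // leqSpred.
have Et t : t \in addrows mu ->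
    (1 - v t (row mu t)) * rho k la (padd mu t) = - c * rho k la (padd mu t).
  move=> tt; have [->|nt] := eqVneq (rho k la (padd mu t)) 0; first by rewrite !mulr0.
  have [_ /(_ i) [+ _]] := Ht t tt nt; rewrite /incr.
  case: eqP => [<- _|_]; last by rewrite addn0 leqNgt lt.
  by rewrite /c vS; congr (_ * _); ring.
(* All nonzero terms now carry the weight [c] or [- c], so the recursion is [c] times the difference
   of the two sides of [rho_comm]. *)
move: nz'; rewrite rho_rec.
rewrite (eq_big_seq (fun s => c * (dn la s * rho k (prem la s) mu))) => [|s ss]; last first.
  by rewrite -mulrA Es //; ring.
rewrite -mulr_sumr.
rewrite [X in _ + X](eq_big_seq (fun t => - c * (up' mu t / al * rho k la (padd mu t)))) => [|t tt]; last first.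
  by rewrite -mulrA Et //; ring.
by rewrite -mulr_sumr rho_comm mulNr addrN eqxx.
Qed.

(** The span of the [j la], encoded as the intersection [sp] of all linear predicates containing
    them, is stable under [p 0] and [rs] by the Pieri rules, hence under every [p k] by commutators;
    it contains 1. *)
Lemma jb_ind (P : F -> Prop) : P 0 -> (forall c f g, P f -> P g -> P (c *: f + g)) ->
  (forall la, P (j la)) -> forall f, P f.
Proof.
pose sp f := forall P : F -> Prop, P 0 -> (forall c f g, P f -> P g -> P (c *: f + g)) ->
  (forall la, P (j la)) -> P f.
suff H : forall f, sp f by move=> P0 PD Pj f; exact: H.
have sp0 : sp 0 by move=> Q Q0 QD Qj.
have spD c f g : sp f -> sp g -> sp (c *: f + g).
  by move=> sf' sg Q Q0 QD Qj; exact: (QD _ _ _ (sf' Q Q0 QD Qj) (sg Q Q0 QD Qj)).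
have spj la : sp (j la) by move=> Q Q0 QD Qj.
have spsum (r : seq nat) (c : nat -> K) (f : nat -> intpart) : sp (\sum_(i <- r) c i *: j (f i)).
  by elim: r => [|i r IHr]; rewrite ?big_nil // big_cons; apply: spD.
have spp0 f : sp f -> sp (p 0 * f).
  move=> Hf; apply: (Hf (fun g => sp (p 0 * g))) => [|c g h Hg Hh|la]; first by rewrite mulr0.
    by rewrite mulrDr -scalerAr; apply: spD.
  by rewrite (jb_p0 jb); exact: spsum.
have sprs f : sp f -> sp (rs f).
  move=> Hf; apply: (Hf (fun g => sp (rs g))) => [|c g h Hg Hh|la].
    by rewrite (linear_at0 (so_rs so).1).
    by rewrite (so_rs so).1; apply: spD.
  by rewrite (jb_rs jb); exact: spsum.
have sppk k f : sp f -> sp (p k * f).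
  elim: k f => [|k IHk] f Hf; first exact: spp0.
  have -> : p k.+1 * f = k.+1%:R^-1 *: (rs (p k * f)) + (- k.+1%:R^-1 *: (p k * rs f) + 0).
    by rewrite (rs_pM so) addr0 scaleNr -scalerBr addrK scalerA mulVf ?scale1r.
  exact: (spD _ _ _ (sprs _ (IHk _ Hf)) (spD _ _ _ (IHk _ (sprs _ Hf)) sp0)).
have sp1 : sp 1 by rewrite -(jb_vac jb); exact: spj.
exact: (so_gen so (P := sp) sp1 sppk sp0 spD).
Qed.

Lemma jb_expand f : exists S : seq intpart, forall S', uniq S' -> {subset S <= S'} ->
  f = \sum_(la <- S') jf f (js la) *: j la.
Proof.
move: f; apply: jb_ind => [|c f g [S HS] [S0 HS0]|la].
- by exists [::] => S' _ _; rewrite big1 // => la _; rewrite (jf0 sf) scale0r.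
- exists (S ++ S0) => S' uS' sub.
  rewrite {1}(HS S') // => [|k kS]; last by apply: sub; rewrite mem_cat kS.
  rewrite {1}(HS0 S') // => [|k kS]; last by apply: sub; rewrite mem_cat kS orbT.
  rewrite scaler_sumr -big_split; apply: eq_bigr => k _ /=.
  by rewrite (jf_lin sf) scalerA scalerDl.
exists [:: la] => S' uS' /(_ la (mem_head _ _)) laS'.
rewrite (bigD1_seq la) //= dual eqxx scale1r big1 ?addr0 // => mu.
by rewrite dual eq_sym => /negPf ->; rewrite scale0r.
Qed.

Lemma xcoef_cons_hstrip k s la : ev (k :: s) (j la) != 0 ->
  exists2 mu, hstrip la mu k & ev s (j mu) != 0.
Proof.
move=> /= nz; have [S HS] := jb_expand (R k (j la)).
move: nz; rewrite (HS (undup S)) ?undup_uniq //; last by move=> mu; rewrite mem_undup.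
rewrite (xcoef_sum sf tauZ); case: (boolP (has (fun mu => (rho k la mu != 0) && (ev s (j mu) != 0)) (undup S))).
  by move=> /hasP[mu _ /andP[/rho_hstrip H nz]] _; exists mu.
move=> /hasPn H; rewrite big_seq big1 ?eqxx // => mu /H.
rewrite negb_and !negbK (xcoefZ sf tauZ) => /orP[] /eqP E; last by rewrite E mulr0.
by rewrite -[jf _ _]/(rho k la mu) E mul0r.
Qed.

Lemma xcoef_sumn s la : ev s (j la) != 0 -> sumn s = sumn la.
Proof.
elim: s la => [|k s IHs] la; last first.
  by move=> /xcoef_cons_hstrip[mu [-> _] /IHs <-] /=; rewrite addnC.
by rewrite /= -(jb_vac jbs) dual; case: (la =P ones 0) => [-> //|_]; rewrite eqxx.
Qed.

(** The first exponent is at most the first row by [hstrip_le]. If they are equal, the strip leaves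
    exactly the tail of [la], and induction compares the rest. *)
Lemma xcoef_lexb s la : 0%N \notin s -> ev s (j la) != 0 -> lexb s la.
Proof.
elim: s la => [|k s IHs] la //; rewrite inE negb_or => /andP[k0 s0].
move=> /xcoef_cons_hstrip[mu /hstrip_le[kla E] /(IHs _ s0)]; move: kla E; rewrite /row.
have : parts (ptail la) = behead la by [].
move: (ptail la) => nu; case: (parts la) => [|x t] /= Et; first by rewrite leqn0 eq_sym (negPf k0).
rewrite leq_eqVlt => /predU1P[->|-> //] /(_ erefl) ->.
by rewrite -Et eqxx => ->; rewrite orbT.
Qed.
End OneBasis.
End Strips.

Lemma sorted_parts n : exists L : seq intpart,
  [/\ uniq L, forall la, (la \in L) = (sumn la == n)
    & sorted (fun la mu : intpart => lexb la mu) L].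
Proof.
have [L uL mL] := finitely_many_parts n.
pose le := fun la mu : intpart => lexb la mu.
exists (sort le L); split; first by rewrite sort_uniq.
  by move=> la; rewrite mem_sort.
by apply: sort_sorted => la mu; apply: lexb_total.
Qed.

Fact sort_nz_intpart (s : seq nat) : is_intpart (sort geq [seq k <- s | k != 0%N]).
Proof.
rewrite /is_intpart sort_sorted; last by move=> x y; apply: leq_total.
by rewrite mem_sort mem_filter eqxx.
Qed.
Definition spart (s : seq nat) : intpart := IntPart (sort_nz_intpart s).

Lemma intpart_lexb_anti (la mu : intpart) : lexb la mu -> lexb mu la -> la = mu.
Proof. by move=> h1 h2; apply: val_inj; apply: lexb_anti; rewrite h1. Qed.

(** * Identification of the Jack family *)

Section Identification.
Variables (K : fieldType) (F : comAlgType K) (p : nat -> F).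
Variables (pd : nat -> F -> F) (rs lw dg : F -> F) (al : K) (jf : F -> F -> K).
Hypothesis so : symops p pd rs lw dg.
Hypothesis sf : symform p pd al jf.
Hypothesis char0 : forall n, (n.+1%:R : K) != 0.
Hypothesis al0 : al != 0.
Hypothesis nondeg : forall f, (forall g, jf f g = 0) -> f = 0.
Variable tau : {rmorphism F -> {poly F}}.
Hypothesis tauZ : forall c f, tau (c *: f) = (c%:A)%:P * tau f.
Hypothesis taup : forall k, tau (p k) = (p k)%:P + 'X^(k.+1).
Variables (u v : nat -> nat -> K).
Hypothesis vu : forall i j, v i j = al * u i j.
Hypothesis vS : forall i j, v i.+1 j = v i j - 1.
Variables (up dn up' dn' : intpart -> nat -> K) (j js : intpart -> F).
Hypothesis jb : jackbasis p pd rs lw dg up dn u v j.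
Hypothesis jbs : jackbasis p pd rs lw dg up' dn' u v js.
Hypothesis dual : forall la mu, jf (j la) (js mu) = (la == mu)%:R.

Local Notation R := (var_coef tau).
Local Notation ev := (xcoef jf tau).

Let j_sumn s la := @xcoef_sumn _ _ _ _ _ _ _ _ _ so sf char0 al0 _ tauZ taup _ _ vu vS _ _ _ _ _ _ jb jbs dual s la.
Let j_lexb s la := @xcoef_lexb _ _ _ _ _ _ _ _ _ so sf char0 al0 _ tauZ taup _ _ vu vS _ _ _ _ _ _ jb jbs dual s la.
Let expand := jb_expand so sf char0 jb dual.

Lemma xcoef_spart s f : ev s f = ev (spart s) f.
Proof.
rewrite -(xcoef_filter jf so tauZ taup); apply: (xcoef_perm jf so tauZ taup).
by rewrite perm_sym; apply/permPl; apply: perm_sort.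
Qed.

Lemma jf_comb (I : eqType) (r : seq I) (c : I -> K) (f : I -> intpart) i :
  uniq r -> i \in r -> injective f ->
  jf (\sum_(k <- r) c k *: j (f k)) (js (f i)) = c i.
Proof.
move=> ur ir fi; rewrite (jf_suml sf) (bigD1_seq i) //= dual eqxx mulr1 big1 ?addr0 // => k.
by rewrite dual (inj_eq fi) => /negPf ->; rewrite mulr0.
Qed.

(** Over a sorted list of partitions the coefficient matrix of the [j] is triangular, and its rows
    are independent because coefficients separate functions. An invertible triangular matrix has no
    zero on its diagonal. *)
Lemma xcoef_diag_neq0 (la : intpart) : ev la (j la) != 0.
Proof.
pose n := sumn la; have [L [uL mL sL]] := sorted_parts n.
pose N := size L; pose lam (i : 'I_N) : intpart := nth (ones 0) L i.
have lamL i : sumn (lam i) = n by apply/eqP; rewrite -mL mem_nth.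
have lam_inj : injective lam by move=> i k /eqP; rewrite nth_uniq // => /eqP/val_inj.
pose A : 'M[K]_N := \matrix_(i, k) ev (lam k) (j (lam i)).
have trig : is_trig_mx A.
  apply/is_trig_mxP => i k ik; rewrite mxE; apply/eqP; apply/negPn/negP => nz.
  have le1 := j_lexb (intpart_no0 (lam k)) nz.
  have le2 : lexb (lam i) (lam k).
    have tr : transitive (fun la mu : intpart => lexb la mu) by move=> x y z; apply: lexb_trans.
    by have := sorted_ltn_nth tr (ones 0) sL; apply=> //; rewrite inE.
  by have /lam_inj E := intpart_lexb_anti le1 le2; rewrite E ltnn in ik.
have free : row_free A.
  apply: inj_row_free => w w0; apply/rowP => i; rewrite [RHS]mxE.
  pose f := \sum_(k <- enum 'I_N) w 0 k *: j (lam k).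
  have jfi : jf f (js (lam i)) = w 0 i by rewrite jf_comb ?enum_uniq ?mem_enum.
  rewrite -jfi; suff -> : f = 0 by rewrite (jf0 sf).
  apply: (xcoef_separates so sf char0 nondeg tauZ taup) => s.
  have evf t : ev t f = \sum_k w 0 k * ev t (j (lam k)).
    rewrite /f (xcoef_sum sf tauZ) big_enum /=; apply: eq_bigr => k _.
    by rewrite (xcoefZ sf tauZ).
  have [sn|sn] := eqVneq (sumn s) n; last first.
    rewrite evf big1 // => k _; have [->|/j_sumn] := eqVneq (ev s (j (lam k))) 0; first by rewrite mulr0.
    by rewrite lamL => E; rewrite E eqxx in sn.
  rewrite xcoef_spart; have rL : spart s \in L.
    rewrite mL -sn /spart /= !sumnE (perm_big _ (permEl (perm_sort _ _))) big_filter.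
    by rewrite [X in _ == X](bigID (fun k => k != 0%N)) /= [X in (_ == _ + X)%N]big1 ?addn0 // => k; rewrite negbK => /eqP.
  have [k Ek] : exists k, lam k = spart s.
    by exists (Ordinal (etrans (index_mem (spart s) L) rL)); rewrite /lam /= nth_index.
  rewrite -Ek evf; have /rowP/(_ k) := w0; rewrite !mxE => Ew; rewrite -[RHS]Ew.
  by apply: eq_bigr => l _; rewrite mxE.
move: free; rewrite row_free_unit unitmxE det_trig // unitfE => /prodf_neq0 nz.
have laL : la \in L by rewrite mL.
have := nz (Ordinal (etrans (index_mem la L) laL)) isT.
by rewrite mxE /lam /= nth_index.
Qed.

(** A lexicographically largest [m] in the expansion of [f] is a genuine exponent of [f]: no other
    term reaches it, and its own coefficient is nonzero by [xcoef_diag_neq0]. *)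
Lemma xcoef_triangular n (la : intpart) f :
  (forall s, ev s f != 0 -> sumn s = n) ->
  (forall rho : intpart, ev rho f != 0 -> lexb rho la) ->
  forall mu, jf f (js mu) != 0 -> sumn mu = n /\ lexb mu la.
Proof.
move=> Hn Hl; have [S HS] := expand f.
have E := HS (undup S) (undup_uniq S) (fun x => (etrans (mem_undup S x))).
have {E} [S' [uS' sub E]] : exists S', [/\ uniq S', {subset S <= S'} & f = \sum_(la <- S') jf f (js la) *: j la].
  by exists (undup S); split; rewrite ?undup_uniq // => x; rewrite mem_undup.
have Hd mu : jf f (js mu) != 0 -> sumn mu = n.
  move=> nz; apply/eqP; apply/negPn/negP => ne.
  pose T := undup (mu :: S).
  have uT : uniq T by apply: undup_uniq.
  have ET : f = \sum_(la <- T) jf f (js la) *: j la.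
    by apply: HS => // x xS; rewrite mem_undup inE xS orbT.
  (* The component of [f] in the degree of [mu]. Its coefficients are those of [f] in that degree,
     all zero as the degree differs from [n]. *)
  pose g := \sum_(la <- T) (if sumn la == sumn mu then jf f (js la) else 0) *: j la.
  have muT : mu \in T by rewrite mem_undup mem_head.
  have gm : jf g (js mu) = jf f (js mu).
    by rewrite /g (@jf_comb _ T _ id mu) // ?eqxx //; move=> ? ?.
  suff g0 : g = 0 by rewrite -gm g0 (jf0 sf) eqxx in nz.
  apply: (xcoef_separates so sf char0 nondeg tauZ taup) => s.
  have evg : ev s g = \sum_(la <- T) (if sumn la == sumn mu then jf f (js la) else 0) * ev s (j la).
    by rewrite /g (xcoef_sum sf tauZ); apply: eq_bigr => k _; rewrite (xcoefZ sf tauZ).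
  rewrite evg; have [sm|sm] := eqVneq (sumn s) (sumn mu); last first.
    apply: big1 => la' _; case: eqP => [Em|_]; last by rewrite mul0r.
    have [->|/j_sumn Es] := eqVneq (ev s (j la')) 0; first by rewrite mulr0.
    by rewrite Es Em eqxx in sm.
  transitivity (ev s f).
    rewrite {2}ET (xcoef_sum sf tauZ); apply: eq_bigr => la' _; rewrite (xcoefZ sf tauZ).
    case: eqP => [//|ne']; rewrite mul0r.
    have [->|/j_sumn Es] := eqVneq (ev s (j la')) 0; first by rewrite mulr0.
    by case: ne'; rewrite -Es sm.
  by apply/eqP; apply/negPn/negP => /Hn Es; rewrite -sm Es eqxx in ne.
move=> mu nz; split; first exact: Hd.
apply/negPn/negP => nle.
pose B := [seq x <- undup (mu :: S) | (jf f (js x) != 0)].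
have muB : mu \in B by rewrite mem_filter nz mem_undup mem_head.
have B0 : B != [::] by apply: contraTneq muB => ->.
have [m mB mmax] := @exists_max _ (fun la mu : intpart => lexb la mu) B
  (fun x y => lexb_total x y) (fun x y z => @lexb_trans x y z) B0.
have nm : ~~ lexb m la.
  by apply: contra nle => h; apply: (lexb_trans _ h); apply: mmax.
have uB : uniq B by rewrite filter_uniq ?undup_uniq.
have EB : f = \sum_(x <- B) jf f (js x) *: j x.
  rewrite {1}(HS (undup (mu :: S))) ?undup_uniq //; last by move=> x xS; rewrite mem_undup inE xS orbT.
  rewrite big_filter [RHS]big_mkcond; apply: eq_bigr => x _.
  by case: eqP => [->|//]; rewrite scale0r.
have : ev m f != 0.
  rewrite EB (xcoef_sum sf tauZ) (bigD1_seq m) //= big_seq_cond big1 ?addr0 => [|x /andP[xB xm]]; last first.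
    rewrite (xcoefZ sf tauZ); have [->|/j_lexb] := eqVneq (ev m (j x)) 0; first by rewrite mulr0.
    move=> /(_ (intpart_no0 m)) mx; have := mmax x xB => xm'.
    by rewrite (intpart_lexb_anti mx xm') eqxx in xm.
  rewrite (xcoefZ sf tauZ) mulf_neq0 ?xcoef_diag_neq0 //.
  by move: mB; rewrite mem_filter => /andP[].
by move=> /Hl; rewrite (negPf nm).
Qed.
(** Since [var_coef] at 1 is [pd 0], each variable with exponent 1 multiplies by the sum of the down
    coefficients, the current size. *)
Lemma xcoef_ones m (la : intpart) : (forall la : intpart, \sum_(i <- remrows la) dn la i = (sumn la)%:R) ->
  sumn la = m -> ev (nseq m 1%N) (j la) = (m`!)%:R.
Proof.
move=> sdn; elim: m la => [|m IHm] la sla.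
  move/eqP: sla; rewrite sumn_eq0 => /eqP ->.
  by rewrite /= -(jb_vac jbs) dual eqxx.
rewrite /= (var_coef1 so tauZ taup) (jb_pd jb) (xcoef_sum sf tauZ) factS natrM -sla -(sdn la) mulr_suml.
apply: eq_big_seq => i; rewrite mem_remrows => ri.
by rewrite (xcoefZ sf tauZ) IHm //; move: sla; rewrite (sumn_prem ri) => -[].
Qed.

Let dual' la mu : jf (js la) (j mu) = (la == mu)%:R.
Proof. by rewrite (jf_sym sf) dual eq_sym. Qed.

Let js_sumn s la := @xcoef_sumn _ _ _ _ _ _ _ _ _ so sf char0 al0 _ tauZ taup _ _ vu vS _ _ _ _ _ _ jbs jb dual' s la.
Let js_lexb s la := @xcoef_lexb _ _ _ _ _ _ _ _ _ so sf char0 al0 _ tauZ taup _ _ vu vS _ _ _ _ _ _ jbs jb dual' s la.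

(** Gram-Schmidt along the sorted list. For [rho] below [la], the dual [js rho] is triangular too,
    hence a combination of [j sig] with [sig] below [la]; these equal [J sig] by induction and are
    orthogonal to [J la]. So [J la] is a multiple of [j la], and the normalisation fixes the
    factor. *)
Theorem jack_unique (J : intpart -> F) :
  (forall la : intpart, \sum_(i <- remrows la) dn la i = (sumn la)%:R) ->
  (forall la mu, la <> mu -> jf (J la) (J mu) = 0) ->
  (forall (la : intpart) s, ev s (J la) != 0 -> sumn s = sumn la) ->
  (forall la rho : intpart, ev rho (J la) != 0 -> lexb rho la) ->
  (forall la : intpart, ev (nseq (sumn la) 1%N) (J la) = ((sumn la)`!)%:R) ->
  forall la, J la = j la.
Proof.
move=> sdn JO Jn Jl JN la; have [L [uL mL sL]] := sorted_parts (sumn la).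
have [m] := ubnP (index la L); move: mL; move Elan: (sumn la) => n mL.
elim: m la Elan => // m IHm la lan; rewrite ltnS => ilm.
have IH (rho : intpart) : sumn rho = n -> lexb rho la -> rho != la -> J rho = j rho.
  move=> rn rla ne; apply: IHm => //; apply: leq_trans ilm.
  rewrite ltnNge; apply: contra ne => le; apply/eqP.
  apply: (intpart_lexb_anti rla).
  have tr : transitive (fun la mu : intpart => lexb la mu) by move=> x y z; apply: lexb_trans.
  have rf : reflexive (fun la mu : intpart => lexb la mu) by move=> x; apply: lexb_refl.
  have := sorted_leq_nth tr rf (ones 0) sL (index la L) (index rho L).
  rewrite !inE !index_mem !mL rn lan eqxx => /(_ isT isT le).
  by rewrite !nth_index ?mL ?rn ?lan.
have T := xcoef_triangular (Jn la) (Jl la).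
have [S HS] := expand (J la).
have EJ : J la = jf (J la) (js la) *: j la.
  rewrite {1}(HS (undup (la :: S))) ?undup_uniq //; last by move=> x xS; rewrite mem_undup inE xS orbT.
  rewrite (bigD1_seq la) ?undup_uniq ?mem_undup ?mem_head //= big1 ?addr0 // => rho ne.
  have [->|nz] := eqVneq (jf (J la) (js rho)) 0; first by rewrite scale0r.
  have [rn rl] := T _ nz; rewrite lan in rn.
  have T' := xcoef_triangular (js_sumn^~ rho) (fun s => js_lexb (intpart_no0 s)).
  have [S' HS'] := expand (js rho).
  suff E0 : jf (J la) (js rho) = 0 by rewrite E0 eqxx in nz.
  rewrite (HS' (undup S')) ?undup_uniq //; last by move=> x; rewrite mem_undup.
  rewrite (jf_sumr sf) big1 // => sig _.
  have [->|nzs] := eqVneq (jf (js rho) (js sig)) 0; first by rewrite mul0r.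
  have [sn sl] := T' _ nzs.
  have sla : sig != la.
    apply: contra ne => /eqP E; apply/eqP; apply: (intpart_lexb_anti rl).
    by rewrite -E; exact: sl.
  rewrite -(IH _ (etrans sn rn) (lexb_trans sl rl) sla).
  by rewrite JO ?mulr0 // => E; rewrite E eqxx in sla.
rewrite EJ; have := JN la; rewrite EJ (xcoefZ sf tauZ) (xcoef_ones sdn erefl) => /eqP.
rewrite -subr_eq0 -{2}[_%:R]mul1r -mulrBl mulf_eq0 orbC.
have -> : (((sumn la)`!)%:R == 0 :> K) = false.
  by apply/negbTE; rewrite -(prednK (fact_gt0 _)) char0.
by rewrite subr_eq0 => /eqP E; rewrite (jfZ sf) dual eqxx mulr1 in E *; rewrite E scale1r.
Qed.
End Identification.

(** * The functional on products *)

Section Functional.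
Variables (K : fieldType) (F : comAlgType K) (p : nat -> F).
Variables (pd : nat -> F -> F) (rs lw dg : F -> F) (al : K) (jf : F -> F -> K).
Hypothesis so : symops p pd rs lw dg.
Hypothesis sf : symform p pd al jf.
Hypothesis char0 : forall n, (n.+1%:R : K) != 0.
Variables (u v : nat -> nat -> K).
Variables (up dn up' dn' : intpart -> nat -> K) (j js : intpart -> F).
Hypothesis jb : jackbasis p pd rs lw dg up dn u v j.
Hypothesis jbs : jackbasis p pd rs lw dg up' dn' u v js.
Hypothesis dual : forall la mu, jf (j la) (js mu) = (la == mu)%:R.

Variables (L : fieldType) (ka : {rmorphism K -> L}) (D : F -> L).
Hypothesis Dlin : forall c f g, D (c *: f + g) = ka c * D f + D g.

Let expand := jb_expand so sf char0 jb dual.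
Let jind := jb_ind so char0 jb.

Lemma semiext (phi : intpart -> L) : exists E : F -> L,
  (forall c f g, E (c *: f + g) = ka c * E f + E g) /\ forall la, E (j la) = phi la.
Proof.
have [S HS] := boolp.choice expand.
pose E f := \sum_(la <- undup (S f)) ka (jf f (js la)) * phi la.
have out f la : la \notin S f -> jf f (js la) = 0.
  move=> nla; rewrite {1}(HS f (undup (S f))) ?undup_uniq //; last by move=> x; rewrite mem_undup.
  rewrite (jf_suml sf) big_seq big1 // => mu; rewrite mem_undup => mS.
  by rewrite dual; case: eqP => [E1|_]; [rewrite -E1 mS in nla | rewrite mulr0].
have EE f T : uniq T -> {subset S f <= T} -> E f = \sum_(la <- T) ka (jf f (js la)) * phi la.
  move=> uT sub; rewrite [RHS](bigID (fun la => la \in S f)) /= [X in _ = _ + X]big1 ?addr0.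
    rewrite -big_filter; apply: perm_big; apply: uniq_perm; rewrite ?undup_uniq ?filter_uniq //.
    move=> x; rewrite mem_undup mem_filter; apply/idP/andP => [xS|[]//].
    by split=> //; apply: sub.
  by move=> x /out ->; rewrite rmorph0 mul0r.
exists E; split=> [c f g|la].
  pose T := undup (S f ++ S g ++ S (c *: f + g)).
  rewrite !(EE _ T) ?undup_uniq //.
  - rewrite mulr_sumr -big_split; apply: eq_bigr => x _ /=.
    by rewrite (jf_lin sf) rmorphD rmorphM /=; ring.
  - by move=> x xS; rewrite mem_undup !mem_cat xS !orbT.
  - by move=> x xS; rewrite mem_undup !mem_cat xS.
  by move=> x xS; rewrite mem_undup !mem_cat xS !orbT.
rewrite (EE _ (undup (la :: S (j la)))) ?undup_uniq //; last first.
  by move=> x xS; rewrite mem_undup inE xS orbT.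
rewrite (bigD1_seq la) ?undup_uniq ?mem_undup ?mem_head //= dual eqxx rmorph1 mul1r.
by rewrite big1 ?addr0 // => mu; rewrite dual eq_sym => /negPf ->; rewrite rmorph0 mul0r.
Qed.

Section Semilinear.
Variable E : F -> L.
Hypothesis Elin : forall c f g, E (c *: f + g) = ka c * E f + E g.
Lemma semi0 : E 0 = 0.
Proof. by have := Elin (-1) 0 0; rewrite scaler0 addr0 rmorphN1 mulN1r addNr. Qed.
Lemma semiZ c f : E (c *: f) = ka c * E f.
Proof. by rewrite -[c *: f]addr0 Elin semi0 addr0. Qed.
Lemma semiD f g : E (f + g) = E f + E g.
Proof. by rewrite -[f]scale1r Elin rmorph1 mul1r scale1r. Qed.
Lemma semi_sum (r : seq nat) (c : nat -> K) (f : nat -> F) :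
  E (\sum_(i <- r) c i *: f i) = \sum_(i <- r) ka (c i) * E (f i).
Proof. by elim: r => [|i r IHr]; rewrite ?big_nil ?semi0 // !big_cons Elin IHr. Qed.
End Semilinear.

(** The augmentation ideal, spanned by the [j la] with [la] nonempty, where the hypotheses on [D]
    and [b] hold. *)
Definition aug f := jf f 1 = 0.

Lemma jf_js f : jf f 1 = jf f (js (ones 0)).
Proof. by rewrite (jb_vac jbs). Qed.

Lemma aug_j la : la <> ones 0 -> aug (j la).
Proof. by rewrite /aug jf_js dual => /eqP/negPf ->. Qed.

Lemma aug_ind (P : F -> Prop) : P 0 ->
  (forall c f g, aug f -> aug g -> P f -> P g -> P (c *: f + g)) ->
  (forall la, la <> ones 0 -> P (j la)) -> forall f, aug f -> P f.
Proof.
move=> P0 PD Pj f af.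
pose au g := g + (- jf g 1) *: 1.
have aau g : aug (au g) by rewrite /aug /au (jfD sf) (jfZ sf) (jf_11 sf) mulr1 addrN.
suff : P (au f) by rewrite /au af oppr0 scale0r addr0.
move: f {af}; apply: jind => [|c f g Pf Pg|la].
- by rewrite /au (jf0 sf) oppr0 scale0r addr0.
- have -> : au (c *: f + g) = c *: au f + au g.
    by rewrite /au (jf_lin sf) scalerDr scalerA mulrN opprD scalerDl addrACA.
  exact: PD.
have [->|/eqP ne] := eqVneq la (ones 0).
  by rewrite /au (jb_vac jb) (jf_11 sf) scaleN1r addrN.
by rewrite /au (aug_j ne) oppr0 scale0r addr0; exact: Pj.
Qed.

Lemma aug_p k f : aug (p k * f).
Proof. by rewrite /aug (jf_p sf) (derivation1 (so_pd so k)) (jf_sym sf) (jf0 sf) mulr0. Qed.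

Lemma aug_lin c f g : aug f -> aug g -> aug (c *: f + g).
Proof. by rewrite /aug => af ag; rewrite (jf_lin sf) af ag mulr0 addr0. Qed.

Lemma aug0 : aug 0. Proof. exact: (jf0 sf). Qed.

Lemma augZ c f : aug f -> aug (c *: f).
Proof. by move=> af; rewrite -[c *: f]addr0; apply: aug_lin => //; exact: aug0. Qed.

Lemma aug_mul h f : aug f -> aug (h * f).
Proof.
move=> af; move: h; apply: (so_gen so) => [|k h IH||c h g IHh IHg].
- by rewrite mul1r.
- by rewrite -mulrA; exact: aug_p.
- by rewrite mul0r; exact: aug0.
by rewrite mulrDl -scalerAl; exact: aug_lin.
Qed.

Lemma aug_rs f : aug (rs f).
Proof. by rewrite /aug (jf_rs so sf) (derivation1 (so_lw so)) (jf_sym sf) (jf0 sf). Qed.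

Lemma aug_dg f : aug f -> aug (dg f).
Proof.
move: f; apply: aug_ind => [|c f g _ _ IHf IHg|la ne].
- by rewrite (linear_at0 (so_dg so).1); exact: aug0.
- by rewrite (so_dg so).1; exact: aug_lin.
by rewrite (jb_dg jb); apply/augZ/aug_j.
Qed.

Variables (uu : L) (e2 hb : K) (b : intpart -> intpart -> L).
Hypothesis e20 : e2 != 0.
Local Notation Eh f := (e2 *: rs f).
Local Notation onebox := (padd (ones 0) 0).
Hypothesis j_one : j onebox = p 0.
Hypothesis hD : forall la, la <> ones 0 ->
  D (Eh (j la)) = uu * D (p 0 * j la) + ka (hb * (sumn la)%:R) * D (j la).
Hypothesis hb1 : forall mu, mu <> ones 0 -> b mu onebox = D (p 0 * j mu).
Hypothesis hb2 : forall mu nu, mu <> ones 0 -> nu <> ones 0 ->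
  \sum_(i <- addrows mu) ka (up mu i) * b (padd mu i) nu =
  \sum_(t <- addrows nu) ka (up nu t) * b mu (padd nu t).
Hypothesis hb3 : forall mu nu, mu <> ones 0 -> nu <> ones 0 ->
  \sum_(i <- addrows mu) ka (e2 * (up mu i * u i (row mu i))) * b (padd mu i) nu +
  \sum_(t <- addrows nu) ka (e2 * (up nu t * u t (row nu t))) * b mu (padd nu t) =
  uu * (\sum_(i <- addrows mu) ka (up mu i) * b (padd mu i) nu) +
  ka (hb * (sumn mu + sumn nu)%:R) * b mu nu.

Theorem functional_product mu nu : mu <> ones 0 -> nu <> ones 0 -> D (j mu * j nu) = b mu nu.
Proof.
have [B1 HB1] := boolp.choice (fun mu => semiext (b mu)).
have [B HB] := boolp.choice (fun g => semiext (fun mu => B1 mu g)).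
have Bl c f f' g : B g (c *: f + f') = ka c * B g f + B g f' by case: (HB g).
have Bj g la : B g (j la) = B1 la g by case: (HB g).
have B0l g : B g 0 = 0 by apply: (semi0 (E := B g)) => *; apply: Bl.
have Br c g g' f : B (c *: g + g') f = ka c * B g f + B g' f.
  move: f; apply: jind => [|a f f' IHf IHf'|la]; first by rewrite !B0l mulr0 addr0.
    by rewrite !Bl IHf IHf'; ring.
  by rewrite !Bj (HB1 la).1.
have Bjj la la' : B (j la') (j la) = b la la' by rewrite Bj (HB1 la).2.
(* The defect to be shown zero on the augmentation ideal. *)
pose C f g := D (f * g) - B g f.
have Cl c f f' g : C (c *: f + f') g = ka c * C f g + C f' g.
  by rewrite /C mulrDl -scalerAl Dlin Bl; ring.
have Cr c f g g' : C f (c *: g + g') = ka c * C f g + C f g'.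
  by rewrite /C mulrDr -scalerAr Dlin Br; ring.
have C0l g : C 0 g = 0 by apply: (semi0 (E := C^~ g)) => *; apply: Cl.
have C0r f : C f 0 = 0 by apply: (semi0 (E := C f)) => *; apply: Cr.
have CZl c f g : C (c *: f) g = ka c * C f g by apply: (semiZ (E := C^~ g)) => *; apply: Cl.
have CZr c f g : C f (c *: g) = ka c * C f g by apply: (semiZ (E := C f)) => *; apply: Cr.
have CDl f f' g : C (f + f') g = C f g + C f' g by apply: (semiD (E := C^~ g)) => *; apply: Cl.
have CDr f g g' : C f (g + g') = C f g + C f g' by apply: (semiD (E := C f)) => *; apply: Cr.
have B_suml r c (f : nat -> F) g : B g (\sum_(i <- r) c i *: f i) = \sum_(i <- r) ka (c i) * B g (f i).
  by apply: (semi_sum (E := B g)) => *; apply: Bl.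
have B_sumr r c (g : nat -> F) f : B (\sum_(i <- r) c i *: g i) f = \sum_(i <- r) ka (c i) * B (g i) f.
  by apply: (semi_sum (E := B^~ f)) => *; apply: Br.
have Eh_lin c f g : Eh (c *: f + g) = c *: Eh f + Eh g.
  by rewrite (so_rs so).1 scalerDr !scalerA mulrC.
have Eh_j la : Eh (j la) = \sum_(i <- addrows la) (e2 * (up la i * u i (row la i))) *: j (padd la i).
  by rewrite (jb_rs jb) scaler_sumr; apply: eq_bigr => i _; rewrite scalerA.
have dg_lin := (so_dg so).1.
have DE f : aug f -> D (Eh f) = uu * D (p 0 * f) + ka hb * D (dg f).
  move: f; apply: aug_ind => [|c f g _ _ IHf IHg|la ne].
  - rewrite (linear_at0 (so_rs so).1) scaler0 mulr0 (linear_at0 dg_lin).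
    by rewrite (semi0 Dlin) !mulr0 addr0.
  - by rewrite Eh_lin dg_lin mulrDr -scalerAr !Dlin IHf IHg; ring.
  by rewrite hD // (jb_dg jb) (semiZ Dlin) rmorphM mulrA.
have Cb f g : aug f -> aug g -> C (p 0 * f) g = C f (p 0 * g).
  move=> af ag; move: f af; apply: aug_ind => [|c f f' _ _ IHf IHf'|la nla].
  - by rewrite mulr0 !C0l.
  - by rewrite mulrDr -scalerAr !Cl IHf IHf'.
  move: g ag; apply: aug_ind => [|c g g' _ _ IHg IHg'|la' nla'].
  - by rewrite mulr0 !C0r.
  - by rewrite mulrDr -scalerAr !Cr IHg IHg'.
  rewrite /C mulrA [j la * p 0]mulrC; congr (_ - _).
  rewrite !(jb_p0 jb) B_suml B_sumr.
  rewrite (eq_bigr (fun i => ka (up la i) * b (padd la i) la')) => [|i _]; last by rewrite Bjj.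
  by rewrite hb2 //; apply: eq_bigr => i _; rewrite Bjj.
(* For the [D] part this is the Leibniz rule followed by [DE] at f g; for the [B] part it is
   [hb3]. *)
have Cc f g : aug f -> aug g -> C (Eh f) g + C f (Eh g) =
    uu * C (p 0 * f) g + ka hb * (C (dg f) g + C f (dg g)).
  move=> af ag; rewrite /C.
  have -> : D (Eh f * g) - B g (Eh f) + (D (f * Eh g) - B (Eh g) f) =
     D (Eh (f * g)) - (B g (Eh f) + B (Eh g) f).
    rewrite (so_rs so).2 scalerDr scalerAl scalerAr (semiD Dlin); ring.
  rewrite DE; last exact: aug_mul.
  rewrite (so_dg so).2 (semiD Dlin) -mulrA.
  suff -> : B g (Eh f) + B (Eh g) f = uu * B g (p 0 * f) + ka hb * (B g (dg f) + B (dg g) f) by ring.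
  have B0r f' : B 0 f' = 0 by apply: (semi0 (E := B^~ f')) => *; apply: Br.
  move: f af; apply: aug_ind => [|c f f' _ _ IHf IHf'|la nla].
  - rewrite (linear_at0 (so_rs so).1) scaler0 mulr0 (linear_at0 dg_lin) !B0l; ring.
  - rewrite Eh_lin dg_lin mulrDr -scalerAr !Bl.
    transitivity (ka c * (B g (Eh f) + B (Eh g) f) + (B g (Eh f') + B (Eh g) f')); first by ring.
    by rewrite IHf IHf'; ring.
  move: g ag; apply: aug_ind => [|c g g' _ _ IHg IHg'|la' nla'].
  - rewrite (linear_at0 (so_rs so).1) scaler0 (linear_at0 dg_lin) !B0r; ring.
  - rewrite Eh_lin dg_lin !Br.
    transitivity (ka c * (B g (Eh (j la)) + B (Eh g) (j la)) + (B g' (Eh (j la)) + B (Eh g') (j la))); first by ring.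
    by rewrite IHg IHg'; ring.
  rewrite !Eh_j !(jb_p0 jb) !B_suml B_sumr !(jb_dg jb).
  have BZ c g f : B g (c *: f) = ka c * B g f by apply: (semiZ (E := B g)) => *; apply: Bl.
  have BZr c g f : B (c *: g) f = ka c * B g f by apply: (semiZ (E := B^~ f)) => *; apply: Br.
  rewrite BZ BZr Bjj.
  under eq_bigr do rewrite Bjj.
  under [X in _ + X]eq_bigr do rewrite Bjj.
  under [X in uu * X]eq_bigr do rewrite Bjj.
  by rewrite hb3 // natrD mulrDr !rmorphD !rmorphM /=; ring.
(* An opaque copy of e2 E, whose scalar the linearity rewrites below must not extract. *)
have [G GE] : exists G : F -> F, forall f, G f = Eh f by exists (fun f => Eh f).
have Cc' f g : aug f -> aug g -> C (G f) g + C f (G g) =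
    uu * C (p 0 * f) g + ka hb * (C (dg f) g + C f (dg g)).
  by rewrite !GE; exact: Cc.
pose Q h := forall f g, aug f -> aug g -> C (h * f) g = C f (h * g).
have kaN0 c : c != 0 -> ka c != 0 by rewrite fmorph_eq0.
(* e2 (k+1) [p k.+1] is the commutator of [G] and [p k]. By induction [Cc'] has the same right-hand
   side at (p_k f, g) and at (f, p_k g), and equating the left-hand sides gives the next
   generator. *)
have Qp k : Q (p k).
  elim: k => [|k IHk] f g af ag; first exact: Cb.
  have e0 : e2 * k.+1%:R != 0 by rewrite mulf_neq0.
  apply: (mulfI (kaN0 _ e0)); rewrite -CZl -CZr.
  have Ek h : (e2 * k.+1%:R) *: (p k.+1 * h) = G (p k * h) + (-1) *: (p k * G h).
    rewrite !GE; by rewrite (rs_pM so) scalerDr scalerA -scalerAr scaleN1r addrK.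
  have A1 := Cc' (p k * f) g (aug_p _ _) ag; have A2 := Cc' f (p k * g) af (aug_p _ _).
  have aEg : aug (G g) by rewrite GE; apply/augZ/aug_rs.
  have aEf : aug (G f) by rewrite GE; apply/augZ/aug_rs.
  rewrite !(dg_pM so) !CDl !CDr !CZl !CZr mulrCA in A1 A2.
  have ap := aug_p 0 f; have adf := aug_dg af; have adg := aug_dg ag.
  rewrite (IHk f _ af aEg) (IHk _ g ap ag) (IHk f g af ag) (IHk _ g adf ag) (IHk f _ af adg) in A1.
  rewrite CZl CZr -CZl -CZr !Ek CDl CDr CZl CZr (IHk _ g aEf ag) rmorphN1 !mulN1r.
  have -> : C (G (p k * f)) g = C (G (p k * f)) g + C f (p k * G g) - C f (p k * G g) by ring.
  have -> : C f (G (p k * g)) = C (G f) (p k * g) + C f (G (p k * g)) - C (G f) (p k * g) by ring.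
  by rewrite A1 A2; ring.
have Qh h : Q h.
  move: h; apply: (so_gen so) => [f g _ _|k h IH f g af ag|f g _ _|c h h' IHh IHh' f g af ag].
  - by rewrite !mul1r.
  - by rewrite -!mulrA Qp ?IH ?mulrA 1?[p k * h]mulrC //; exact: aug_mul.
  - by rewrite !mul0r C0l C0r.
  by rewrite !mulrDl -!scalerAl Cl Cr IHh // IHh'.
(* In [Cc] at (f, p_k) every second argument is a multiple of [p k], except in one term, which is e2
   (k+1) C(f, p_(k+1)). *)
have Cp k f : aug f -> C f (p k) = 0.
  elim: k f => [|k IHk] f af.
    move: f af; apply: aug_ind => [|c f g _ _ IHf IHg|la ne]; first exact: C0l.
      by rewrite Cl IHf IHg mulr0 addr0.
    by rewrite /C -j_one Bjj j_one hb1 // mulrC subrr.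
  have e0 : e2 * k.+1%:R != 0 by rewrite mulf_neq0.
  apply: (mulfI (kaN0 _ e0)); rewrite mulr0 -CZr.
  have ap : aug (p k) by rewrite -[p k]mulr1; exact: aug_p.
  have := Cc f (p k) af ap; rewrite (so_rsp so) (so_dgp so) scalerA.
  rewrite (IHk (Eh f)) ?(IHk (p 0 * f)) ?(IHk (dg f)) ?CZr ?IHk //; last first.
  - by apply/augZ/aug_rs.
  - exact: aug_p.
  - exact: aug_dg.
  by rewrite add0r => ->; rewrite !(mulr0, addr0).
(* In a product with [p k] the cofactor moves over to [f] by [Qh], leaving [p k] alone; [au]
   subtracts the constant term that the induction on [g] would meet. *)
have C0 f g : aug f -> aug g -> C f g = 0.
  move=> af ag; pose au h := h + (- jf h 1) *: 1.
  suff : C f (au g) = 0 by rewrite /au ag oppr0 scale0r addr0.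
  move: g {ag}; apply: (so_gen so) => [|k g _||c g g' IHg IHg'].
  - by rewrite /au (jf_11 sf) scaleN1r addrN C0r.
  - rewrite /au (aug_p k g) oppr0 scale0r addr0 mulrC -Qh //.
      by apply: Cp; exact: aug_mul.
    by rewrite -[p k]mulr1; exact: aug_p.
  - by rewrite /au (jf0 sf) oppr0 scale0r addr0 C0r.
  have -> : au (c *: g + g') = c *: au g + au g'.
    by rewrite /au (jf_lin sf) scalerDr scalerA mulrN opprD scalerDl addrACA.
  by rewrite Cr IHg IHg' mulr0 addr0.
move=> nmu nnu; apply/eqP; rewrite -subr_eq0 -Bjj -/(C (j mu) (j nu)) C0 //; exact: aug_j.
Qed.
End Functional.

(** * Boxes and partial fractions *)

Section Boxes.
Implicit Types (la mu : intpart).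

Lemma mem_boxes la (b : int * int) :
  (b \in boxes la) = (0 <= b.1)%R && (0 <= b.2)%R && (`|b.2| < row la `|b.1|)%N.
Proof.
apply/allpairsPdep/idP => [[i [k [_ + ->]]]|].
  by rewrite mem_iota add0n.
case: b => [[i|i] [k|k]] //= kl; exists i, k; split=> //; last by rewrite mem_iota.
by rewrite mem_iota add0n -row_gt0 (leq_ltn_trans _ kl).
Qed.

Lemma boxes_uniq la : uniq (boxes la).
Proof.
apply: allpairs_uniq_dep; [exact: iota_uniq | by move=> *; exact: iota_uniq |].
by move=> [i k] [i' k'] _ _ /= [-> ->].
Qed.

Lemma boxes_padd la i : addable la i ->
  perm_eq (boxes (padd la i)) ((i%:Z, (row la i)%:Z) :: boxes la).
Proof.
move=> ai; apply: uniq_perm; first exact: boxes_uniq.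
  by rewrite /= boxes_uniq mem_boxes /= ltnn.
move=> [x y]; rewrite inE !mem_boxes /= row_padd // /incr.
case: x => x; case: y => y; rewrite ?andbF //= xpair_eqE /= ?andbF //.
have -> : (Posz x == Posz i) = (x == i) by [].
have -> : (Posz y == Posz (row la i)) = (y == row la i) by [].
by case: (x =P i) => [->|_] /=; rewrite ?addn0 // addn1 ltnS leq_eqVlt.
Qed.

Lemma mem00_boxes la : la <> ones 0 -> ((0, 0) : int * int) \in boxes la.
Proof.
move=> n0; rewrite mem_boxes /= row_gt0 lt0n; apply/eqP => s0; apply: n0.
by apply: row_inj => k; rewrite !row_default // s0.
Qed.

Lemma boxes_onebox : perm_eq (boxes (padd (ones 0) 0)) [:: ((0, 0) : int * int)].
Proof. by apply: (perm_trans (boxes_padd (isT : addable (ones 0) 0))). Qed.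
End Boxes.

(** * Partial fractions of the product formula *)

Section Numeric.
Variables (K : fieldType) (e1 e2 : K).
Hypothesis gen : generic e1 e2.
Variables (L : fieldType) (ka : {rmorphism K -> L}).
Implicit Types (la mu nu : intpart).

Local Notation br := (weight e1 e2).
Local Notation "[ 'ct' la i ]" := (br i (row la i)) (at level 0, la at level 8, i at level 8).
Local Notation upc := (jack_up e1 e2).
Local Notation varpi := (varpi e1 e2).

Lemma brakE i k : brak e1 e2 (i%:Z, k%:Z) = br i k.
Proof. by []. Qed.

Lemma brakD x y : brak e1 e2 (x + y) = brak e1 e2 x + brak e1 e2 y.
Proof. by rewrite /brak /= !rmorphD /=; ring. Qed.

(** For nonempty [la] the added box is not the corner (0, 0) that [varpi] omits. *)
Lemma varpi_padd la i : la <> ones 0 -> addable la i -> varpi (padd la i) = varpi la * [ct la i].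
Proof.
move=> n0 ai; rewrite /Defs.varpi (perm_big _ (boxes_padd ai)) big_cons.
case: eqP => [E|_]; last by rewrite mulrC.
have := mem00_boxes n0; rewrite -E => H.
by have := boxes_uniq (padd la i); rewrite (perm_uniq (boxes_padd ai)) /= H.
Qed.

Lemma varpi_onebox : varpi (padd (ones 0) 0) = 1.
Proof. by rewrite /Defs.varpi (perm_big _ boxes_onebox) big_cons big_nil eqxx. Qed.

Definition Nratio (z : L) : L := ((z - ka (brak e1 e2 (0, 0))) * (z - ka (brak e1 e2 (1, 1)))) /
  ((z - ka (brak e1 e2 (1, 0))) * (z - ka (brak e1 e2 (0, 1)))).

Definition Tprod la (z : L) : L := \prod_(x <- boxes la) Nratio (z - ka (brak e1 e2 x)).

(** Keeps every denominator nonzero, and is stable under shifts by elements of K. *)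
Definition transc (z : L) := forall x : K, z != ka x.

Lemma transcB z x : transc z -> transc (z - ka x).
Proof. by move=> tz y; rewrite subr_eq -rmorphD; exact: tz. Qed.

Lemma transc_neq0 z x : transc z -> z - ka x != 0.
Proof. by move=> tz; rewrite subr_eq0; exact: tz. Qed.

Lemma Nratio_row z i m : transc z -> \prod_(k <- iota 0 m) Nratio (z - ka (br i k)) =
  ((z - ka (br i 0)) * (z - ka (br i.+1 m))) / ((z - ka (br i.+1 0)) * (z - ka (br i m))).
Proof.
move=> tz; elim: m => [|m IHm].
  by rewrite big_nil [X in _ / X]mulrC divff // mulf_neq0 // transc_neq0.
rewrite prod_iotaS /= IHm /Nratio.
have e (x y : K) : z - ka x - ka y = z - ka (x + y) by rewrite rmorphD opprD addrA.
rewrite !e.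
have -> : br i m + brak e1 e2 (0, 0) = br i m by rewrite /brak /= !mulr0z !mul0r !addr0.
have -> : br i m + brak e1 e2 (1, 1) = br i.+1 m.+1 by rewrite /brak /weight /= -[in RHS]addn1 -[in RHS](addn1 m) !natrD; ring.
have -> : br i m + brak e1 e2 (1, 0) = br i.+1 m by rewrite /brak /weight /= -[in RHS]addn1 natrD; ring.
have -> : br i m + brak e1 e2 (0, 1) = br i m.+1 by rewrite /brak /weight /= -[in RHS]addn1 natrD; ring.
have n1 := transc_neq0 (br i.+1 0) tz; have n2 := transc_neq0 (br i m) tz.
have n3 := transc_neq0 (br i.+1 m) tz; have n4 := transc_neq0 (br i m.+1) tz.
by field; rewrite n1 n2 n3 n4.
Qed.

(** The rows, already telescoped by [Nratio_row], telescope once more. With row [N] empty the result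
    is z G(z), where G is the function whose residues are the up coefficients; this ties T to the
    Pieri rule. *)
Lemma Tprod_rows la z N : transc z ->
  \prod_(i <- iota 0 N) \prod_(k <- iota 0 (row la i)) Nratio (z - ka (br i k)) =
  z * (\prod_(k <- iota 0 N) (z - ka ([ct la k] + e1))) /
  ((z - ka (br N 0)) * \prod_(k <- iota 0 N) (z - ka [ct la k])).
Proof.
move=> tz; elim: N => [|N IHN].
  rewrite !big_nil !mulr1 /weight !mul0r addr0 rmorph0 subr0 divff //.
  by have := tz 0; rewrite rmorph0.
rewrite !prod_iotaS IHN Nratio_row //=.
have -> : br N (row la N) + e1 = br N.+1 (row la N) by rewrite /weight -[in RHS]addn1 natrD; ring.
have n1 := transc_neq0 (br N.+1 0) tz; have n2 := transc_neq0 (br N 0) tz.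
have n3 := transc_neq0 [ct la N] tz.
have n4 : \prod_(k <- iota 0 N) (z - ka [ct la k]) != 0.
  by rewrite prodf_seq_neq0; apply/allP => k _; exact: transc_neq0.
by field; rewrite n1 n2 n3 n4.
Qed.

Lemma map_weight i k : ka (br i k) = weight (ka e1) (ka e2) i k.
Proof. by rewrite rmorphD !rmorphM !rmorph_nat. Qed.

Lemma map_rowend r i : ka (rowend e1 e2 r i) = rowend (ka e1) (ka e2) r i.
Proof. exact: map_weight. Qed.

Lemma map_generic : generic (ka e1) (ka e2).
Proof. by move=> i k i' k'; rewrite -!map_weight => /fmorph_inj; exact: gen. Qed.

Lemma map_jack_up la i : ka (upc la i) = jack_up (ka e1) (ka e2) la i.
Proof.
rewrite /jack_up /up_coef rmorphM fmorphV !rmorph_prod; congr (_ / _).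
  apply: eq_bigr => k _; by rewrite rmorphB [ka (_ + e1)]rmorphD !map_rowend.
by apply: eq_bigr => k _; rewrite rmorphB !map_rowend.
Qed.

Lemma Tprod_partfrac la z : transc z ->
  Tprod la z = z * \sum_(i <- addrows la) ka (upc la i) / (z - ka [ct la i]).
Proof.
move=> tz.
have -> : Tprod la z = \prod_(i <- iota 0 (size la)) \prod_(k <- iota 0 (row la i)) Nratio (z - ka (br i k)).
  by rewrite /Tprod /boxes big_allpairs_dep.
rewrite Tprod_rows //; under [X in _ = z * X]eq_bigr do rewrite map_jack_up map_weight.
rewrite (jack_up_partfrac map_generic) => [|i]; last by rewrite -map_weight; exact: tz.
rewrite mulrA prod_iotaS /= [_ * (z - _)]mulrC -map_weight row_default //; congr (_ * _ / (_ * _)).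
  by apply: eq_bigr => k _; rewrite rmorphD map_weight.
by apply: eq_bigr => k _; rewrite map_weight.
Qed.

Lemma sum_ka (r : seq nat) (f : nat -> K) : \sum_(i <- r) ka (f i) = ka (\sum_(i <- r) f i).
Proof. by rewrite rmorph_sum. Qed.

Lemma Tprod_partfrac1 la z : transc z ->
  Tprod la z = 1 + \sum_(i <- addrows la) ka (upc la i * [ct la i]) / (z - ka [ct la i]).
Proof.
move=> tz; have [M0 _ _] := jack_up_moments gen la.
rewrite Tprod_partfrac // -[1](rmorph1 ka) -M0 -sum_ka mulr_sumr -big_split; apply: eq_bigr => i _ /=.
have n := transc_neq0 [ct la i] tz; rewrite rmorphM; field.
by rewrite n.
Qed.

Variable uu : L.
Hypothesis tu : transc uu.

Definition Ssum la : L := \sum_(s <- boxes la) 1 / (uu - ka (brak e1 e2 s)).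

Lemma Ssum_padd la i : addable la i -> Ssum (padd la i) = Ssum la + 1 / (uu - ka [ct la i]).
Proof. by move=> ai; rewrite /Ssum (perm_big _ (boxes_padd ai)) big_cons [LHS]addrC brakE. Qed.

(** As the first moment is 0, only the fractions of the added boxes survive. Up to [varpi] this is
    Delta(p_1 j_la). *)
Lemma Ssum_moment1 la :
  \sum_(i <- addrows la) ka (upc la i * [ct la i]) * Ssum (padd la i) = Tprod la uu - 1.
Proof.
have [_ M1 _] := jack_up_moments gen la.
rewrite (Tprod_partfrac1 la tu) addrAC subrr add0r.
under eq_big_seq => i.
  rewrite mem_addrows => ai; rewrite Ssum_padd // mulrDr mul1r; over.
by rewrite big_split /= -mulr_suml sum_ka M1 rmorph0 mul0r add0r.
Qed.

(** Up to [varpi], Delta(e2 E j_la): the second moment multiplies the old sum by - e1 e2 |la|, and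
    x^2 / (u - x) = u x / (u - x) - x reduces the new fractions to the first moment. *)
Lemma Ssum_moment2 la :
  \sum_(i <- addrows la) ka (upc la i * [ct la i] ^+ 2) * Ssum (padd la i) =
  uu * (Tprod la uu - 1) + ka (- (e1 * e2) * (sumn la)%:R) * Ssum la.
Proof.
have [_ M1 M2] := jack_up_moments gen la.
rewrite (Tprod_partfrac1 la tu) addrAC subrr add0r.
under eq_big_seq => i.
  rewrite mem_addrows => ai; rewrite Ssum_padd // mulrDr mul1r; over.
rewrite big_split /= -mulr_suml sum_ka M2 addrC; congr (_ + _).
rewrite mulr_sumr; apply/eqP; rewrite -subr_eq0 -sumrB.
rewrite (eq_bigr (fun i => - ka (upc la i * [ct la i]))) => [|i _].
  by rewrite sumrN sum_ka M1 rmorph0 oppr0.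
have n := transc_neq0 [ct la i] tu; move: (upc la i) => c.
by rewrite !rmorphM; field; rewrite n.
Qed.

Definition Tstar mu nu : L :=
  \prod_(x <- boxes mu) \prod_(y <- boxes nu) Nratio (uu - ka (brak e1 e2 (x + y))).

Lemma Tstar_sym mu nu : Tstar mu nu = Tstar nu mu.
Proof.
rewrite /Tstar exchange_big; apply: eq_bigr => x _; apply: eq_bigr => y _.
by rewrite [_ + x]addrC.
Qed.

Lemma Tstar_padd mu nu i : addable mu i ->
  Tstar (padd mu i) nu = Tstar mu nu * Tprod nu (uu - ka [ct mu i]).
Proof.
move=> ai; rewrite /Tstar (perm_big _ (boxes_padd ai)) big_cons mulrC; congr (_ * _).
apply: eq_bigr => y _; rewrite brakD brakE rmorphD opprD addrA.
by [].
Qed.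

Definition product_value mu nu : L := ka (varpi mu * varpi nu) * (Tstar mu nu - 1).

Lemma product_value_sym mu nu : product_value mu nu = product_value nu mu.
Proof. by rewrite /product_value Tstar_sym mulrC [varpi mu * _]mulrC mulrC. Qed.

Lemma product_value_onebox mu : product_value mu (padd (ones 0) 0) = ka (varpi mu) * (Tprod mu uu - 1).
Proof.
rewrite /product_value varpi_onebox mulr1 /Tstar; congr (_ * (_ - 1)).
apply: eq_bigr => x _; rewrite (perm_big _ boxes_onebox) big_seq1 addr0.
by [].
Qed.

(** What remains of the Pieri sum of [product_value] after partial fractions; its symmetry is the
    identity B(p_1 f, g) = B(f, p_1 g). *)
Definition pole_sum mu nu : L := \sum_(i <- addrows mu) \sum_(t <- addrows nu)
   ka (upc mu i * [ct mu i]) * ka (upc nu t * [ct nu t]) / (uu - ka [ct mu i] - ka [ct nu t]).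

Lemma pole_sum_sym mu nu : pole_sum mu nu = pole_sum nu mu.
Proof.
rewrite /pole_sum exchange_big; apply: eq_bigr => i _; apply: eq_bigr => t _.
by rewrite [ka _ * _]mulrC addrAC.
Qed.

Lemma pole_sumE mu nu : \sum_(i <- addrows mu) ka (upc mu i * [ct mu i]) * Tprod nu (uu - ka [ct mu i]) = pole_sum mu nu.
Proof.
have [_ M1 _] := jack_up_moments gen mu.
under eq_bigr do rewrite (Tprod_partfrac1 nu (transcB _ tu)) mulrDr mulr1.
rewrite big_split /= sum_ka M1 rmorph0 add0r; apply: eq_bigr => i _.
by rewrite mulr_sumr; apply: eq_bigr => t _; rewrite mulrA.
Qed.

Lemma product_value_padd mu nu i : mu <> ones 0 -> addable mu i ->
  product_value (padd mu i) nu = ka (varpi mu * varpi nu) * (ka [ct mu i] * (Tstar mu nu * Tprod nu (uu - ka [ct mu i]) - 1)).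
Proof.
by move=> n0 ai; rewrite /product_value Tstar_padd // varpi_padd // !rmorphM /=; ring.
Qed.

Lemma product_value_pieri mu nu : mu <> ones 0 ->
  \sum_(i <- addrows mu) ka (upc mu i) * product_value (padd mu i) nu =
  ka (varpi mu * varpi nu) * (Tstar mu nu * pole_sum mu nu).
Proof.
move=> n0; have [_ M1 _] := jack_up_moments gen mu.
rewrite -pole_sumE mulr_sumr mulr_sumr.
rewrite (eq_big_seq (fun i => ka (varpi mu * varpi nu) * (Tstar mu nu * (ka (upc mu i * [ct mu i]) * Tprod nu (uu - ka [ct mu i])))
   - ka (varpi mu * varpi nu) * ka (upc mu i * [ct mu i]))) => [|i].
  by rewrite sumrB -[X in _ - X]mulr_sumr sum_ka M1 rmorph0 mulr0 subr0.
by rewrite mem_addrows => ai; rewrite product_value_padd // !rmorphM; ring.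
Qed.

Lemma product_value_comm mu nu : mu <> ones 0 -> nu <> ones 0 ->
  \sum_(i <- addrows mu) ka (upc mu i) * product_value (padd mu i) nu =
  \sum_(t <- addrows nu) ka (upc nu t) * product_value mu (padd nu t).
Proof.
move=> n0 n1; rewrite product_value_pieri //; under [RHS]eq_bigr do rewrite product_value_sym.
by rewrite product_value_pieri // Tstar_sym pole_sum_sym [varpi mu * _]mulrC.
Qed.

Lemma product_value_second mu nu : mu <> ones 0 ->
  \sum_(i <- addrows mu) ka (upc mu i * [ct mu i]) * product_value (padd mu i) nu =
  ka (varpi mu * varpi nu) *
   (Tstar mu nu * (\sum_(i <- addrows mu) ka (upc mu i * [ct mu i] ^+ 2) * Tprod nu (uu - ka [ct mu i]))
    - ka (- (e1 * e2) * (sumn mu)%:R)).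
Proof.
move=> n0; have [_ _ M2] := jack_up_moments gen mu.
rewrite -M2 -sum_ka mulr_sumr -sumrB mulr_sumr.
apply: eq_big_seq => i; rewrite mem_addrows => ai.
by rewrite product_value_padd // !rmorphM; ring.
Qed.

(** For weights x and y of boxes added to [mu] and [nu], adding the two expansions puts x + y over u
    - x - y. This is u / (u - x - y) minus 1, and the constant is killed by the vanishing first
    moments. *)
Lemma Tprod_second mu nu :
  \sum_(i <- addrows mu) ka (upc mu i * [ct mu i] ^+ 2) * Tprod nu (uu - ka [ct mu i]) +
  \sum_(t <- addrows nu) ka (upc nu t * [ct nu t] ^+ 2) * Tprod mu (uu - ka [ct nu t]) =
  ka (- (e1 * e2) * (sumn mu + sumn nu)%:R) + uu * pole_sum mu nu.
Proof.
have [_ M1 M2] := jack_up_moments gen mu; have [_ N1 N2] := jack_up_moments gen nu.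
have H m n : \sum_(i <- addrows m) ka (upc m i * [ct m i] ^+ 2) * Tprod n (uu - ka [ct m i]) =
   ka (- (e1 * e2) * (sumn m)%:R) + \sum_(i <- addrows m) \sum_(t <- addrows n)
     ka (upc m i * [ct m i]) * ka (upc n t * [ct n t]) * ka [ct m i] / (uu - ka [ct m i] - ka [ct n t]).
  have [_ _ <-] := jack_up_moments gen m.
  rewrite -sum_ka -big_split; apply: eq_bigr => i _ /=.
  rewrite (Tprod_partfrac1 n (transcB _ tu)) mulrDr mulr1; congr (_ + _).
  rewrite mulr_sumr; apply: eq_bigr => t _; rewrite mulrA; congr (_ / _).
  by rewrite !rmorphM; ring.
rewrite !H [X in _ + (_ + X)]exchange_big /= addrACA; congr (_ + _).
  by rewrite -rmorphD natrD mulrDr.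
rewrite -big_split /= /pole_sum mulr_sumr; apply/eqP; rewrite -subr_eq0 -sumrB.
rewrite (eq_bigr (fun i => - (ka (upc mu i * [ct mu i]) * ka (\sum_(t <- addrows nu) upc nu t * [ct nu t])))).
  by rewrite sumrN -mulr_suml N1 rmorph0 mulr0 oppr0.
move=> i _; rewrite -big_split /= mulr_sumr -sumrB -sum_ka mulr_sumr -sumrN; apply: eq_bigr => t _.
have n := transc_neq0 [ct nu t] (transcB [ct mu i] tu).
have -> : uu - ka [ct nu t] - ka [ct mu i] = uu - ka [ct mu i] - ka [ct nu t] by ring.
by field; rewrite n.
Qed.

Lemma product_value_deriv mu nu : mu <> ones 0 -> nu <> ones 0 ->
  \sum_(i <- addrows mu) ka (upc mu i * [ct mu i]) * product_value (padd mu i) nu +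
  \sum_(t <- addrows nu) ka (upc nu t * [ct nu t]) * product_value mu (padd nu t) =
  uu * (\sum_(i <- addrows mu) ka (upc mu i) * product_value (padd mu i) nu) +
  ka (- (e1 * e2) * (sumn mu + sumn nu)%:R) * product_value mu nu.
Proof.
move=> n0 n1; rewrite product_value_second // product_value_pieri //.
under [X in _ + X]eq_bigr do rewrite product_value_sym.
rewrite product_value_second // [varpi nu * _]mulrC [Tstar nu mu]Tstar_sym -mulrDr.
have T2 := Tprod_second mu nu; rewrite /product_value.
set A := \sum_(_ <- addrows mu) _ in T2 *; set B := \sum_(_ <- addrows nu) _ in T2 *.
transitivity (ka (varpi mu * varpi nu) * (Tstar mu nu * (A + B) - ka (- (e1 * e2) * (sumn mu + sumn nu)%:R))).
  have -> : ka (- (e1 * e2) * (sumn mu + sumn nu)%:R) =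
      ka (- (e1 * e2) * (sumn mu)%:R) + ka (- (e1 * e2) * (sumn nu)%:R).
    by rewrite -rmorphD natrD mulrDr.
  by move: (ka (_ * (sumn mu)%:R)) (ka (_ * (sumn nu)%:R)) => c d; ring.
by rewrite T2; ring.
Qed.
End Numeric.

(** * The Fock model of the Jack functions and its dual *)

Section Models.
Variables (K : fieldType) (al : K).
Hypothesis al0 : al != 0.

(** With [dual_dn], the transposes of [dn] and [up] for a form in which p_1 is adjoint to al times
    d_1. *)
Definition dual_up (dn : intpart -> nat -> K) (la : intpart) i := al * dn (padd la i) i.
Definition dual_dn (up : intpart -> nat -> K) (la : intpart) j := up (prem la j) j / al.

(** Transposing exchanges the two factors of each diagonal product, so the diagonals are unchanged;
    the swap relation is the original one read at [prem (padd la i) j] with the rows exchanged. *)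
Lemma dual_fockmodel up dn u v : fockmodel up dn u v ->
  fockmodel (dual_up dn) (dual_dn up) u v.
Proof.
case=> sw d1 du dv duv.
have E w la : diag (dual_up dn) (dual_dn up) w la = diag up dn w la.
  rewrite /diag /dual_up /dual_dn; congr (_ - _).
    apply: eq_big_seq => i; rewrite mem_addrows => ai; rewrite prem_padd //.
    by congr (_ * _); field.
  apply: eq_big_seq => j; rewrite mem_remrows => rj; rewrite padd_prem //.
  by congr (_ * _); field.
split=> [la i j ij ai rj|la|la|la|la]; rewrite ?E //.
rewrite /dual_up /dual_dn.
have /esym := add_rem_swap la ij; rewrite ai rj => /andP[rj' ai'].
have ms := padd_prem_swap ij ai rj.
have ji : j != i by rewrite eq_sym.
have aj : addable (prem (padd la i) j) j by exact: addable_prem.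
have H := sw (prem (padd la i) j) j i ji aj.
rewrite padd_prem // in H; rewrite removable_padd // in H.
move: (H isT); rewrite ms prem_padd // => {}H.
transitivity (up (padd (prem la j) i) j * dn (padd la i) i); first by field.
by rewrite H; field.
Qed.

Variables (e1 e2 : K).
Hypothesis gen : generic e1 e2.

(** With [wv], the weights of E and of its adjoint. They differ by the factor [al], and their
    product - weight^2 / (e1 e2) turns the second diagonal moment into twice the size. *)
Definition wu i j := weight e1 e2 i j / e2.
Definition wv i j := - weight e1 e2 i j / e1.

Lemma wv_wu i j : wv i j = - e2 / e1 * wu i j.
Proof. by have n1 := gen_e1 gen; have n2 := gen_e2 gen; rewrite /wv /wu; field; rewrite n1 n2. Qed.

Lemma wvS i j : wv i.+1 j = wv i j - 1.
Proof. by have n1 := gen_e1 gen; rewrite /wv /weight -addn1 natrD; field. Qed.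

Lemma jack_fockmodel : fockmodel (jack_up e1 e2) (jack_dn e1 e2) wu wv.
Proof.
have n1 := gen_e1 gen; have n2 := gen_e2 gen.
have E m c (w : nat -> nat -> K) la : (forall i j, w i j = c * weight e1 e2 i j ^+ m) ->
  diag (jack_up e1 e2) (jack_dn e1 e2) w la = c *
  (\sum_(i <- addrows la) jack_up e1 e2 la i * jack_dn e1 e2 (padd la i) i * weight e1 e2 i (row la i) ^+ m -
   \sum_(j <- remrows la) jack_dn e1 e2 la j * jack_up e1 e2 (prem la j) j * weight e1 e2 j (row la j).-1 ^+ m).
  move=> wE; rewrite /diag mulrBr !mulr_sumr.
  by congr (_ - _); apply: eq_bigr => i _; rewrite wE mulrCA.
split=> [la i j ij ai rj|la|la|la|la].
- exact: jack_up_dn_swap.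
- have [D0 _ _] := jack_up_dn_diag gen la.
  by rewrite (E 0%N 1) ?D0 ?mulr1 // => i j; rewrite mul1r.
- have [_ D1 _] := jack_up_dn_diag gen la.
  by rewrite (E 1%N e2^-1) ?D1 ?mulr0 // => i j; rewrite /wu mulrC.
- have [_ D1 _] := jack_up_dn_diag gen la.
  by rewrite (E 1%N (- e1^-1)) ?D1 ?mulr0 // => i j; rewrite /wv; ring.
have [_ _ D2] := jack_up_dn_diag gen la.
rewrite (E 2%N (- (e1 * e2)^-1)) => [|i j]; first by rewrite D2; field; rewrite n1 n2.
by rewrite /wu /wv; field; rewrite n1 n2.
Qed.
End Models.

(** * Evaluation morphisms *)

Section FreeGenerators.
Variables (K : fieldType) (F : comAlgType K) (p : nat -> F).
Hypothesis gen : generated_by p.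

Definition evaluates (S : comNzRingType) (c : K -> S) (v : nat -> S) (h : F -> S) : Prop :=
  (forall a f, h (a *: f) = c a * h f) /\ forall k, h (p k) = v k.

Hypothesis univ : forall (S : comNzRingType) (c : {rmorphism K -> S}) (v : nat -> S),
  exists h : {rmorphism F -> S}, evaluates c v h.

Local Notation cF := (polyC \o GRing.in_alg F).

(** The dual number trick: the morphism sending [p k] to [p k] + [v k] X is the identity modulo X,
    and its coefficient of X is the derivation. *)
Lemma derivation_exists (v : nat -> F) :
  exists D : F -> F, derivation D /\ forall k, D (p k) = v k.
Proof.
have [h [hZ hv]] := univ cF (fun k => (p k)%:P + (v k)%:P * 'X).
have h0 f : (h f)`_0 = f.
  move: f; apply: gen => [|k f IHf||a f g IHf IHg].
  - by rewrite rmorph1 coef1.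
  - by rewrite rmorphM /= hv coef0M coefD coefC coefMX addr0 IHf.
  - by rewrite rmorph0 coef0.
  by rewrite rmorphD /= hZ coefD coefCM IHf IHg mulr_algl.
exists (fun f => (h f)`_1); split=> [|k]; last first.
  by rewrite hv coefD coefC coefMX coefC add0r.
split=> [a f g|f g]; first by rewrite rmorphD /= hZ coefD coefCM mulr_algl.
by rewrite rmorphM /= coefM !big_ord_recl big_ord0 /= !h0 addr0 addrC.
Qed.

Lemma symops_exists : exists pd rs lw dg, symops p pd rs lw dg.
Proof.
have [pd Hpd] := boolp.choice (fun k => derivation_exists (fun i => (i == k)%:R)).
have [rs [drs Hrs]] := derivation_exists (fun k => k.+1%:R *: p k.+1).
have [lw [dlw Hlw]] := derivation_exists (fun k => if k is l.+1 then k.+1%:R *: p l else 0).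
have [dg [ddg Hdg]] := derivation_exists (fun k => k.+1%:R *: p k).
exists pd, rs, lw, dg; split=> // [k|k i]; first by case: (Hpd k).
by case: (Hpd k) => _ ->.
Qed.

(* The morphism [p_k -> p_k X^(k+1)] sends a homogeneous [f] of degree n to [f X^n]. *)
Lemma homogeneous_scale (dg : F -> F) (c : K) (n : nat) (f : F)
    (s h : {rmorphism F -> F}) :
  (forall n, (n.+1%:R : K) != 0) ->
  derivation dg -> (forall k, dg (p k) = k.+1%:R *: p k) ->
  evaluates (GRing.in_alg F) (fun k => s (p k)) s ->
  evaluates (GRing.in_alg F) (fun k => c ^+ k.+1 *: s (p k)) h ->
  dg f = n%:R *: f -> h f = c ^+ n *: s f.
Proof.
move=> char0 ddg Hdg [sZ _] [hZ hv] dgf.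
have [g [gZ gv]] := univ cF (fun k => (p k)%:P * 'X^(k.+1)).
have g_dg i x : (g (dg x))`_i = i%:R * (g x)`_i.
  move: x i; apply: gen => [i|k x IHx i|i|a x y IHx IHy i].
  - by rewrite (derivation1 ddg) rmorph0 rmorph1 coef0 coef1; case: i => [|i]; rewrite ?mul0r ?mulr0.
  - rewrite ddg.2 Hdg -scalerAl rmorphD /= gZ !rmorphM /= gv -!mulrA coefD !coefCM !coefXnM.
    case: ltnP => [|ki]; first by rewrite !mulr0 addr0.
    have -> : (i%:R : F) = k.+1%:R + (i - k.+1)%:R by rewrite -natrD subnKC.
    by rewrite IHx scaler_nat; ring.
  - by rewrite (linear_at0 ddg.1) rmorph0 !coef0 mulr0.
  by rewrite ddg.1 !rmorphD /= !gZ !coefD !coefCM IHx IHy; ring.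
have g1 x : (g x).[1] = x.
  move: x; apply: gen => [|k x IHx||a x y IHx IHy].
  - by rewrite rmorph1 hornerC.
  - by rewrite rmorphM /= gv !hornerE IHx expr1n mulr1.
  - by rewrite rmorph0 horner0.
  by rewrite rmorphD /= gZ !hornerE IHx IHy mulr_algl.
have hg x : h x = (map_poly s (g x)).[c%:A].
  move: x; apply: gen => [|k x IHx||a x y IHx IHy].
  - by rewrite !rmorph1 hornerC.
  - rewrite !rmorphM /= gv hv !rmorphM /= map_polyC map_polyXn !hornerE IHx /=.
    by rewrite exprZn expr1n [s _ * _%:A]mulrC mulr_algl.
  - by rewrite !rmorph0 horner0.
  rewrite !rmorphD /= gZ hZ rmorphM /= map_polyC !hornerE IHx IHy /=.
  by rewrite sZ rmorph1 mulr1.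
have natK (m : nat) (x : F) : m%:R * x = (m%:R : K) *: x by rewrite mulr_natl scaler_nat.
have gn i : i != n -> (g f)`_i = 0.
  move=> ni; have := g_dg i f; rewrite dgf gZ coefCM mulr_algl natK => /eqP.
  rewrite -subr_eq0 -scalerBl scaler_eq0 => /orP[|/eqP //].
  have natB a b : (a < b)%N -> (b%:R - a%:R : K) != 0.
    by move=> ab; rewrite -natrB ?(ltnW ab) // -(prednK (_ : 0 < b - a)%N) ?subn_gt0.
  case: (ltngtP i n) => [/natB/negPf ->//|/natB|/eqP]; last by rewrite (negPf ni).
  by rewrite -oppr_eq0 opprB => /negPf ->.
have gfE : g f = ((g f)`_n)%:P * 'X^n.
  apply/polyP => i; rewrite coefCM coefXn; case: eqP => [->|/eqP/gn ->]; rewrite ?mulr1 ?mulr0 //.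
have fE : (g f)`_n = f by rewrite -[RHS]g1 gfE !hornerE coefCM coefXn eqxx expr1n.
by rewrite hg gfE fE rmorphM /= map_polyC map_polyXn !hornerE /= exprZn expr1n mulrC mulr_algl.
Qed.
End FreeGenerators.

(** * The product formula for the Jack family *)

Section JackProducts.
Variables (K : fieldType) (e1 e2 : K).
Hypothesis gen : generic e1 e2.
Variables (F : comAlgType K) (p : nat -> F).
Variables (pd : nat -> F -> F) (rs lw dg : F -> F) (jf : F -> F -> K).
Local Notation al := (- e2 / e1).
Hypothesis so : symops p pd rs lw dg.
Hypothesis univ : forall (S : comNzRingType) (c : {rmorphism K -> S}) (v : nat -> S),
  exists h : {rmorphism F -> S}, evaluates p c v h.
Hypothesis sf : symform p pd al jf.
Hypothesis nondeg : forall f, (forall g, jf f g = 0) -> f = 0.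
Variables (M : freemod K intpart) (tau : {rmorphism F -> {poly F}}).
Hypothesis tauE : evaluates p (polyC \o GRing.in_alg F) (fun k => (p k)%:P + 'X^(k.+1)) tau.

Variable J : intpart -> F.
Hypothesis J_orth : forall la mu, la <> mu -> jf (J la) (J mu) = 0.
Hypothesis J_sumn : forall (la : intpart) s, xcoef jf tau s (J la) != 0 -> sumn s = sumn la.
Hypothesis J_lexb : forall la rho : intpart, xcoef jf tau rho (J la) != 0 -> lexb rho la.
Hypothesis J_ones : forall la : intpart, xcoef jf tau (nseq (sumn la) 1%N) (J la) = ((sumn la)`!)%:R.

Variable s : {rmorphism F -> F}.
Hypothesis sE : evaluates p (GRing.in_alg F) (fun k => (- e1)^-1 *: p k) s.
Local Notation H la := ((- e1) ^+ sumn (parts la) *: s (J la)).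

Variables (L : fieldType) (ka : {rmorphism K -> L}) (uu : L) (Delta : F -> L).
Hypothesis tu : transc ka uu.
Hypothesis Delta_lin : forall c f g, Delta (c *: f + g) = ka c * Delta f + Delta g.
Hypothesis DeltaE : forall la, Delta (H la) = ka (varpi e1 e2 la) * Ssum e1 e2 ka uu la.

Theorem jack_product mu nu : mu <> ones 0 -> nu <> ones 0 ->
  Delta (H mu * H nu) = product_value e1 e2 ka uu mu nu.
Proof.
have n1 := gen_e1 gen; have n2 := gen_e2 gen; have char0 := gen_nat gen.
have al0 : al != 0 by rewrite mulf_neq0 ?oppr_eq0 ?invr_eq0.
have fk := jack_fockmodel gen; have fk' := dual_fockmodel al0 fk.
have adj0 la j : removable la j -> al * dual_dn al (jack_up e1 e2) la j = jack_up e1 e2 (prem la j) j.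
  by move=> _; rewrite /dual_dn mulrC divfK.
have adj0' la j : removable la j -> al * jack_dn e1 e2 la j = dual_up al (jack_dn e1 e2) (prem la j) j.
  by move=> rj; rewrite /dual_up padd_prem.
have [j [js [jb jbs dual]]] := jackpair_exists so sf char0 al0 nondeg M fk fk' adj0 adj0' (wv_wu gen).
have tauZ c f : tau (c *: f) = (c%:A)%:P * tau f by rewrite tauE.1.
have Jj := jack_unique so sf char0 al0 nondeg tauZ tauE.2 (wv_wu gen) (wvS gen) jb jbs dual
  (sum_jack_dnE gen) J_orth J_sumn J_lexb J_ones.
(* On degree n the rescaling [s] followed by the factor (- e1)^n is the ring morphism [h]. So a
   product of homogeneous Jack functions is [h] of a product of [j], and [Delta] may be replaced by
   its composite with [h]. *)
have [h hE] := univ (GRing.in_alg F) (fun k => (- e1) ^+ k.+1 *: s (p k)).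
have sE' : evaluates p (GRing.in_alg F) (fun k => s (p k)) s by split=> [|//]; exact: sE.1.
have Hj la : H la = h (j la).
  by rewrite Jj (homogeneous_scale (so_gen so) univ char0 (so_dg so) (so_dgp so) sE' hE (jb_dg jb la)).
have hl c f : h (c *: f) = c *: h f by rewrite hE.1 mulr_algl.
pose D f := Delta (h f).
have Dlin c f g : D (c *: f + g) = ka c * D f + D g by rewrite /D rmorphD /= hl Delta_lin.
have Dj la : D (j la) = ka (varpi e1 e2 la) * Ssum e1 e2 ka uu la by rewrite /D -Hj DeltaE.
have D0 : D 0 = 0.
  by have := Dlin (-1) 0 0; rewrite scaler0 addr0 rmorphN1 mulN1r addNr.
have Dsum (r : seq nat) c (f : nat -> intpart) : D (\sum_(i <- r) c i *: j (f i)) = \sum_(i <- r) ka (c i) * D (j (f i)).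
  by elim: r => [|i r IHr]; rewrite ?big_nil // !big_cons Dlin IHr.
have DZ c f : D (c *: f) = ka c * D f by rewrite -[c *: f]addr0 Dlin D0 addr0.
have Dp la : la <> ones 0 -> D (p 0 * j la) = ka (varpi e1 e2 la) * (Tprod e1 e2 ka la uu - 1).
  move=> n0; rewrite (jb_p0 jb) Dsum -(Ssum_moment1 gen tu) mulr_sumr.
  apply: eq_big_seq => i; rewrite mem_addrows => ai.
  by rewrite Dj varpi_padd // !rmorphM; ring.
have Drs la : la <> ones 0 -> D (e2 *: rs (j la)) =
    uu * D (p 0 * j la) + ka (- (e1 * e2) * (sumn la)%:R) * D (j la).
  move=> n0; rewrite DZ (jb_rs jb) Dsum Dp // Dj.
  transitivity (ka (varpi e1 e2 la) * \sum_(i <- addrows la)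
      ka (jack_up e1 e2 la i * weight e1 e2 i (row la i) ^+ 2) * Ssum e1 e2 ka uu (padd la i)).
    rewrite !mulr_sumr; apply: eq_big_seq => i; rewrite mem_addrows => ai.
    have -> : jack_up e1 e2 la i * wu e1 e2 i (row la i) = e2^-1 * (jack_up e1 e2 la i * weight e1 e2 i (row la i)).
      by rewrite /wu; ring.
    rewrite mulrA -rmorphM mulVKf // Dj varpi_padd // !rmorphM; ring.
  by rewrite (Ssum_moment2 gen tu); ring.
have j1 : j (padd (ones 0) 0) = p 0.
  rewrite -[RHS]mulr1 -(jb_vac jb) (jb_p0 jb) big_seq1; have [M0 _ _] := jack_up_moments gen (ones 0).
  by rewrite big_seq1 in M0; rewrite M0 scale1r.
have wE la i : e2 * (jack_up e1 e2 la i * wu e1 e2 i (row la i)) = jack_up e1 e2 la i * weight e1 e2 i (row la i).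
  by rewrite /wu; field.
move=> mu0 nu0; rewrite !Hj -rmorphM -/(D _).
apply: (functional_product so sf char0 jb jbs dual Dlin n2 j1 Drs) => // [la la0|x y x0 y0|x y x0 y0].
- by rewrite product_value_onebox Dp.
- exact: product_value_comm.
under eq_bigr do rewrite wE.
under [X in _ + X]eq_bigr do rewrite wE.
exact: product_value_deriv.
Qed.
End JackProducts.

Local Notation cm0 := (monalg.one : {cmonom nat}).
Local Notation cmul := (@monalg.mul {cmonom nat}).

Section Weights.
Variables (K : fieldType) (al : K).

Definition jack_weight (m : {cmonom nat}) : K := (zee m)%:R * al ^+ monalg.mdeg m.

Lemma zee_sub (d : {fset nat}) (m : {cmonom nat}) : (finsupp m `<=` d)%fset ->
  zee m = (\prod_(k <- d) (k.+1 ^ m k * (m k)`!))%N.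
Proof.
move=> le; rewrite [LHS](big_fset_incl _ le) // => k _.
by rewrite -cmE_eq0 => /eqP ->.
Qed.

Lemma jack_weight_pvar k m : jack_weight (cmul (ucm k) m) = k.+1%:R * al * (m k).+1%:R * jack_weight m.
Proof.
rewrite /jack_weight mdegM mdegU add1n exprS.
pose d := (k |` finsupp m)%fset.
have kd : k \in d by rewrite fset1U1.
have s1 : (finsupp m `<=` d)%fset by rewrite fsubsetUr.
have s2 : (finsupp (cmul (ucm k) m) `<=` d)%fset.
  by rewrite mdomD mdomU.
rewrite (zee_sub s1) (zee_sub s2) !(bigD1_seq k) ?fset_uniq //=.
have -> : cmul (ucm k) m k = (m k).+1 by rewrite cmM cmUU.
have -> : (\prod_(i <- d | i != k) (i.+1 ^ cmul (ucm k) m i * (cmul (ucm k) m i)`!) =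
   \prod_(i <- d | i != k) (i.+1 ^ m i * (m i)`!))%N.
  by apply: eq_bigr => i ik; rewrite cmM cmU eq_sym (negPf ik).
rewrite expnS factS !natrM.
move: (k.+1 ^ m k)%:R ((m k)`!)%:R (_ ^+ monalg.mdeg m) (k.+1%:R) ((m k).+1%:R) (\prod_(_ <- _ | _) _)%:R => a b c x y z.
by ring.
Qed.

Lemma jack_weight0 : jack_weight cm0 = 1.
Proof. by rewrite /jack_weight monalg.mdeg1 expr0 mulr1 /zee mdom1 big_seq_fset0. Qed.

Lemma jack_weight_neq0 m : (forall n, (n.+1%:R : K) != 0) -> al != 0 -> jack_weight m != 0.
Proof.
move=> c0 a0; elim/cmonom_ind: m => [|k m IHm]; first by rewrite jack_weight0 oner_neq0.
by rewrite jack_weight_pvar; do 2![apply: mulf_neq0 => //]; apply: mulf_neq0.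
Qed.

End Weights.

(** * The Jack form on monomials in the power sums *)

Section MonomialForm.
Variables (K : fieldType) (al : K) (F : comAlgType K) (p : nat -> F).
Variable mon : {cmonom nat} -> F.
Hypothesis mon1 : mon cm0 = 1.
Hypothesis monM : forall k m, p k * mon m = mon (cmul (ucm k) m).
Hypothesis mon_ind : forall P : F -> Prop, P 0 ->
  (forall c x y, P x -> P y -> P (c *: x + y)) -> (forall m, P (mon m)) -> forall f, P f.
Variable jf : F -> F -> K.
Hypothesis jfl : forall c f g h, jf (c *: f + g) h = c * jf f h + jf g h.
Hypothesis jfr : forall c f g h, jf h (c *: f + g) = c * jf h f + jf h g.
Hypothesis jfUU : forall m n, jf (mon m) (mon n) = (m == n)%:R * jack_weight al m.
Variables (pd : nat -> F -> F).
Hypothesis dpd : forall k, derivation (pd k).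
Hypothesis pdp : forall k i, pd k (p i) = (i == k)%:R.

Lemma bilinear_ext (B B' : F -> F -> K) :
  (forall c f g h, B (c *: f + g) h = c * B f h + B g h) ->
  (forall c f g h, B h (c *: f + g) = c * B h f + B h g) ->
  (forall c f g h, B' (c *: f + g) h = c * B' f h + B' g h) ->
  (forall c f g h, B' h (c *: f + g) = c * B' h f + B' h g) ->
  (forall m n, B (mon m) (mon n) = B' (mon m) (mon n)) -> forall f g, B f g = B' f g.
Proof.
move=> Bl Br Bl' Br' BU.
have Z0 (G : F -> K) : (forall c f g, G (c *: f + g) = c * G f + G g) -> G 0 = 0.
  by move=> Gl; have := Gl (-1) 0 0; rewrite scaler0 addr0 mulN1r addNr.
move=> f g; move: f; apply: mon_ind => [|c x y IHx IHy|m].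
- by rewrite (Z0 (fun f => B f g)) // (Z0 (fun f => B' f g)).
- by rewrite Bl Bl' IHx IHy.
move: g; apply: mon_ind => [|c x y IHx IHy|n].
- by rewrite (Z0 (fun f => B _ f)) // (Z0 (fun f => B' _ f)).
- by rewrite Br Br' IHx IHy.
exact: BU.
Qed.

Lemma monform_sym f g : jf f g = jf g f.
Proof.
apply: (bilinear_ext (B := fun f g => jf f g) (B' := fun f g => jf g f)) => // m n.
rewrite !jfUU [n == m]eq_sym; by case: eqP => [->|_]; rewrite ?mul0r.
Qed.

Lemma monformZr c f h : jf h (c *: f) = c * jf h f.
Proof.
have jf0 : jf h 0 = 0 by have := jfr (-1) 0 0 h; rewrite scaler0 addr0 mulN1r addNr.
by rewrite -[c *: f]addr0 jfr jf0 addr0.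
Qed.

(** If [m k] is 0, the truncated quotient is [m] itself and the coefficient kills it. *)
Lemma pd_monom k m : pd k (mon m) = (m k)%:R *: mon (divcm m (ucm k)).
Proof.
elim/cmonom_ind: m => [|i m IHm].
  by rewrite cm1 scale0r mon1 (derivation1 (dpd k)).
rewrite -monM (dpd k).2 pdp IHm -scalerAr monM.
have [->|ik] := eqVneq i k.
  have -> : divcm (cmul (ucm k) m) (ucm k) = m.
    by apply/eqP/cmP => j; rewrite divcmE cmM addKn.
  rewrite cmM cmUU mul1r; case: (posnP (m k)) => [->|mk].
    by rewrite scale0r addr0 addn0 scale1r.
  have -> : cmul (ucm k) (divcm m (ucm k)) = m.
    apply/eqP/cmP => j; rewrite cmM divcmE cmU; case: eqP => [<-|_] /=.
      by rewrite subnKC.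
    by rewrite subn0.
  by rewrite natrD scalerDl scale1r.
rewrite mul0r add0r cmM cmU (negPf ik) add0n; congr (_ *: mon _).
apply/eqP/cmP => j; rewrite !(cmM, divcmE, cmU).
by case: (i =P j) => [<-|_]; rewrite ?[k == _]eq_sym ?(negPf ik) ?subn0.
Qed.

Lemma monform_pd k (f g : F) : jf (p k * f) g = k.+1%:R * al * jf f (pd k g).
Proof.
have H1 c x y h : jf (p k * (c *: x + y)) h = c * jf (p k * x) h + jf (p k * y) h.
  by rewrite mulrDr -scalerAr jfl.
have H2 c x y h : k.+1%:R * al * jf (c *: x + y) (pd k h) =
    c * (k.+1%:R * al * jf x (pd k h)) + k.+1%:R * al * jf y (pd k h).
  by rewrite jfl; move: (jf _ _) (jf _ _) => a b; ring.
have H3 c x y h : k.+1%:R * al * jf h (pd k (c *: x + y)) =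
    c * (k.+1%:R * al * jf h (pd k x)) + k.+1%:R * al * jf h (pd k y).
  by rewrite (dpd k).1 jfr; move: (jf _ _) (jf _ _) => a b; ring.
refine (bilinear_ext (B := fun f g => jf (p k * f) g) (B' := fun f g => k.+1%:R * al * jf f (pd k g))
  H1 (fun c f g h => jfr c f g _) H2 H3 _ f g) => m n.
rewrite monM pd_monom monformZr !jfUU jack_weight_pvar.
have [<-|ne] := eqVneq (cmul (ucm k) m) n.
  rewrite cmM cmUU mul1r.
  have -> : divcm (cmul (ucm k) m) (ucm k) = m.
    by apply/eqP/cmP => j; rewrite divcmE cmM addKn.
  by rewrite eqxx add1n mul1r; move: (jack_weight al m) => w; ring.
rewrite mul0r; have [nk|nk] := posnP (n k); first by rewrite nk mul0r mulr0.
case: eqP => [E|_]; last by rewrite mul0r !mulr0.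
case/eqP: ne; apply/eqP/cmP => j; rewrite E cmM divcmE cmU; case: eqP => [<-|_] /=.
  by rewrite subnKC.
by rewrite subn0.
Qed.

Lemma ppart_monom (r : seq nat) : 0%N \notin r ->
  exists m : {cmonom nat}, ppart (p) r = mon m /\ forall k, m k = count_mem k.+1 r.
Proof.
rewrite /ppart; elim: r => [|k r IHr] r0.
  by exists cm0; split=> [|k]; rewrite ?big_nil ?cm1.
move: r0; rewrite inE negb_or => /andP[k0 /IHr[m [Em Cm]]].
exists (cmul (ucm k.-1) m); split; first by rewrite big_cons Em monM.
by case: k k0 => // k _ i; rewrite cmM cmU Cm /= eqSS.
Qed.

Lemma mon_symform : (forall n, (n.+1%:R : K) != 0) -> al != 0 ->
  symform (p) pd al jf.
Proof.
move=> c0 a0; split.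
- exact: jfl.
- exact: monform_sym.
- exact: monform_pd.
- by rewrite -mon1 jfUU eqxx mul1r jack_weight0.
- move=> rho sig ne.
  have [m [-> Cm]] := ppart_monom (intpart_no0 rho); have [n [-> Cn]] := ppart_monom (intpart_no0 sig).
  rewrite jfUU; case: eqP => [E|_]; last by rewrite mul0r.
  case: ne; apply: intpart_perm.
  apply/allP => k _; apply/eqP; case: k => [|k] /=; last by rewrite -Cm -Cn E.
  by rewrite !(count_memPn _) ?intpart_no0.
move=> rho; have [m [-> _]] := ppart_monom (intpart_no0 rho).
by rewrite jfUU eqxx mul1r jack_weight_neq0.
Qed.

End MonomialForm.

Section JackForm.
Variable (K : fieldType).
Local Notation F := {malg K[{cmonom nat}]}.

Lemma pvar_gen : generated_by (F := F) (pvar K).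
Proof. exact: psum_ind. Qed.

Lemma pvar_univ (S : comNzRingType) (c : {rmorphism K -> S}) (v : nat -> S) :
  exists2 h : {rmorphism F -> S}, evaluates (F := F) (pvar K) c v h &
    forall f, peval c v f = h f.
Proof. by exists (peval c v) => //; split; [exact: pevalZ | exact: peval_pvar]. Qed.

Variable al : K.
Local Notation jf := (jack_form al).

Lemma jack_formP c (f g h : F) : jf (c *: f + g) h = c * jf f h + jf g h.
Proof.
have E (x : F) : jf x h = linext (V := K^o) (fun m => monalg.mcoeff m h * jack_weight al m) x.
  by apply: eq_bigr => m _; rewrite -mulrA.
by rewrite !E linearP.
Qed.

Lemma jack_formUl m (g : F) : jf << m >> g = monalg.mcoeff m g * jack_weight al m.
Proof. by rewrite /jack_form msuppU oner_eq0 big_seq_fset1 mcoeffUU mul1r. Qed.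

Lemma jack_formPr c (f g h : F) : jf h (c *: f + g) = c * jf h f + jf h g.
Proof.
rewrite /jack_form mulr_sumr -big_split; apply: eq_bigr => m _ /=.
rewrite monalg.mcoeffD monalg.mcoeffZ -/(jack_weight al m).
by move: (monalg.mcoeff m h) (monalg.mcoeff m f) (monalg.mcoeff m g) (jack_weight al m) => x y z w; ring.
Qed.

Lemma jack_formUU m n : jf << m >> << n >> = (m == n)%:R * jack_weight al m.
Proof. by rewrite jack_formUl mcoeffU eq_sym. Qed.

Lemma jack_symform (pd : nat -> F -> F) :
  (forall k, derivation (F := F) (pd k)) -> (forall k i, pd k (pvar K i) = (i == k)%:R) ->
  (forall n, (n.+1%:R : K) != 0) -> al != 0 -> symform (F := F) (pvar K) pd al jf.
Proof.
exact: (mon_symform (F := F) (mon := fun m => << m >>) erefl (@pvarM K) (@malg_lin_ind K _) jack_formP jack_formPr jack_formUU).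
Qed.

Lemma jack_form_nondeg (f : F) : (forall n, (n.+1%:R : K) != 0) -> al != 0 ->
  (forall g, jf g f = 0) -> f = 0.
Proof.
move=> c0 a0 f0; apply/malgP => m; rewrite monalg.mcoeff0.
have := f0 << m >>; rewrite jack_formUl => /eqP.
by rewrite mulf_eq0 (negPf (jack_weight_neq0 m c0 a0)) orbF => /eqP.
Qed.
End JackForm.

(** * Monomial expansions *)

Lemma sumn_filter_neq0 (s : seq nat) : sumn [seq e <- s | e != 0%N] = sumn s.
Proof. by elim: s => //= -[|k] s IHs /=; rewrite IHs. Qed.

Section MonomialExpansion.
Variables (K : fieldType) (N : nat).
Implicit Types (m : 'X_{1..N}) (mu la : intpart).

Lemma mdeg_sumn m : mdeg m = sumn [seq e <- m | e != 0%N].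
Proof. by rewrite sumn_filter_neq0 sumnE. Qed.

Lemma mcoeff_msympoly mu m :
  (msympoly K N mu)@_m = (perm_eq [seq e <- m | e != 0%N] mu)%:R.
Proof.
rewrite /msympoly raddf_sum /=; case: (boolP (perm_eq _ _)) => pm; last first.
  rewrite big1 // => m' pm'; rewrite mcoeffX; case: (_ =P m) => // E.
  by move: pm; rewrite -E pm'.
have dm : (mdeg m < (sumn mu).+1)%N by rewrite mdeg_sumn (perm_sumn pm).
rewrite (bigD1 (BMultinom dm)) //= mcoeffX eqxx big1 ?addr0 // => m' /andP[_ ne].
by rewrite mcoeffX; case: eqP => // E; case/eqP: ne; apply: val_inj.
Qed.

Lemma mcoeff_Xn_mul (t : 'I_N) i (q : mpoly N K) m :
  ('X_t ^+ i * q)@_m = if (i <= m t)%N then q@_(m - U_(t) *+ i)%MM else 0.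
Proof.
rewrite mpolyXn mulrC; case: ifP => im.
  have le : (U_(t) *+ i <= m)%MM.
    by apply/mnm_lepP => j; rewrite mulmnE mnm1E; case: (t =P j) => [<-|_]; rewrite ?mul1n ?mul0n.
  by rewrite -[m in LHS](submK le) addmC mcoeffMX.
rewrite [q]mpolyE mulr_suml raddf_sum big1 // => k _ /=.
rewrite -scalerAl -mpolyXD mcoeffZ mcoeffX; case: eqP => [E|_]; last by rewrite mulr0.
by move: im; rewrite -E mnmDE mulmnE mnm1E eqxx mul1n leq_addl.
Qed.

Lemma multinom_sub_seq (t : 'I_N) i m :
  (m - U_(t) *+ i)%MM = set_nth 0%N m t (nth 0%N m t - i)%N :> seq nat.
Proof.
have sz : size (set_nth 0%N m t (nth 0%N m t - i)%N) = N.
  by rewrite size_set_nth size_tuple; apply/maxn_idPr.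
apply: (@eq_from_nth _ 0%N) => [|k]; rewrite ?sz size_tuple // => kN.
pose o := Ordinal kN; have E (n : 'X_{1..N}) : nth 0%N n k = n o by rewrite (mnm_nth 0%N).
rewrite nth_set_nth E mnmBE mulmnE mnm1E /= E -(mnm_nth 0%N m t).
rewrite -[t == o]/(val t == k) eq_sym; case: eqP => [kt|_]; last by rewrite mul0n subn0.
by rewrite mul1n; congr (_ - _)%N; congr (m _); apply: val_inj.
Qed.
End MonomialExpansion.

Section Evaluation.
Variables (K : fieldType) (F : comAlgType K) (p : nat -> F).
Variables (pd : nat -> F -> F) (rs lw dg : F -> F) (al : K) (jf : F -> F -> K).
Hypothesis so : symops p pd rs lw dg.
Hypothesis sf : symform p pd al jf.
Variable tau : {rmorphism F -> {poly F}}.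
Hypothesis tauE : evaluates p (polyC \o GRing.in_alg F) (fun k => (p k)%:P + 'X^(k.+1)) tau.
Local Notation R := (var_coef tau).
Local Notation ev := (xcoef jf tau).
Let tauZ c f : tau (c *: f) = (c%:A)%:P * tau f. Proof. by rewrite tauE.1. Qed.
Let taup := tauE.2.

Lemma xcoef_1 s : ev s 1 = (all (eq_op^~ 0%N) s)%:R.
Proof.
elim: s => [|k s IHs] /=; first exact: jf_11 sf.
rewrite (var_coef_1 tau); case: eqP => _ /=; first exact: IHs.
exact: (xcoef0 sf tau).
Qed.

(** Each position [t] is a variable whose power of exponent i+1 may be taken from [p i]. Nothing is
    left after the last variable, since [p i] times a function has no constant term. *)
Lemma xcoef_pM s i f : ev s (p i * f) = \sum_(t < size s)
  if (i < nth 0%N s t)%N then ev (set_nth 0%N s t (nth 0%N s t - i.+1)%N) f else 0.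
Proof.
elim: s f => [|k s IHs] f.
  rewrite big_ord0 /= (jf_p sf) (derivation1 (so_pd so i)) (jf_sym sf) (jf0 sf) mulr0.
  by [].
rewrite /= (var_coef_pM taup) (xcoefD sf tauZ) IHs big_ord_recl /= addrC; congr (_ + _).
by rewrite leqNgt; case: (i < k)%N => //=; rewrite (xcoef0 sf tau).
Qed.

Variables (N : nat) (rh : {rmorphism F -> mpoly N K}).
Hypothesis rhE : evaluates p (@mpolyC N K) (fun k => \sum_(i < N) 'X_i ^+ k.+1) rh.

(** Identifies [xcoef], built from [tau] and the form, with the coefficient in N variables: both
    follow the same rule for multiplication by a power sum. *)
Lemma xcoef_symrestr f (m : 'X_{1..N}) : ev m f = (rh f)@_m.
Proof.
move: f m; apply: (so_gen so) => [m|k f IHf m|m|c f g IHf IHg m].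
- rewrite xcoef_1 rmorph1 mcoeff1; congr _%:R; congr nat_of_bool; apply/allP/eqP => [H|->].
    apply/mnmP => i; rewrite mnm0E (mnm_nth 0); apply/eqP/H/mem_nth.
    by rewrite size_tuple.
  by move=> x /tnthP[i ->]; rewrite -mnm_tnth mnm0E.
- rewrite xcoef_pM rmorphM /= rhE.2 mulr_suml raddf_sum /= size_tuple.
  apply: eq_bigr => t _; rewrite mcoeff_Xn_mul -(mnm_nth 0 m t); case: ifP => // _.
  by rewrite -IHf multinom_sub_seq (mnm_nth 0).
- by rewrite (xcoef0 sf tau) rmorph0 mcoeff0.
by rewrite (xcoef_lin sf tauZ) rmorphD /= rhE.1 mcoeffD mcoeffCM IHf IHg.
Qed.

Lemma xcoef_mexpansion (r : seq intpart) (c : intpart -> K) f :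
  rh f = \sum_(mu <- r) c mu *: msympoly K N mu ->
  forall s, size s = N -> ev s f = \sum_(mu <- r | perm_eq [seq e <- s | e != 0%N] mu) c mu.
Proof.
move=> rf s sN; pose m : 'X_{1..N} := Multinom (tcast sN (in_tuple s)).
have sm : s = m :> seq nat by rewrite /= val_tcast.
rewrite sm xcoef_symrestr rf raddf_sum [RHS]big_mkcond; apply: eq_bigr => mu _ /=.
by rewrite mcoeffZ mcoeff_msympoly; case: ifP => _; rewrite ?mulr1 ?mulr0.
Qed.
End Evaluation.

(** As long as the rows agree, dominance passes to the tails; at the first difference the partial
    sums compare the rows themselves. A longer [mu] is excluded because its parts are nonzero. *)
Lemma dominated_lexb (mu la : intpart) : dominated mu la -> lexb mu la.
Proof.
case=> _; move: (intpart_no0 mu); elim: (mu : seq nat) (la : seq nat) => [|x s IHs] [|y t] //=.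
  by rewrite inE negb_or => /andP[x0 _] /(_ 1%N) /=; rewrite take0 addn0 leqn0 eq_sym (negPf x0).
rewrite inE negb_or => /andP[_ s0] dom.
have := dom 1%N; rewrite /= !take0 !addn0 leq_eqVlt => /orP[/eqP E|->//].
rewrite E eqxx ltnn /=; apply: (IHs _ s0) => k.
by have := dom k.+1; rewrite /= E leq_add2l.
Qed.

Lemma eps_generic (R : realType) : generic (eps1 R) (eps2 R).
Proof.
have E i j : weight (eps1 R) (eps2 R) i j = tofrac (i%:R * 'X_0 + j%:R * 'X_1 : mpoly 2 R[i]).
  by rewrite rmorphD !rmorphM !rmorph_nat.
move=> i j k l /eqP; rewrite !E tofrac_eq => /eqP /(congr1 (fun q : mpoly 2 R[i] => (q@_U_(0), q@_U_(1)))).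
rewrite !mcoeffD !mulr_natl !mcoeffMn !mcoeffXU /= !mul0rn !addr0 !add0r => -[/eqP + /eqP].
by rewrite !eqr_nat => /eqP -> /eqP ->.
Qed.

Lemma uvar_transc (K : fieldType) : transc (@Kconst K) (uvar K).
Proof.
move=> x; rewrite tofrac_eq; apply/eqP => /(congr1 (fun q : {poly K} => size q)).
by rewrite size_polyX size_polyC; case: (x != 0).
Qed.

(** * Coefficients of the given Jack family *)

Section Jack.
Variables (K : fieldType) (e1 e2 : K).
Hypothesis gen : generic e1 e2.
Local Notation F := {malg K[{cmonom nat}]}.
Local Notation al := (- e2 / e1).
Variable J : intpart -> F.
Hypothesis JJ : is_jack_family al J.
Variable tau : {rmorphism F -> {poly F}}.
Hypothesis tauE : evaluates (F := F) (pvar K) (polyC \o GRing.in_alg F)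
  (fun k => (pvar K k)%:P + 'X^(k.+1)) tau.
Variables (pd : nat -> F -> F) (rs lw dg : F -> F).
Hypothesis so : symops (F := F) (pvar K) pd rs lw dg.
Hypothesis sf : symform (F := F) (pvar K) pd al (jack_form al).
Local Notation ev := (xcoef (F := F) (jack_form al) tau).

(** The coefficient at the exponent list [s] is read from the restriction to exactly [size s]
    variables. *)
Lemma jack_family_ev (la : intpart) : exists c : {malg K[intpart]},
  [/\ forall s, ev s (J la) = \sum_(mu <- monalg.msupp c | perm_eq [seq e <- s | e != 0%N] mu) monalg.mcoeff mu c,
      forall mu : intpart, mu \in monalg.msupp c -> dominated mu la
    & monalg.mcoeff (ones (sumn la)) c = ((sumn la)`!)%:R].
Proof.
have [_ /(_ la)[c [expc domc onec]]] := JJ; exists c; split=> // s.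
have [rh rhE rhf] := pvar_univ (@mpolyC (size s) K) (fun k => \sum_(i < size s) 'X_i ^+ k.+1).
have E := expc (size s); rewrite /symrestr rhf in E.
exact: (xcoef_mexpansion so sf tauE rhE E erefl).
Qed.

Lemma jack_family_dominated (la : intpart) s : ev s (J la) != 0 ->
  exists2 mu, dominated mu la & perm_eq [seq e <- s | e != 0%N] mu.
Proof.
have [c [-> dom _]] := jack_family_ev la => nz.
suff /hasP[mu /dom] : has (fun mu : intpart => perm_eq [seq e <- s | e != 0%N] mu) (monalg.msupp c).
  by exists mu.
apply: contraNT nz => /hasPn H; rewrite big1_seq // => mu /andP[pm /H].
by rewrite pm.
Qed.

Lemma jack_family_sumn (la : intpart) s : ev s (J la) != 0 -> sumn s = sumn la.
Proof.
by case/jack_family_dominated => mu [<- _] /perm_sumn <-; rewrite sumn_filter_neq0.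
Qed.

Lemma jack_family_lexb (la rho : intpart) : ev rho (J la) != 0 -> lexb rho la.
Proof.
case/jack_family_dominated => mu dom; rewrite filter_parts => /intpart_perm ->.
exact: dominated_lexb.
Qed.

Lemma jack_family_ones (la : intpart) : ev (nseq (sumn la) 1%N) (J la) = ((sumn la)`!)%:R.
Proof.
have [c [-> _ <-]] := jack_family_ev la.
have -> : nseq (sumn la) 1%N = ones (sumn la) by [].
rewrite filter_parts -big_filter; set r := [seq mu <- _ | _].
have rE mu : mu \in r = (mu == ones (sumn la)) && (mu \in monalg.msupp c).
  rewrite mem_filter; congr (_ && _); apply/idP/eqP => [pm|->].
    exact/esym/intpart_perm.
  exact: perm_refl.
have [iN|niN] := boolP (ones (sumn la) \in monalg.msupp c).
  rewrite (bigD1_seq (ones (sumn la))) ?filter_uniq ?fset_uniq //=; last by rewrite rE eqxx.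
  by rewrite big1_seq ?addr0 // => mu /andP[/negPf ne]; rewrite rE ne.
rewrite monalg.mcoeff_outdom // big1_seq // => mu /andP[_]; rewrite rE => /andP[/eqP ->].
by rewrite (negPf niN).
Qed.
End Jack.

Lemma parts_neq0 (la : intpart) : parts la <> [::] -> la <> ones 0.
Proof. by move=> H E; apply: H; rewrite E. Qed.

Local Notation malgF K := {malg K[{cmonom nat}]}.

Theorem jack_product_malg (K : fieldType) (e1 e2 : K)
    (J : intpart -> {malg K[{cmonom nat}]})
    (Delta : {malg K[{cmonom nat}]} -> {fraction {poly K}})
    (mu nu : intpart) :
  generic e1 e2 -> is_jack_family (- e2 / e1) J ->
  (forall c f g, Delta (c *: f + g) = Kconst c * Delta f + Delta g) ->
  (forall la : intpart,
     Delta (hjack e1 J la) = Kconst (varpi e1 e2 la) *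
       \sum_(s <- boxes la) 1 / (uvar K - Kconst (brak e1 e2 s))) ->
  parts mu <> [::] -> parts nu <> [::] ->
  Delta (hjack e1 J mu * hjack e1 J nu) =
  Kconst (varpi e1 e2 mu * varpi e1 e2 nu) * (starT e1 e2 mu nu - 1).
Proof.
move=> gen JJ Dl DE mu0 nu0.
have c0 := gen_nat gen.
have al0 : - e2 / e1 != 0 by rewrite mulf_neq0 ?oppr_eq0 ?invr_eq0 ?(gen_e1 gen) ?(gen_e2 gen).
have univ (S : comNzRingType) (c : {rmorphism K -> S}) v : exists h : {rmorphism malgF K -> S}, evaluates (F := malgF K) (pvar K) c v h.
  by have [h hE _] := pvar_univ c v; exists h.
have [pd [rs [lw [dg so]]]] := symops_exists (F := malgF K) (@pvar_gen K) univ.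
have sf := jack_symform (so_pd so) (so_pdp so) c0 al0.
have [tau tauE _] := pvar_univ (polyC \o GRing.in_alg (malgF K)) (fun k => (pvar K k)%:P + 'X^(k.+1)).
have [s sE sf'] := pvar_univ (GRing.in_alg (malgF K)) (fun k => (- e1)^-1 *: pvar K k).
have nd f : (forall g, jack_form (- e2 / e1) f g = 0) -> f = 0.
  by move=> H; apply: (jack_form_nondeg c0 al0) => g; rewrite (jf_sym sf) H.
have HE (la : intpart) : hjack e1 J la = (- e1) ^+ sumn la *: s (J la) by rewrite -sf'.
rewrite !HE.
have DE' (la : intpart) : Delta ((- e1) ^+ sumn la *: s (J la)) = Kconst (varpi e1 e2 la) * Ssum e1 e2 (@Kconst K) (uvar K) la.
  by rewrite -HE DE.
have H := jack_product (F := malgF K) gen so univ sf nd (malg_freemod K intpart) tauE JJ.1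
  (jack_family_sumn JJ tauE so sf) (jack_family_lexb JJ tauE so sf) (jack_family_ones JJ tauE so sf)
  sE (@uvar_transc K) Dl DE' (parts_neq0 mu0) (parts_neq0 nu0).
have E : product_value e1 e2 (@Kconst K) (uvar K) mu nu = Kconst (varpi e1 e2 mu * varpi e1 e2 nu) * (starT e1 e2 mu nu - 1).
  by [].
rewrite -E.
exact: H.
Qed.

Theorem mainTheorem2 (R : realType)
    (J : intpart -> {malg (Keps R)[{cmonom nat}]})
    (Delta : {linear {malg (Keps R)[{cmonom nat}]} ->
                {fraction {poly (Keps R)}} | @Kconst (Keps R) \; *%R})
    (mu nu : intpart) :
  is_jack_family (- eps2 R / eps1 R) J ->
  (forall la : intpart,
     Delta (hjack (eps1 R) J la) =
     Kconst (varpi (eps1 R) (eps2 R) la) *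
       \sum_(s <- boxes la)
         1 / (uvar (Keps R) - Kconst (brak (eps1 R) (eps2 R) s))) ->
  parts mu <> [::] -> parts nu <> [::] ->
  Delta (hjack (eps1 R) J mu * hjack (eps1 R) J nu) =
  Kconst (varpi (eps1 R) (eps2 R) mu * varpi (eps1 R) (eps2 R) nu) *
    (starT (eps1 R) (eps2 R) mu nu - 1).
Proof.
move=> JJ DE mu0 nu0.
have Dl c f g : Delta (c *: f + g) = Kconst c * Delta f + Delta g by exact: linearP.
exact: (jack_product_malg (@eps_generic R) JJ Dl DE mu0 nu0).
Qed.
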